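(* Let $M$ be a special almost Hermitian $2n$-manifold with $n\ge4$. Then the exterior derivatives of $\psi_+$ and $\psi_-$ satisfy $$d\psi_+,\,d\psi_-\in T^*M\wedge[\![\lambda^{n-2,0}]\!]\wedge\omega=\mathcal W_1^a+\mathcal W_2^a+\mathcal W_{4,5}^a,$$ where $\widetilde a_\pm(\mathcal W_1^\Xi)=\mathcal W_1^a$, $\widetilde a_\pm(\mathcal W_2^\Xi)=\mathcal W_2^a$ and $\widetilde a_\pm(\mathcal W_4^\Xi)=\widetilde a_\pm(\mathcal W_5^\mp)=\mathcal W_{4,5}^a$. Moreover, $\ker(\widetilde a_\pm)=\mathcal W_3^\Xi+\mathcal A_\pm$, where $T^*M\cong\mathcal A_\pm\subseteq\mathcal W_4^\Xi+\mathcal W_5^\mp$, and the modules $\mathcal W_i^a$ are described by $$\mathcal W_1^a=[\![\lambda^{n-3,0}]\!]\wedge\omega\wedge\omega,$$ $$\mathcal W_2^a=\{b\in T^*M\wedge[\![\lambda^{n-2,0}]\!]\wedge\omega\mid b\wedge\omega=0\text{ and }\ast b\wedge\psi_+=0\}=\{b\in T^*M\wedge[\![\lambda^{n-2,0}]\!]\wedge\omega\mid b\wedge\omega=0\text{ and }\ast b\wedge\psi_-=0\},$$ $$\mathcal W_{4,5}^a=T^*M\wedge\psi_+=T^*M\wedge\psi_-=[\![\lambda^{n-1,0}]\!]\wedge\omega.$$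
   Context: A special almost Hermitian $2n$-manifold ($SU(n)$-structure) is a $2n$-manifold $M$ with a Riemannian metric $\langle\cdot,\cdot\rangle$, an orthogonal almost complex structure $I$, and a complex volume form $\Psi=\psi_++i\psi_-$ of unit length; vectors are identified with one-forms by $x\mapsto\langle\cdot,x\rangle$, and locally there are orthonormal (adapted) frames $e_1,\dots,e_n,Ie_1,\dots,Ie_n$ with $\Psi=(e_1+iIe_1)\wedge\dots\wedge(e_n+iIe_n)$. Kähler form: $\omega(x,y)=\langle x,Iy\rangle$. The real volume form $Vol$ is fixed by $(-1)^{n(n+1)/2}n!\,Vol=\omega^n$, and $\ast$ is the associated Hodge star. Statements about modules are fibrewise; $+$ between modules denotes direct sum; repeated indices in $e_i$ are summed over an orthonormal basis of the real tangent space. For a $(0,s)$-tensor $b$: $I_{(i)}b(X_1,\dots,X_s)=-b(X_1,\dots,IX_i,\dots,X_s)$. $[\![\lambda^{1,0}]\!]=T^*M$ and for $p\ge2$, $[\![\lambda^{p,0}]\!]=\{b\in\Lambda^pT^*M\mid I_{(i)}I_{(j)}b=-b,\ 1\le i<j\le p\}$. $\mathfrak u(n)^\perp=[\![\lambda^{2,0}]\!]\subset\Lambda^2T^*M$, and $T^*M\otimes\mathfrak u(n)^\perp=\mathcal W_1+\mathcal W_2+\mathcal W_3+\mathcal W_4$ is the Gray–Hervella decomposition into irreducible $U(n)$-modules: $a\in\mathcal W_1$ iff $a$ is totally skew; $a\in\mathcal W_2$ iff the cyclic sum of $a(X,Y,Z)$ vanishes; $a\in\mathcal W_3$ iff $a(IX,IY,Z)=a(X,Y,Z)$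 and $a(e_i,e_i,Z)=0$; $\mathcal W_4=\{e_i\otimes(e_i\wedge\mu-Ie_i\wedge I\mu)\mid\mu\in T^*M\}$, $(I\mu)(X)=-\mu(IX)$. $\Xi_\pm:T^*M\otimes\mathfrak u(n)^\perp\to T^*M\otimes\Lambda^nT^*M$ are $\Xi_+(a)_X=\frac12(e_i\lrcorner a_X)\wedge(e_i\lrcorner\psi_-)$ and $\Xi_-(a)_X=-\frac12(e_i\lrcorner a_X)\wedge(e_i\lrcorner\psi_+)$, with $a_X=a(X,\cdot,\cdot)$. $\mathcal W_i^\Xi=\Xi_+(\mathcal W_i)=\Xi_-(\mathcal W_i)$, $\mathcal W^\Xi=T^*M\otimes[\![\lambda^{n-2,0}]\!]\wedge\omega=\mathcal W_1^\Xi+\dots+\mathcal W_4^\Xi$, $\mathcal W_5^\pm=T^*M\otimes\psi_\pm$. The maps $\widetilde a_\pm:\mathcal W^\Xi+\mathcal W_5^\mp\to\Lambda^{n+1}T^*M$ are the restrictions of the alternation map $\alpha\otimes\beta\mapsto\alpha\wedge\beta$ (one has $\nabla\psi_\pm\in\mathcal W^\Xi+\mathcal W_5^\mp$ and $d\psi_\pm=\widetilde a_\pm(\nabla\psi_\pm)$). *)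

(* Defs.v *)
From mathcomp Require Import all_boot all_order all_algebra.
From mathcomp Require Import all_classical all_reals all_analysis.
From mathcomp Require Import complex.

Set Implicit Arguments.
Unset Strict Implicit.
Unset Printing Implicit Defensive.

Import Order.TTheory GRing.Theory Num.Theory numFieldNormedType.Exports.
Local Open Scope classical_set_scope.
Local Open Scope ring_scope.

(* A tensor on [V] is a function of the list of its arguments; a tensor of
  degree k vanishes on every list whose length is not k.  Thus tensors of all
  degrees live in one pointwise module and no degree casts are needed.  A
  (0, 1+s)-tensor seen in [V^* (x) T^s] has the [V^*] slot first. *)

Notation tensor K V := (seq V -> K).

Section Exterior.
Variables (K : comNzRingType) (V : Type).
Implicit Types (a b : tensor K V) (X : V) (s : seq V).

Definition tensor_one : tensor K V := fun s => (nilp s)%:R.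

(* The number of pairs i < j such that position i is not selected and
   position j is: the length of the shuffle moving selected entries first. *)
Definition shuffle_inv k (m : k.-tuple bool) : nat :=
  (\sum_(i < k) \sum_(j < k | i < j) (~~ tnth m i && tnth m j))%N.

(* Determinant convention: (al /\ be)(X,Y) = al(X) be(Y) - al(Y) be(X) for
   1-forms.  The sum is over the shuffles; only those whose selected part has
   the degree of [a] contribute. *)
Definition ewedge a b : tensor K V := fun s =>
  \sum_(m : (size s).-tuple bool)
    (-1) ^+ shuffle_inv m * a (mask m s) * b (mask (map negb m) s).

Definition contract X b : tensor K V := fun s => b (X :: s).

(* Only used with a 1-form as left factor. *)
Definition otimes a b : tensor K V := fun s => a (take 1%N s) * b (behead s).

(* The linear extension of al (x) be |-> al /\ be to V^* (x) Lambda^p: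
   (alt t)(X_0,...,X_p) = sum_i (-1)^i t(X_i; X_0,..,^X_i,..,X_p). *)
Definition alt (t : tensor K V) : tensor K V := fun s =>
  \sum_(i < size s)
    (-1) ^+ i * t (tnth (in_tuple s) i :: take i s ++ drop i.+1 s).

Definition pullback (h : V -> V) b : tensor K V := fun s => b (map h s).

End Exterior.

Arguments tensor_one {K V}.
Arguments alt {K V} t s.

Section Subspaces.
Variables (R : nzRingType) (W : lmodType R).
Implicit Types A B S : set W.

Definition lin_span S : set W :=
  [set w | exists k (c : 'I_k -> R) (v : 'I_k -> W),
     (forall i, S (v i)) /\ w = \sum_i c i *: v i].

Definition is_subspace A : Prop :=
  A 0 /\ forall c u v, A u -> A v -> A (c *: u + v).

Definition sum_space A B : set W := [set a + b | a in A & b in B].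

(* S is the internal direct sum of the subspaces in the list. *)
Definition is_direct_sum (As : seq (set W)) S : Prop :=
  S = [set w | exists u : 'I_(size As) -> W,
         (forall i : 'I_(size As), nth set0 As i (u i)) /\ w = \sum_i u i]
  /\ forall u : 'I_(size As) -> W, (forall i : 'I_(size As), nth set0 As i (u i)) ->
       \sum_i u i = 0 -> forall i, u i = 0.

End Subspaces.

Section Fibre.
Variables (R : realType) (V : lmodType R).
Local Notation T := (tensor R V).
Implicit Types (a b t mu : T) (X Y Z : V).

Definition homogeneous k b := forall s, size s != k -> b s = 0.

Definition multilinear b := forall s1 s2 (c : R) X Y,
  b (s1 ++ (c *: X + Y) :: s2) = c * b (s1 ++ X :: s2) + b (s1 ++ Y :: s2).

Definition alternating b := forall s1 s2 s3 X,
  b (s1 ++ X :: s2 ++ X :: s3) = 0.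

Definition is_form k b := [/\ homogeneous k b, multilinear b & alternating b].

Definition kforms k : set T := [set b | is_form k b].

Definition wedge_space (A B : set T) : set T :=
  lin_span [set ewedge a b | a in A & b in B].

Definition tensor_space (A B : set T) : set T :=
  lin_span [set otimes a b | a in A & b in B].

Record su_data := SUData {
  met : V -> V -> R;
  acs : V -> V;
  psi_plus : T;
  psi_minus : T
}.

Variable D : su_data.
Local Notation I := (acs D).

(* [true] stands for the sign +, [false] for -. *)
Definition psi (eps : bool) : T := if eps then psi_plus D else psi_minus D.

Definition flat X : T := fun s => if s is [:: Y] then met D X Y else 0.

Definition kahler : T := fun s => if s is [:: X; Y] then met D X (I Y) else 0.

Local Notation om := kahler.

(* Slots are numbered from 0. *)
Definition Iact (i : nat) b : T := fun s =>
  - b (mkseq (fun k => if k == i then I s`_k else s`_k) (size s)).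

(* For p = 1 the condition is void and this is the whole cotangent space. *)
Definition lam p : set T :=
  [set b | kforms p b /\
     forall i j, (i < j < p)%N -> Iact i (Iact j b) = - b].

Definition is_orthonormal k (e : 'I_k -> V) :=
  forall i j, met D (e i) (e j) = (i == j)%:R.

(* The complex 1-form e + i Ie. *)
Definition theta X : tensor R[i] V := fun s =>
  (flat X s +i* flat (I X) s)%C.

Definition adapted n (e : 'I_n -> V) :=
  [/\ is_orthonormal e,
      (forall i j, met D (e i) (I (e j)) = 0) &
      forall s, (psi_plus D s +i* psi_minus D s)%C =
                (\big[@ewedge R[i] V/tensor_one]_(i < n) theta (e i)) s].

(* The adapted frame carries the type and the unit length of
   psi_plus + i psi_minus. *)
Definition su_fibre n :=
  [/\ (forall c X Y Z, met D (c *: X + Y) Z = c * met D X Z + met D Y Z),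
      (forall X Y, met D X Y = met D Y X),
      (forall X, X != 0 -> 0 < met D X X),
      (forall c X Y, I (c *: X + Y) = c *: I X + I Y)
    & [/\ (forall X, I (I X) = - X),
          (forall X Y, met D (I X) (I Y) = met D X Y),
          kforms n (psi_plus D), kforms n (psi_minus D)
        & exists e : 'I_n -> V, adapted e]].

(* The group SU(n) of the fibre; an isometry is invertible. *)
Definition su_map (h : {linear V -> V}) :=
  [/\ (forall X Y, met D (h X) (h Y) = met D X Y),
      (forall X, h (I X) = I (h X)),
      pullback h (psi_plus D) = psi_plus D
    & pullback h (psi_minus D) = psi_minus D].

(* A is a submodule isomorphic, as an SU(n)-module, to the cotangent space. *)
Definition iso_cotangent (A : set T) :=
  is_subspace A /\
  exists f : T -> T,
    [/\ set_bij (kforms 1%N) A f,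
        (forall c mu nu, kforms 1%N mu -> kforms 1%N nu ->
           f (c *: mu + nu) = c *: f mu + f nu)
      & (forall h mu, su_map h -> kforms 1%N mu ->
           f (pullback h mu) = pullback h (f mu))].

(* From (-1)^(n(n+1)/2) n! Vol = om^n. *)
Definition vol n : T :=
  ((-1) ^+ (n * n.+1)./2 / n`!%:R) *:
    (\big[@ewedge R V/tensor_one]_(i < n) om).

Section Frame.
Variables (n : nat) (e : 'I_(n.*2) -> V).

(* Hodge star of the k-form b.  For an orthonormal basis e this is the
   solution of  al /\ star b = <al, b> Vol  for all k-forms al, where
   <al, b> = 1/k! sum_j al(e_j1,..,e_jk) b(e_j1,..,e_jk). *)
Definition star k b : T := fun s =>
  (k`!%:R)^-1 * \sum_(j : {ffun 'I_k -> 'I_(n.*2)})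
     b [seq e (j i) | i : 'I_k] * vol n ([seq e (j i) | i : 'I_k] ++ s).

(* T^* (x) u(n)^perp, where u(n)^perp = lam 2. *)
Definition TU : set T := tensor_space (kforms 1%N) (lam 2%N).

Definition W1 : set T := [set a | TU a /\ alternating a].

Definition W2 : set T := [set a | TU a /\ forall X Y Z,
  a [:: X; Y; Z] + a [:: Y; Z; X] + a [:: Z; X; Y] = 0].

Definition W3 : set T := [set a | TU a /\
  (forall X Y Z, a [:: I X; I Y; Z] = a [:: X; Y; Z]) /\
  (forall Z, \sum_i a [:: e i; e i; Z] = 0)].

Definition W4 : set T :=
  [set \sum_i otimes (flat (e i))
         (ewedge (flat (e i)) mu - ewedge (flat (I (e i))) (Iact 0 mu))
  | mu in kforms 1%N].

Definition Xi_with (ph : T) a : T := fun s =>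
  if s is X :: s' then
    (2^-1 *: \sum_i ewedge (contract (e i) (contract X a))
                          (contract (e i) ph)) s'
  else 0.

Definition Xi_plus a : T := Xi_with (psi_minus D) a.
Definition Xi_minus a : T := - Xi_with (psi_plus D) a.

(* Xi_plus and Xi_minus have the same image on each of W1, W2, W3, W4. *)
Definition WXi (W : set T) : set T := Xi_plus @` W.

Definition WXi_total : set T :=
  tensor_space (kforms 1%N) [set ewedge b om | b in lam (n - 2)%N].

Definition W5 (eps : bool) : set T :=
  tensor_space (kforms 1%N) [set psi eps].

(* The alternation map of sign + (resp. -) is restricted to
   WXi_total + W5 of sign - (resp. +). *)
Definition alt_dom (eps : bool) : set T := sum_space WXi_total (W5 (~~ eps)).

Definition alt_ker (eps : bool) : set T :=
  [set t | alt_dom eps t /\ alt t = 0].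

Definition Wa : set T :=
  [set ewedge c om | c in wedge_space (kforms 1%N) (lam (n - 2)%N)].

Definition W1a : set T := [set ewedge (ewedge b om) om | b in lam (n - 3)%N].

Definition W2a (eps : bool) : set T :=
  [set b | [/\ Wa b, ewedge b om = 0 & ewedge (star n.+1 b) (psi eps) = 0]].

Definition W45a (eps : bool) : set T := wedge_space (kforms 1%N) [set psi eps].

Definition lam_wedge_om p : set T := [set ewedge b om | b in lam p].

End Frame.

End Fibre.

Section Manifold.
Variables (R : realType) (m : nat).
Local Notation V := 'rV[R]_m.

(* For an open set U, [Ck k U f] says that f is of class C^k on U. *)
Fixpoint Ck (k : nat) (U : set V) (f : V -> R) : Prop :=
  (forall x, U x -> {for x, continuous f}) /\
  if k is k'.+1 then
    forall v, (forall x, U x -> derivable f x v) /\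
              Ck k' U (fun x => 'D_v f x)
  else True.

Definition smooth_on (U : set V) (f : V -> R) := forall k, Ck k U f.

Record manifold := Manifold {
  carrier :> topologicalType;
  chart : Type;
  chart_dom : chart -> set carrier;
  chart_coord : chart -> carrier -> V;
  chart_param : chart -> V -> carrier;
  carrier_hausdorff : hausdorff_space carrier;
  carrier_countable : @second_countable carrier;
  chart_dom_open : forall c, open (chart_dom c);
  chart_dom_cover : forall p, exists c, chart_dom c p;
  chart_coord_open : forall c, open (chart_coord c @` chart_dom c);
  chart_coordK : forall c p, chart_dom c p -> chart_param c (chart_coord c p) = p;
  chart_coord_continuous : forall c p, chart_dom c p -> {for p, continuous (chart_coord c)};
  chart_param_continuous : forall c p, chart_dom c p ->
    {for chart_coord c p, continuous (chart_param c)};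
  transition_smooth : forall c d i,
    smooth_on (chart_coord c @` (chart_dom c `&` chart_dom d))
              (fun x => chart_coord d (chart_param c x) 0 i)
}.

(* The differential at p of the change of coordinates from c to d. *)
Definition transition_diff (M : manifold) (c d : chart M) (p : M) (X : V) : V :=
  'D_X (fun x => chart_coord d (chart_param c x)) (chart_coord c p).

(* Exterior derivative of a form given in coordinates. *)
Definition ext_deriv (b : V -> tensor R V) (x : V) : tensor R V :=
  alt (fun s => if s is X :: s' then 'D_X (fun y => b y s') x else 0).

End Manifold.

(* In each chart c the tensors are given on the tangent spaces R^(2n) of the
   coordinate image, and the data in two charts are related by the differential
   of the change of coordinates. *)
Record su_structure (R : realType) (n : nat) (M : manifold R n.*2) := SUStructure {
  su_at : chart M -> 'rV[R]_(n.*2) -> su_data 'rV[R]_(n.*2);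
  su_at_fibre : forall c p, chart_dom c p -> su_fibre (su_at c (chart_coord c p)) n;
  met_smooth : forall c X Y,
    smooth_on (chart_coord c @` chart_dom c) (fun x => met (su_at c x) X Y);
  acs_smooth : forall c X i,
    smooth_on (chart_coord c @` chart_dom c) (fun x => acs (su_at c x) X 0 i);
  psi_smooth : forall c eps s,
    smooth_on (chart_coord c @` chart_dom c) (fun x => psi (su_at c x) eps s);
  met_compat : forall (c d : chart M) p X Y, chart_dom c p -> chart_dom d p ->
    met (su_at c (chart_coord c p)) X Y =
    met (su_at d (chart_coord d p)) (transition_diff c d p X)
                              (transition_diff c d p Y);
  acs_compat : forall (c d : chart M) p X, chart_dom c p -> chart_dom d p ->
    transition_diff c d p (acs (su_at c (chart_coord c p)) X) =
    acs (su_at d (chart_coord d p)) (transition_diff c d p X);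
  psi_compat : forall (c d : chart M) p eps, chart_dom c p -> chart_dom d p ->
    psi (su_at c (chart_coord c p)) eps =
    pullback (transition_diff c d p) (psi (su_at d (chart_coord d p)) eps)
}.

(* Main.v *)
(* In the coframe dz_1, ..., dz_n and its conjugate given by an adapted frame,
  Psi = psi_+ + i psi_- is dz_1 /\ ... /\ dz_n, and om /\ Psi = 0.  Contracting
  this identity up to three times computes om /\ (iota Psi) and om^2 /\ (iota Psi),
  and shows that T^* /\ [[lambda^(n-2,0)]] /\ om consists of the real parts of
    Q c + P u,  Q c = sum c_mlj dzb_m /\ dzb_l /\ (d_j _| Psi),
                P u = sum u_l dzb_l /\ Psi,
  of types (n - 1, 2) and (n, 1).  For n >= 4 these types and their conjugates are
  four different types, so Q c and P u are determined by the real part.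
  An element of T^* (x) u(n)^perp is the real part of a tensor with components
  A x j l, where x is arbitrary, j and l are antiholomorphic, and A is skew in
  j, l.  Alternating its image under Xi_+ gives Q of the part of A with x
  antiholomorphic and P of the trace of the part with x holomorphic: the first part
  is W1 + W2 (totally skew, cyclic sum zero), the second is W3 + W4 (traceless, pure
  trace).  On the other side b /\ om = 0 kills the totally skew part of c,
  *b /\ psi = 0 kills u, and T^* /\ psi is the set of real parts of P u.
  For d psi, differentiating Psi(IX, ...) = i Psi(X, ...) along Y shows that the
  derivative of Psi along Y vanishes on two antiholomorphic arguments; hence d Psi
  has at most two antiholomorphic factors, and so is of the form Q c + P u. *)

Require Import Defs.
From mathcomp Require Import all_boot all_order all_algebra.
From mathcomp Require Import all_classical all_reals all_analysis.
From mathcomp Require Import complex zify ring.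
Import Order.TTheory GRing.Theory Num.Theory numFieldNormedType.Exports.
Local Open Scope classical_set_scope.
Local Open Scope ring_scope.
Set Implicit Arguments.
Unset Strict Implicit.
Unset Printing Implicit Defensive.
Local Notation contract := Defs.contract.
Local Notation alternating := Defs.alternating.
Local Notation multilinear := Defs.multilinear.
Local Notation "a ∧ b" := (ewedge a b) (at level 38, right associativity).
Local Notation iz i := (contract (true, i)).
Local Notation ib i := (contract (false, i)).

(** * Wedge product and contraction *)

(** Everything is reduced to component tensors on the finite index type [bool * 'I_n]. [rho f] is
    the real tensor with complex components [f]; it is compatible with alternation, contraction and
    the wedge with a real factor, and each module is described as the image under [rho] of arrays
    with prescribed symmetries. The equalities of modules are comparisons of such descriptions. The
    obstacle is that [rho] keeps only a real part: [rho f = 0] gives no more than [f + cj f = 0], so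
    uniqueness needs either [f] real or a type that differs from that of its conjugate. Preimages
    are explicit: a Koszul formula for Q c, a pure trace tensor for P u. The module A in the kernel
    consists of the differences of an element of the image of W4 and a one-form tensored with psi
    that has the same alternation; its equivariance rests on Xi not depending on the orthonormal
    frame. For d psi no connection is introduced, since the coordinate derivatives of psi and I
    already satisfy the required relation. Smoothness is given one direction at a time, so linearity
    of the derivative in its direction has to be proved. *)

Section ShuffleProduct.
Variables (K : numFieldType) (V : Type).
Implicit Types (a b c : tensor K V) (x y : V) (s : seq V) (p q : nat).

(** The grading involution. With it the Leibniz rule for contractions holds for all tensors,
    homogeneous or not, so inductions on the list of arguments need no bookkeeping of degrees. *)
Definition sg a : tensor K V := fun s => (-1) ^+ size s * a s.

Definition hom p a := forall s, size s != p -> a s = 0.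

Lemma scaleTE (k : K) a s : (k *: a) s = k * a s. Proof. by []. Qed.
Lemma addTE a b s : (a + b) s = a s + b s. Proof. by []. Qed.

Lemma oppTE a s : (- a) s = - a s. Proof. by []. Qed.

Lemma sum_bool_tuple k (F : k.+1.-tuple bool -> K) :
  \sum_m F m = \sum_(m : k.-tuple bool) F [tuple of true :: m] +
              \sum_(m : k.-tuple bool) F [tuple of false :: m].
Proof.
rewrite (reindex (fun bt : bool * k.-tuple bool => [tuple of bt.1 :: bt.2])) /=.
  rewrite -(pair_bigA _ (fun (x : bool) (t : k.-tuple bool) => F [tuple of x :: t])) /=.
  by rewrite big_bool.
exists (fun m => (thead m, [tuple of behead m])) => [[b t] _|m _] /=.
  by congr pair; apply/val_inj.
by case/tupleP: m => b t; apply/val_inj.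
Qed.

Lemma shuffle_inv_cons k (u : bool) (m : k.-tuple bool) :
  shuffle_inv [tuple of u :: m] = ((~~ u) * count id m + shuffle_inv m)%N.
Proof.
rewrite /shuffle_inv big_ord_recl big_mkcond big_ord_recl /= add0n; congr addn.
  rewrite -sum1_count big_tuple big_distrr big_mkcond /=.
  rewrite [LHS](eq_bigr (fun i : 'I_k => nat_of_bool (~~ u && tnth m i))).
    rewrite [RHS]big_mkcond; apply: eq_bigr => i _.
    by case: ifP => _; case: u; case: (tnth m i).
  move=> i _; rewrite (tnth_nth false) /= [tnth _ (lift _ _)](tnth_nth false) /=.
  by rewrite -tnth_nth.
apply: eq_bigr => i _; rewrite big_mkcond big_ord_recl /= add0n [RHS]big_mkcond.
apply: eq_bigr => j _.
rewrite !(tnth_nth false) /= -!tnth_nth.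
by rewrite /bump /= !add1n ltnS.
Qed.

Lemma ewedge_nil a b : ewedge a b [::] = a [::] * b [::].
Proof.
rewrite /ewedge (big_pred1 [tuple]) => [|m]; last by rewrite /= [m]tuple0; apply/esym/eqP/val_inj.
by rewrite /shuffle_inv big_ord0 expr0 mul1r.
Qed.

(** Shuffles are split by whether the head is selected; if it is not, every selected entry passes
    it, whence [sg a]. With [ewedge_nil] this recursion replaces the sum over shuffles in the
    inductions below. *)
Lemma ewedge_cons a b x s :
  ewedge a b (x :: s) =
  ewedge (contract x a) b s + ewedge (sg a) (contract x b) s.
Proof.
rewrite {1}/ewedge sum_bool_tuple; congr (_ + _); apply: eq_bigr => m _.
  by rewrite shuffle_inv_cons mul0n.
rewrite shuffle_inv_cons mul1n exprD /sg /= size_mask ?size_tuple //.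
by rewrite (mulrC (_ ^+ count _ _)) -!mulrA.
Qed.

Lemma contract_ewedge x a b :
  contract x (ewedge a b) = ewedge (contract x a) b + ewedge (sg a) (contract x b).
Proof. by apply/funext => s; rewrite /contract ewedge_cons. Qed.

Lemma ewedgeDl a b c : ewedge (a + b) c = ewedge a c + ewedge b c.
Proof.
apply/funext => s; rewrite addTE /ewedge -big_split /=; apply: eq_bigr => m _.
by rewrite addTE mulrDr mulrDl.
Qed.

Lemma ewedgeDr a b c : ewedge c (a + b) = ewedge c a + ewedge c b.
Proof.
apply/funext => s; rewrite addTE /ewedge -big_split /=; apply: eq_bigr => m _.
by rewrite addTE mulrDr.
Qed.

Lemma ewedgeZl k a c : ewedge (k *: a) c = k *: ewedge a c.
Proof.
apply/funext => s; rewrite scaleTE /ewedge big_distrr /=; apply: eq_bigr => m _.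
by rewrite scaleTE mulrCA !mulrA.
Qed.

Lemma ewedgeZr k a c : ewedge c (k *: a) = k *: ewedge c a.
Proof.
apply/funext => s; rewrite scaleTE /ewedge big_distrr /=; apply: eq_bigr => m _.
by rewrite scaleTE mulrCA !mulrA.
Qed.

Lemma ewedge0l c : ewedge 0 c = 0.
Proof. by have := ewedgeZl 0 0 c; rewrite !scale0r. Qed.

Lemma ewedge0r c : ewedge c 0 = 0.
Proof. by have := ewedgeZr 0 0 c; rewrite !scale0r. Qed.

Lemma ewedgeNl a c : ewedge (- a) c = - ewedge a c.
Proof. by rewrite -scaleN1r ewedgeZl scaleN1r. Qed.

Lemma ewedgeNr a c : ewedge c (- a) = - ewedge c a.
Proof. by rewrite -scaleN1r ewedgeZr scaleN1r. Qed.

Lemma ewedge_suml (J : Type) (r : seq J) (P : pred J) (F : J -> tensor K V) c :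
  ewedge (\sum_(j <- r | P j) F j) c = \sum_(j <- r | P j) ewedge (F j) c.
Proof. by elim/big_rec2: _ => [|j a b _ <-]; rewrite ?ewedge0l ?ewedgeDl. Qed.

Lemma ewedge_sumr (J : Type) (r : seq J) (P : pred J) (F : J -> tensor K V) c :
  ewedge c (\sum_(j <- r | P j) F j) = \sum_(j <- r | P j) ewedge c (F j).
Proof. by elim/big_rec2: _ => [|j a b _ <-]; rewrite ?ewedge0r ?ewedgeDr. Qed.

Lemma contractD x a b : contract x (a + b) = contract x a + contract x b.
Proof. by []. Qed.
Lemma contractN x a : contract x (- a) = - contract x a.
Proof. by []. Qed.
Lemma contractZ x k a : contract x (k *: a) = k *: contract x a.
Proof. by []. Qed.
Lemma contract0 x : contract x (0 : tensor K V) = 0.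
Proof. by []. Qed.
Lemma contract_sum x (J : Type) (r : seq J) (P : pred J) (F : J -> tensor K V) :
  contract x (\sum_(j <- r | P j) F j) = \sum_(j <- r | P j) contract x (F j).
Proof. by elim/big_rec2: _ => [|j a b _ <-]. Qed.

Lemma sgK : involutive sg.
Proof. by move=> a; apply/funext => s; rewrite /sg mulrA -expr2 sqrr_sign mul1r. Qed.

Lemma contract_sg x a : contract x (sg a) = - sg (contract x a).
Proof. by apply/funext => s; rewrite /contract /sg /= exprS mulN1r mulNr. Qed.

Lemma sg_ewedge a b : sg (ewedge a b) = ewedge (sg a) (sg b).
Proof.
apply/funext => s; elim: s a b => [|x s IH] a b.
  by rewrite /sg /= !ewedge_nil /= !mul1r.
rewrite /sg /= !ewedge_cons -/(sg _) !contract_sg ewedgeNl ewedgeNr exprS mulN1r.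
by rewrite mulNr mulrDr opprD; congr (- _ - _); [exact: IH | exact: IH].
Qed.

Lemma ewedgeA a b c : ewedge a (ewedge b c) = ewedge (ewedge a b) c.
Proof.
apply/funext => s; elim: s a b c => [|x s IH] a b c; first by rewrite !ewedge_nil mulrA.
rewrite !ewedge_cons !contract_ewedge ewedgeDr ewedgeDl !addTE !IH sg_ewedge.
by rewrite addrA.
Qed.

Lemma sg_hom p a : hom p a -> sg a = (-1) ^+ p *: a.
Proof.
move=> ha; apply/funext => s; rewrite scaleTE /sg.
by have [->//|/ha ->] := eqVneq (size s) p; rewrite !mulr0.
Qed.

Lemma hom_contract p x a : hom p.+1 a -> hom p (contract x a).
Proof. by move=> ha s hs; apply: ha. Qed.

Lemma hom0_contract x a : hom 0 a -> contract x a = 0.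
Proof. by move=> ha; apply/funext => s; apply: ha. Qed.

Lemma ewedge_hom p q a b : hom p a -> hom q b -> hom (p + q)%N (ewedge a b).
Proof.
move=> ha hb s; elim: s p q a b ha hb => [|x s IH] p q a b ha hb hs.
  rewrite ewedge_nil; move: hs; rewrite eq_sym addn_eq0 negb_and.
  by case/orP=> h; [rewrite ha ?mul0r|rewrite hb ?mulr0] => //=; rewrite eq_sym.
rewrite ewedge_cons (sg_hom ha) ewedgeZl scaleTE.
suff [-> ->] : ewedge (contract x a) b s = 0 /\ ewedge a (contract x b) s = 0.
  by rewrite mulr0 addr0.
split.
  case: p ha hs => [|p] ha hs; first by rewrite hom0_contract // ewedge0l.
  by apply: (IH p q) => //; exact: hom_contract.
case: q hb hs => [|q] hb hs; first by rewrite (hom0_contract x hb) ewedge0r.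
by rewrite addnS in hs; apply: (IH p q) => //; exact: hom_contract.
Qed.

Lemma ewedgeC p q a b : hom p a -> hom q b ->
  ewedge a b = (-1) ^+ (p * q) *: ewedge b a.
Proof.
move=> ha hb; apply/funext => s; elim: s p q a b ha hb => [|x s IH] p q a b ha hb.
  rewrite scaleTE !ewedge_nil mulrC.
  case: p ha => [|p] ha; last by rewrite [a _]ha // !mulr0.
  by rewrite mul0n mul1r.
rewrite scaleTE !ewedge_cons (sg_hom ha) (sg_hom hb) !ewedgeZl !scaleTE mulrDr addrC.
congr (_ + _).
  case: q hb => [|q] hb; first by rewrite (hom0_contract x hb) !(ewedge0l, ewedge0r) !mulr0.
  rewrite (IH p q) //; last exact: hom_contract.
  by rewrite scaleTE mulrA -exprD mulnS.
case: p ha => [|p] ha; first by rewrite (hom0_contract x ha) !(ewedge0l, ewedge0r) !mulr0.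
rewrite (IH p q) //; last exact: hom_contract.
rewrite scaleTE mulSn addnC exprD -mulrA; congr (_ * _).
by rewrite mulrA -expr2 sqrr_sign mul1r.
Qed.

Lemma ewedgeE a b s : ewedge a b s = \sum_(m : (size s).-tuple bool)
  (-1) ^+ shuffle_inv m * a (mask m s) * b (mask (map negb m) s).
Proof. by []. Qed.

Opaque ewedge.

Lemma homD p a b : hom p a -> hom p b -> hom p (a + b).
Proof. by move=> ha hb s hs; rewrite addTE ha ?hb ?addr0. Qed.
Lemma homZ p k a : hom p a -> hom p (k *: a).
Proof. by move=> ha s hs; rewrite scaleTE ha ?mulr0. Qed.
Lemma hom_sum p (J : Type) (r : seq J) (P : pred J) (F : J -> tensor K V) :
  (forall j, P j -> hom p (F j)) -> hom p (\sum_(j <- r | P j) F j).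
Proof. by move=> hF; apply: big_ind => // a b; exact: homD. Qed.

(** Only neighbours are exchanged, which suits induction on lists and makes sense on a bare index
    type. In characteristic 0 it implies [alternating]; the converse holds for multilinear
    tensors. *)
Definition skew a := forall s1 x y s2,
  a (s1 ++ x :: y :: s2) = - a (s1 ++ y :: x :: s2).

Lemma skew_contract x a : skew a -> skew (contract x a).
Proof. by move=> ha s1; exact: (ha (x :: s1)). Qed.

Lemma skew_contractC x y a : skew a ->
  contract x (contract y a) = - contract y (contract x a).
Proof. by move=> ha; apply/funext => s; exact: (ha [::]). Qed.

Lemma skew_contract2 x a : skew a -> contract x (contract x a) = 0.
Proof.
by move=> /(skew_contractC x x)/eqP; rewrite -subr_eq0 opprK -mulr2n -scaler_nat scaler_eq0
  pnatr_eq0 => /eqP.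
Qed.

Lemma skew0 : skew 0. Proof. by move=> *; rewrite oppr0. Qed.
Lemma skewD a b : skew a -> skew b -> skew (a + b).
Proof. by move=> ha hb s1 x y s2; rewrite !addTE ha hb opprD. Qed.
Lemma skewZ k a : skew a -> skew (k *: a).
Proof. by move=> ha s1 x y s2; rewrite !scaleTE ha mulrN. Qed.
Lemma skew_sum (J : Type) (r : seq J) (P : pred J) (F : J -> tensor K V) :
  (forall j, P j -> skew (F j)) -> skew (\sum_(j <- r | P j) F j).
Proof. by move=> hF; apply: big_ind => //; [exact: skew0|move=> a b; exact: skewD]. Qed.

Lemma skew_sg a : skew a -> skew (sg a).
Proof. by move=> ha s1 x y s2; rewrite /sg ha mulrN !size_cat. Qed.

Lemma skew_ewedge a b : skew a -> skew b -> skew (ewedge a b).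
Proof.
move=> ha hb s1; elim: s1 a b ha hb => [|z s1 IH] a b ha hb x y s2 /=.
  rewrite !ewedge_cons !contract_sg.
  rewrite (skew_contractC x y ha) (skew_contractC x y hb) sgK.
  rewrite !(ewedgeNl, ewedgeNr) !oppTE.
  have E (p q r t : K) : p + q + (- r + t) = - (- p + r + (- q - t)) by ring.
  exact: E.
rewrite !ewedge_cons opprD; congr (_ + _).
  by apply: IH => //; exact: skew_contract.
by apply: IH; [exact: skew_sg|exact: skew_contract].
Qed.
End ShuffleProduct.

Section Alternation.
Variables (K : numFieldType) (V : Type).
Implicit Types (a b t : tensor K V) (x y : V) (s : seq V).

(** In [alt t (x :: s)] all terms but the first keep [x] as first form argument and take the leading
    slot from [s]; [swp x t] is the tensor alternated there. *)
Definition swp x t : tensor K V := fun s => if s is y :: s' then t (y :: x :: s') else 0.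

Lemma alt_nil t : alt t [::] = 0.
Proof. by rewrite /alt big_ord0. Qed.

Lemma alt_cons t x s : alt t (x :: s) = t (x :: s) - alt (swp x t) s.
Proof.
rewrite /alt big_ord_recl mul1r (tnth_nth x) /= drop0; congr (_ + _).
rewrite -sumrN; apply: eq_bigr => i _.
by rewrite exprS mulN1r mulNr !(tnth_nth x).
Qed.

Lemma contract_alt x t : contract x (alt t) = contract x t - alt (swp x t).
Proof. by apply/funext => s; exact: alt_cons. Qed.

Lemma altD t1 t2 : alt (t1 + t2) = alt t1 + alt t2.
Proof.
by apply/funext => s; rewrite addTE /alt -big_split; apply: eq_bigr => i _; rewrite addTE mulrDr.
Qed.

Lemma altZ k t : alt (k *: t) = k *: alt t.
Proof.
apply/funext => s; rewrite scaleTE /alt big_distrr; apply: eq_bigr => i _.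
by rewrite scaleTE mulrCA.
Qed.

Lemma alt0 : alt (0 : tensor K V) = 0.
Proof. by have := altZ 0 0; rewrite !scale0r. Qed.

Lemma alt_sum (J : Type) (r : seq J) (P : pred J) (F : J -> tensor K V) :
  alt (\sum_(j <- r | P j) F j) = \sum_(j <- r | P j) alt (F j).
Proof. by elim/big_rec2: _ => [|j a b _ <-]; rewrite ?alt0 ?altD. Qed.

Lemma ewedge1l b : ewedge tensor_one b = b.
Proof.
apply/funext => s; elim: s b => [|x s IH] b; first by rewrite ewedge_nil mul1r.
rewrite ewedge_cons (_ : contract x tensor_one = 0) // ewedge0l add0r.
rewrite (_ : sg tensor_one = tensor_one) ?IH //.
by apply/funext => -[|y s']; rewrite /sg /tensor_one /= ?mul1r ?mulr0.
Qed.

Lemma ewedge1r b : ewedge b tensor_one = b.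
Proof.
apply/funext => s; elim: s b => [|x s IH] b; first by rewrite ewedge_nil mulr1.
by rewrite ewedge_cons (_ : contract x tensor_one = 0) // ewedge0r addr0 IH.
Qed.

End Alternation.

Section CoordinateForms.
Variables (K : numFieldType) (J : finType).
Implicit Types (a b t f : tensor K J) (x y : J) (s : seq J).

Definition dcoord x : tensor K J := fun s => (s == [:: x])%:R.

Lemma dcoord_hom x : hom 1 (dcoord x).
Proof. by move=> [|y [|z s]] //= _; rewrite /dcoord eqseq_cons andbF. Qed.

Lemma dcoord_skew x : skew (dcoord x).
Proof.
move=> s1 y z s2; rewrite /dcoord.
have E (l : seq J) : (2 <= size l)%N -> (l == [:: x]) = false by case: l => [|? [|? ?]] //= _; rewrite eqseq_cons andbF.
by rewrite !E ?oppr0 // size_cat /= !addnS.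
Qed.

Lemma sg_dcoord x : sg (dcoord x) = - dcoord x.
Proof. by rewrite (sg_hom (@dcoord_hom x)) expr1 scaleN1r. Qed.

Lemma contract_dcoord y x : contract y (dcoord x) = (y == x)%:R *: tensor_one.
Proof.
apply/funext => s; rewrite scaleTE /contract /dcoord /tensor_one eqseq_cons.
by case: (y == x); rewrite ?mul1r ?mul0r //= ; case: s.
Qed.

Lemma contract_dwedge y x a :
  contract y (ewedge (dcoord x) a) = (y == x)%:R *: a - ewedge (dcoord x) (contract y a).
Proof. by rewrite contract_ewedge contract_dcoord ewedgeZl ewedge1l sg_dcoord ewedgeNl. Qed.

(** Euler's identity, refined to a set of indices: taken over all of them it yields the degree, over
    the barred ones the number of antiholomorphic factors. *)
Lemma euler (S : pred J) f s : skew f ->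
  (\sum_(x | S x) ewedge (dcoord x) (contract x f)) s = (count S s)%:R * f s.
Proof.
elim: s f => [|y s IH] f skf.
  by rewrite fct_sumE big1 ?mul0r // => x _; rewrite ewedge_nil mul0r.
rewrite -[LHS]/(contract y _ s) contract_sum.
under eq_bigr => x _ do rewrite contract_dwedge (skew_contractC y x skf) ewedgeNr opprK.
rewrite big_split /= addTE IH; last exact: skew_contract.
rewrite natrD mulrDl; congr (_ + _).
rewrite fct_sumE; have [Sy|Sy] := boolP (S y).
  rewrite (bigD1 y) //= eqxx scale1r mul1r big1 ?addr0 // => x /andP[_ nxy].
  by rewrite eq_sym (negPf nxy) scale0r.
rewrite mul0r big1 // => x Sx; rewrite (_ : y == x = false) ?scale0r //.
by apply: contraNF Sy => /eqP ->.
Qed.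

Lemma alt_dcoord t : alt t = \sum_x ewedge (dcoord x) (contract x t).
Proof.
apply/funext => s; elim: s t => [|y s IH] t.
  by rewrite alt_nil fct_sumE big1 // => x _; rewrite ewedge_nil mul0r.
rewrite alt_cons IH -[RHS]/(contract y _ s) contract_sum.
under [in RHS]eq_bigr => x _ do rewrite contract_dwedge.
rewrite sumrB addTE oppTE; congr (_ - _).
rewrite (bigD1 y) //= eqxx scale1r big1 ?addr0 // => x nxy.
by rewrite eq_sym (negPf nxy) scale0r.
Qed.

End CoordinateForms.

(** * Linear substitution in tensors *)

Section Substitution.
Variables (K : numFieldType) (J : finType).

Section Decode.
Variables (V : Type) (M : V -> J -> K).
Implicit Types (a b t f : tensor K J) (x : V) (s : seq V).

(* [decs [:: X_1; ...; X_k] f] is the sum of M X_1 y_1 ... M X_k y_k f [:: y_1; ...; y_k]: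
   the tensor whose components in the coframe M are f. *)
Fixpoint decs s f : K :=
  if s is x :: s' then \sum_y M x y * decs s' (contract y f) else f [::].

Definition lin_subst f : tensor K V := fun s => decs s f.

Lemma dec_nil f : lin_subst f [::] = f [::]. Proof. by []. Qed.
Lemma dec_cons f x s : lin_subst f (x :: s) = \sum_y M x y * lin_subst (contract y f) s.
Proof. by []. Qed.

Lemma decD f g : lin_subst (f + g) = lin_subst f + lin_subst g.
Proof.
apply/funext => s; elim: s f g => [|x s IH] f g //.
rewrite addTE !dec_cons -big_split; apply: eq_bigr => y _.
by rewrite contractD IH mulrDr.
Qed.

Lemma decZ k f : lin_subst (k *: f) = k *: lin_subst f.
Proof.
apply/funext => s; elim: s f => [|x s IH] f //.
rewrite scaleTE !dec_cons big_distrr; apply: eq_bigr => y _.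
by rewrite contractZ IH /= mulrCA.
Qed.

Lemma dec0 : lin_subst 0 = 0.
Proof. by have := decZ 0 0; rewrite !scale0r. Qed.

Lemma decN f : lin_subst (- f) = - lin_subst f.
Proof. by rewrite -scaleN1r decZ scaleN1r. Qed.

Lemma dec_sum (I : Type) (r : seq I) (P : pred I) (F : I -> tensor K J) :
  lin_subst (\sum_(j <- r | P j) F j) = \sum_(j <- r | P j) lin_subst (F j).
Proof. by elim/big_rec2: _ => [|j a b _ <-]; rewrite ?dec0 ?decD. Qed.

Lemma contract_dec x f : contract x (lin_subst f) = lin_subst (\sum_y M x y *: contract y f).
Proof.
apply/funext => s; rewrite /contract dec_cons dec_sum fct_sumE.
by apply: eq_bigr => y _; rewrite decZ.
Qed.

Lemma dec_sg f : sg (lin_subst f) = lin_subst (sg f).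
Proof.
apply/funext => s; elim: s f => [|x s IH] f //.
rewrite /sg /= exprS mulN1r mulNr big_distrr -sumrN; apply: eq_bigr => y _ /=.
by rewrite contract_sg -/(lin_subst _ s) -/(lin_subst _ s) decN oppTE -IH /sg mulrN mulrCA.
Qed.

Lemma dec_ewedge f g : lin_subst (ewedge f g) = ewedge (lin_subst f) (lin_subst g).
Proof.
apply/funext => s; elim: s f g => [|x s IH] f g; first by rewrite dec_nil !ewedge_nil.
rewrite ewedge_cons !contract_dec !dec_sum ewedge_suml ewedge_sumr !fct_sumE.
rewrite dec_cons -big_split; apply: eq_bigr => y _ /=.
by rewrite contract_ewedge decD !decZ ewedgeZl ewedgeZr !scaleTE addTE !IH mulrDr dec_sg.
Qed.

Lemma dec_one : lin_subst tensor_one = tensor_one.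
Proof.
apply/funext => -[|x s] //; rewrite dec_cons big1 // => y _.
by rewrite (_ : contract y _ = 0) // dec0 mulr0.
Qed.

Lemma dec_dcoord y : lin_subst (dcoord K y) = fun s => if s is [:: x] then M x y else 0.
Proof.
apply/funext => -[|x s] //; rewrite dec_cons (bigD1 y) //= big1 => [|z nzy].
  rewrite contract_dcoord eqxx scale1r dec_one addr0.
  by case: s => [|u s]; rewrite /tensor_one ?mulr1 ?mulr0.
by rewrite contract_dcoord (negPf nzy) scale0r dec0 mulr0.
Qed.

Lemma swp_dec x t : swp x (lin_subst t) = lin_subst (\sum_y M x y *: swp y t).
Proof.
apply/funext => -[|z s].
  rewrite dec_sum fct_sumE [RHS]big1 // => y _.
  by rewrite decZ scaleTE mulr0.
rewrite dec_sum fct_sumE.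
transitivity (\sum_y \sum_i M x y * (M z i * lin_subst (contract y (contract i t)) s)).
  rewrite -[LHS]/(lin_subst t [:: z, x & s]) dec_cons exchange_big; apply: eq_bigr => i _.
  by rewrite dec_cons big_distrr; apply: eq_bigr => y _; rewrite /= mulrCA.
apply: eq_bigr => y _; rewrite decZ scaleTE dec_cons big_distrr /=.
by apply: eq_bigr => i _; congr (_ * (_ * _)).
Qed.

Lemma dec_alt t : lin_subst (alt t) = alt (lin_subst t).
Proof.
apply/funext => s; elim: s t => [|x s IH] t; first by rewrite dec_nil !alt_nil.
rewrite alt_cons swp_dec -IH alt_sum dec_sum fct_sumE dec_cons dec_cons -sumrB.
by apply: eq_bigr => y _; rewrite contract_alt decD decN altZ decZ addTE oppTE scaleTE mulrBr.
Qed.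

Lemma dec_hom p f : hom p f -> hom p (lin_subst f).
Proof.
move=> hf s; elim: s p f hf => [|x s IH] p f hf hs; first by rewrite dec_nil hf.
rewrite dec_cons big1 // => y _; case: p hf hs => [|p] hf hs.
  by rewrite (hom0_contract y hf) dec0 mulr0.
by rewrite (IH p) ?mulr0 //; exact: hom_contract.
Qed.

Lemma dec_skew f : skew f -> skew (lin_subst f).
Proof.
move=> hf s1; elim: s1 f hf => [|z s1 IH] f hf x y s2.
  rewrite !cat0s; transitivity (\sum_z \sum_w M x z * (M y w * lin_subst (contract w (contract z f)) s2)).
    by rewrite dec_cons; apply: eq_bigr => z _; rewrite dec_cons big_distrr.
  rewrite dec_cons exchange_big -sumrN; apply: eq_bigr => w _.
  rewrite dec_cons -mulrN -sumrN big_distrr; apply: eq_bigr => z _ /=.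
  by rewrite (skew_contractC w z hf) decN oppTE !mulrN mulrCA.
rewrite !cat_cons !dec_cons -sumrN; apply: eq_bigr => w _.
by rewrite IH ?mulrN //; exact: skew_contract.
Qed.

Lemma dec_otimes f g : lin_subst (otimes f g) = otimes (lin_subst f) (lin_subst g).
Proof.
apply/funext => -[|x s]; first by [].
rewrite dec_cons /otimes /= take0 -/(lin_subst g s) big_distrl; apply: eq_bigr => y _ /=.
rewrite -mulrA; congr (_ * _).
by rewrite (_ : contract y _ = f [:: y] *: g) ?decZ // /contract /otimes; apply/funext => s' /=; rewrite take0.
Qed.

End Decode.

Lemma dec_comp (V : Type) (M : V -> J -> K) (N : J -> J -> K) f :
  lin_subst M (lin_subst N f) = lin_subst (fun x y => \sum_z M x z * N z y) f.
Proof.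
apply/funext => s; elim: s f => [|x s IH] f //.
transitivity (\sum_z \sum_y M x z * (N z y * lin_subst M (lin_subst N (contract y f)) s)).
  rewrite dec_cons; apply: eq_bigr => z _.
  rewrite contract_dec !dec_sum fct_sumE mulr_sumr; apply: eq_bigr => y _.
  by rewrite !decZ.
rewrite exchange_big dec_cons; apply: eq_bigr => y _ /=.
by rewrite mulr_suml; apply: eq_bigr => z _; rewrite IH mulrA.
Qed.

Lemma dec_id f : lin_subst (fun x y => (x == y)%:R) f = f.
Proof.
apply/funext => s; elim: s f => [|x s IH] f //.
rewrite dec_cons (bigD1 x) //= big1 ?addr0 => [|y nxy]; last by rewrite eq_sym (negPf nxy) mul0r.
by rewrite eqxx mul1r IH.
Qed.

End Substitution.

Section SkewMove.
Variables (K : numFieldType) (V : Type).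

Lemma skew_move (f : tensor K V) x s t : skew f -> f (s ++ x :: t) = (-1) ^+ size s * f (x :: s ++ t).
Proof.
elim: s f => [|y s IH] f skf; first by rewrite mul1r.
rewrite -[LHS]/(contract y f (s ++ x :: t)) IH; last exact: skew_contract.
by rewrite /contract exprS mulN1r mulNr -mulrN; congr (_ * _); exact: (skf [::]).
Qed.

End SkewMove.

Section SkewValues.
Variables (K : numFieldType) (J : finType).
Implicit Types (f : tensor K J) (x y : J) (s t : seq J).

Lemma skew_nuniq f s : skew f -> ~~ uniq s -> f s = 0.
Proof.
elim: s f => [|x s IH] f skf //=; rewrite negb_and negbK => /orP[xs|us].
  case/splitPr: xs => s1 s2.
  rewrite -[LHS]/(contract x f (s1 ++ x :: s2)) skew_move; last exact: skew_contract.
  by rewrite -[contract x f _]/(contract x (contract x f) _) skew_contract2 // mulr0.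
by rewrite -[LHS]/(contract x f s) IH //; exact: skew_contract.
Qed.

(** Only vanishing is carried along a permutation, so no sign of a permutation has to be
    computed. *)
Lemma skew_perm_eq0 f s t : skew f -> perm_eq s t -> f t = 0 -> f s = 0.
Proof.
elim: s t f => [|x s IH] t f skf st ft.
  by move: st; rewrite perm_sym => /perm_nilP t0; rewrite -t0.
have xt : x \in t by rewrite -(perm_mem st) mem_head.
case/splitPr: xt st ft => t1 t2 st ft.
apply: (IH (t1 ++ t2) (contract x f)); first exact: skew_contract.
  by rewrite -(perm_cons x) (permPl st) perm_catC /= perm_cons perm_catC.
move/eqP: ft; rewrite skew_move // mulf_eq0 expf_eq0 oppr_eq0 oner_eq0 andbF.
by move/eqP.
Qed.

Lemma skew_overflow f p : skew f -> hom p f -> (#|J| < p)%N -> f = 0.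
Proof.
move=> skf hf hp; apply/funext => s; have [sp|/hf//] := eqVneq (size s) p.
apply: skew_nuniq => //; apply: contraL hp => /card_uniqP us.
by rewrite -leqNgt -sp -us max_card.
Qed.

End SkewValues.

(** * Complex forms in an adapted coframe *)

(* The index (true, i) stands for z_i and (false, i) for its conjugate; a tensor on the
   index type is the family of the components of a complex tensor. *)
Section ComplexForms.
Variables (C : numClosedFieldType) (n : nat).
Local Notation J := (bool * 'I_n)%type.
Implicit Types (f g : tensor C J) (x y : J) (s : seq J) (i j k l m : 'I_n).

Definition barJ x : J := (~~ x.1, x.2).
(** Components of the complex conjugate tensor: conjugation also exchanges dz_i and its
    conjugate. *)
Definition cj f : tensor C J := fun s => (f (map barJ s))^*.
Definition nfalse s := count (fun x => ~~ x.1) s.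

(* [ty p d f]: f is a form of degree p and of type (p - d, d). *)
Definition ty (p d : nat) f := [/\ hom p f, skew f & forall s, nfalse s != d -> f s = 0].

Local Notation dz i := (dcoord C (true, i)).
Local Notation db i := (dcoord C (false, i)).

Lemma barJK : involutive barJ.
Proof. by case=> b i; rewrite /barJ negbK. Qed.

Lemma nfalse_bar s : (nfalse (map barJ s) + nfalse s)%N = size s.
Proof.
rewrite /nfalse count_map addnC -[RHS](count_predC (fun x => ~~ x.1)); congr addn.
Qed.

Lemma tyD p d f g : ty p d f -> ty p d g -> ty p d (f + g).
Proof.
case=> hf sf tf [hg sg' tg]; split; [exact: homD|exact: skewD|].
by move=> s hs; rewrite addTE tf // tg // addr0.
Qed.

Lemma tyZ p d c f : ty p d f -> ty p d (c *: f).
Proof.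
case=> hf sf tf; split; [exact: homZ|exact: skewZ|].
by move=> s hs; rewrite scaleTE tf // mulr0.
Qed.

Lemma ty0 p d : ty p d 0.
Proof. by split=> //; exact: skew0. Qed.

Lemma ty_sum p d (I : Type) (r : seq I) (P : pred I) (F : I -> tensor C J) :
  (forall a, P a -> ty p d (F a)) -> ty p d (\sum_(a <- r | P a) F a).
Proof. by move=> hF; apply: big_ind => //; [exact: ty0|move=> a b; exact: tyD]. Qed.

Lemma ty_iz p d i f : ty p.+1 d f -> ty p d (iz i f).
Proof.
case=> hf sf tf; split; [exact: hom_contract|exact: skew_contract|].
by move=> s hs; exact: tf.
Qed.

Lemma ty_ib p d i f : ty p.+1 d.+1 f -> ty p d (ib i f).
Proof.
case=> hf sf tf; split; [exact: hom_contract|exact: skew_contract|].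
by move=> s hs; apply: tf.
Qed.

Lemma ty0_ib p i f : ty p 0 f -> ib i f = 0.
Proof. by case=> _ _ tf; apply/funext => s; apply: tf. Qed.

Lemma ty_ewedge p d q e f g : ty p d f -> ty q e g -> ty (p + q)%N (d + e)%N (f ∧ g).
Proof.
case=> hf sf tf [hg sg' tg]; split; [exact: ewedge_hom|exact: skew_ewedge|].
move=> s; clear p q hf sf hg sg'.
elim: s d e f g tf tg => [|[b i] s IH] d e f g tf tg.
  rewrite ewedge_nil eq_sym addn_eq0 negb_and.
  by case/orP=> h; [rewrite tf ?mul0r|rewrite tg ?mulr0] => //=; rewrite eq_sym.
rewrite ewedge_cons /nfalse /= => hs.
have tsg : forall s', nfalse s' != d -> sg f s' = 0 by move=> s' /tf; rewrite /sg => ->; rewrite mulr0.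
case: b hs => /= hs.
  by rewrite (IH d e) ?(IH d e _ _ tsg) ?addr0 //; move=> s' h; [exact: tg|exact: tf].
rewrite add1n in hs.
suff [-> ->] : ewedge (ib i f) g s = 0 /\ ewedge (sg f) (ib i g) s = 0 by rewrite addr0.
split.
  case: d tf hs {tsg} => [|d] tf hs.
    by rewrite (_ : ib i f = 0) ?ewedge0l //; apply/funext => s'; exact: tf.
  by apply: (IH d e) => // s' h; exact: tf.
case: e tg hs => [|e] tg hs.
  by rewrite (_ : ib i g = 0) ?ewedge0r //; apply/funext => s'; exact: tg.
by rewrite addnS in hs; apply: (IH d e) => // s' h; exact: tg.
Qed.

Lemma ty_dz i : ty 1 0 (dz i).
Proof.
split; [exact: dcoord_hom|exact: dcoord_skew|].
by move=> s; rewrite /dcoord; case: (s =P _) => [->|].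
Qed.

Lemma ty_db i : ty 1 1 (db i).
Proof.
split; [exact: dcoord_hom|exact: dcoord_skew|].
by move=> s; rewrite /dcoord; case: (s =P _) => [->|].
Qed.

Lemma ty_disjoint p d e f g : ty p d f -> ty p e g -> d != e -> f + g = 0 -> f = 0.
Proof.
case=> _ _ tf [_ _ tg] de fg0; apply/funext => s.
have [sd|/tf//] := eqVneq (nfalse s) d.
by have := congr1 (fun F => F s) fg0; rewrite addTE (tg s) ?addr0 // sd.
Qed.

Lemma cjK : involutive cj.
Proof.
by move=> f; apply/funext => s; rewrite /cj conjCK -map_comp (eq_map barJK) map_id.
Qed.

Lemma cjD f g : cj (f + g) = cj f + cj g.
Proof. by apply/funext => s; rewrite /cj addTE rmorphD. Qed.

Lemma cjZ c f : cj (c *: f) = c^* *: cj f.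
Proof. by apply/funext => s; rewrite /cj scaleTE rmorphM. Qed.

Lemma cj0 : cj 0 = 0.
Proof. by apply/funext => s; rewrite /cj rmorph0. Qed.

Lemma cjN f : cj (- f) = - cj f.
Proof. by apply/funext => s; rewrite /cj oppTE rmorphN. Qed.

Lemma cj_sum (I : Type) (r : seq I) (P : pred I) (F : I -> tensor C J) :
  cj (\sum_(a <- r | P a) F a) = \sum_(a <- r | P a) cj (F a).
Proof. by elim/big_rec2: _ => [|j a b _ <-]; rewrite ?cj0 ?cjD. Qed.

Lemma contract_cj x f : contract x (cj f) = cj (contract (barJ x) f).
Proof. by []. Qed.

Lemma cj_sg f : cj (sg f) = sg (cj f).
Proof. by apply/funext => s; rewrite /cj /sg rmorphM rmorphXn rmorphN1 size_map. Qed.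

Lemma cj_ewedge f g : cj (f ∧ g) = cj f ∧ cj g.
Proof.
apply/funext => s; elim: s f g => [|x s IH] f g; first by rewrite /cj !ewedge_nil rmorphM.
rewrite ewedge_cons -cj_sg !contract_cj -!IH -addTE -cjD -contract_ewedge.
by [].
Qed.

Lemma cj_dcoord x : cj (dcoord C x) = dcoord C (barJ x).
Proof.
apply/funext => s; rewrite /cj /dcoord conjC_nat; congr (nat_of_bool _)%:R.
by rewrite -[in RHS](inj_eq (inj_map (inv_inj barJK))) /= barJK.
Qed.

Lemma cj_skew f : skew f -> skew (cj f).
Proof. by move=> sf s1 x y s2; rewrite /cj !map_cat /= sf rmorphN. Qed.

Lemma cj_hom p f : hom p f -> hom p (cj f).
Proof. by move=> hf s hs; rewrite /cj hf ?rmorph0 // size_map. Qed.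

Lemma ty_cj p d e f : (d + e)%N = p -> ty p d f -> ty p e (cj f).
Proof.
move=> pde [hf sf tf]; split; [exact: cj_hom|exact: cj_skew|] => s hs.
have [sp|hsp] := eqVneq (size s) p; last exact: (cj_hom hf).
rewrite /cj tf ?rmorph0 //; apply: contra_neq hs => hd; apply/eqP.
by rewrite -(eqn_add2l d) pde -sp -{1}hd nfalse_bar.
Qed.

Lemma sumJ (M : nmodType) (F : J -> M) :
  \sum_x F x = \sum_i F (true, i) + \sum_i F (false, i).
Proof.
rewrite (eq_bigr (fun x => F (x.1, x.2))); last by case.
by rewrite -(pair_bigA _ (fun b i => F (b, i))) /= big_bool.
Qed.

Lemma nfalse_true s : nfalse s = 0%N -> s = map (fun i => (true, i)) (map snd s).
Proof.
elim: s => [|[b i] s IH] //; rewrite /nfalse /=; case: b => //= /IH <-.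
by [].
Qed.

Lemma holo_overflow p f : ty p 0 f -> (n < p)%N -> f = 0.
Proof.
case=> hf sf tf np; apply/funext => s; have [sp|/hf//] := eqVneq (size s) p.
have [s0|/tf//] := eqVneq (nfalse s) 0%N.
apply: skew_nuniq => //; rewrite (nfalse_true s0); apply: contraL np => us.
rewrite -leqNgt -sp -(size_map snd); move/map_uniq/card_uniqP: us => <-.
by rewrite -[X in (_ <= X)%N]card_ord max_card.
Qed.

Definition ztop : seq J := map (fun i => (true, i)) (enum 'I_n).

(** The difference of the two sides vanishes at [ztop] by construction, hence at every reordering of
    it, and no other list of n distinct holomorphic indices exists. *)
Lemma holo_top f g : ty n 0 f -> ty n 0 g -> f ztop *: g = g ztop *: f.
Proof.
move=> tf tg; apply/eqP; rewrite -subr_eq0; apply/eqP.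
have [] : ty n 0 (f ztop *: g - g ztop *: f).
  by rewrite -scaleNr; apply: tyD; exact: tyZ.
set F := _ - _ => hF sF tF; apply/funext => s.
have [sn|/hF//] := eqVneq (size s) n; have [s0|/tF//] := eqVneq (nfalse s) 0%N.
have [us|] := boolP (uniq s); last exact: skew_nuniq.
apply: (@skew_perm_eq0 _ _ _ _ ztop) => //; last first.
  by rewrite /F addTE oppTE !scaleTE mulrC subrr.
have [u2 e2] : uniq ztop /\ size ztop = n.
  split; last by rewrite size_map size_enum_ord.
  by rewrite map_inj_uniq ?enum_uniq // => a b [].
apply: uniq_perm => //.
apply: (uniq_min_size us _ _).2; last by rewrite e2 sn.
move=> x xs; have : all (fun x => x.1) s.
  by rewrite all_count; apply/eqP; rewrite -(count_predC (fun x => ~~ x.1) s) -/(nfalse s) s0; apply: eq_count => y /=; rewrite negbK.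
by move/allP/(_ x xs); case: x {xs} => -[] // i _; apply: map_f; rewrite mem_enum.
Qed.

Definition Psi : tensor C J := \big[@ewedge C J/tensor_one]_(i < n) dz i.

Lemma PsiE : Psi = \big[@ewedge C J/tensor_one]_(i <- enum 'I_n) dz i.
Proof. by rewrite /Psi enumT [index_enum _]unlock. Qed.

Lemma ty_Psi : ty n 0 Psi.
Proof.
rewrite PsiE -[X in ty X]size_enum_ord.
elim: (enum 'I_n) => [|i r IH].
  rewrite big_nil; split.
  - by case.
  - by move=> [|u s1] x y s2; rewrite /tensor_one /= oppr0.
  - by case.
by rewrite big_cons; exact: (ty_ewedge (ty_dz i) IH).
Qed.

Lemma Psi_ztop : Psi ztop = 1.
Proof.
rewrite PsiE /ztop; elim: (enum 'I_n) (enum_uniq 'I_n) => [|i r IH] /=.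
  by rewrite big_nil.
case/andP=> ir ur; rewrite big_cons -[LHS]/(contract _ _ _) contract_dwedge eqxx scale1r.
rewrite (_ : iz i _ = 0) ?ewedge0r ?subr0; first exact: IH.
elim: r ir {ur IH} => [|j r IH]; first by rewrite big_nil.
rewrite inE negb_or big_cons => /andP[ij ir]; rewrite contract_dwedge IH // ewedge0r.
by rewrite xpair_eqE (negPf ij) scale0r subr0.
Qed.

Lemma Psi_neq0 : Psi != 0.
Proof. by apply/eqP => P0; have := Psi_ztop; rewrite P0 => /eqP; rewrite eq_sym oner_eq0. Qed.

Lemma holo_Psi f : ty n 0 f -> f = f ztop *: Psi.
Proof. by move=> tf; rewrite (holo_top tf ty_Psi) Psi_ztop scale1r. Qed.

End ComplexForms.

(** * Contractions of Psi, the form om, and the forms Q c and P u *)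

Section FormIdentities.
Variables (C : numClosedFieldType) (n : nat).
Local Notation J := (bool * 'I_n)%type.
Implicit Types (f g : tensor C J) (x y : J) (s : seq J) (i j k l m : 'I_n).
Local Notation dz i := (dcoord C (true, i)).
Local Notation db i := (dcoord C (false, i)).
Local Notation Psi := (@Psi C n).

Lemma iz_db i j f : iz i (db j ∧ f) = - (db j ∧ iz i f).
Proof. by rewrite contract_dwedge scale0r sub0r. Qed.

Lemma iz_dz i j f : iz i (dz j ∧ f) = (i == j)%:R *: f - dz j ∧ iz i f.
Proof. by rewrite contract_dwedge. Qed.

Lemma ib_db i j f : ib i (db j ∧ f) = (i == j)%:R *: f - db j ∧ ib i f.
Proof. by rewrite contract_dwedge. Qed.

Lemma dwedgeC x y f : dcoord C x ∧ (dcoord C y ∧ f) = - (dcoord C y ∧ (dcoord C x ∧ f)).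
Proof.
rewrite ewedgeA (ewedgeC (@dcoord_hom _ _ x) (@dcoord_hom _ _ y)) expr1 scaleN1r.
by rewrite ewedgeNl ewedgeA.
Qed.

Lemma dwedge_Psi i : dz i ∧ Psi = 0.
Proof. exact: (holo_overflow (ty_ewedge (ty_dz _ i) (@ty_Psi C n))). Qed.

Lemma ib_Psi i : ib i Psi = 0.
Proof. exact: (ty0_ib _ (@ty_Psi C n)). Qed.

Lemma ib_iz i j f : skew f -> ib i (iz j f) = - iz j (ib i f).
Proof. exact: skew_contractC. Qed.

Lemma skew_Psi : skew Psi. Proof. by case: (@ty_Psi C n). Qed.

Lemma dz_iz_Psi i j : dz i ∧ iz j Psi = (j == i)%:R *: Psi.
Proof.
have := congr1 (iz j) (dwedge_Psi i); rewrite iz_dz contract0 => /eqP.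
by rewrite subr_eq0 => /eqP.
Qed.

(** The Kähler form. The minus sign comes from the convention om(X, Y) = <X, IY>, opposite to <IX,
    Y>. *)
Definition omJ : tensor C J := (- ('i / 2)) *: \sum_j dz j ∧ db j.
Local Notation kap := ('i / 2 : C).

Lemma ty_omJ : ty 2 1 omJ.
Proof.
apply: tyZ; apply: ty_sum => j _; exact: (ty_ewedge (ty_dz _ j) (ty_db _ j)).
Qed.

Lemma om_comm p f : hom p f -> f ∧ omJ = omJ ∧ f.
Proof.
case: ty_omJ => h _ _ hf.
by rewrite (ewedgeC hf h) mulnC exprM sqrrN expr1n expr1n scale1r.
Qed.

Lemma om_pull p f g : hom p f -> omJ ∧ (f ∧ g) = f ∧ (omJ ∧ g).
Proof. by move=> hf; rewrite !ewedgeA (om_comm hf). Qed.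

Lemma sg_om : sg omJ = omJ.
Proof. by case: ty_omJ => h _ _; rewrite (sg_hom h) sqrrN expr1n scale1r. Qed.

Lemma iz_om k : iz k omJ = (- kap) *: db k.
Proof.
rewrite contractZ contract_sum; congr (_ *: _).
rewrite (bigD1 k) //= iz_dz eqxx scale1r contract_dcoord scale0r ewedge0r subr0.
rewrite big1 ?addr0 // => j jk.
by rewrite iz_dz eq_sym (negPf jk) scale0r contract_dcoord scale0r ewedge0r subr0.
Qed.

Lemma iz_om_wedge k f : iz k (omJ ∧ f) = (- kap) *: (db k ∧ f) + omJ ∧ iz k f.
Proof. by rewrite contract_ewedge iz_om ewedgeZl sg_om. Qed.

Lemma om_Psi : omJ ∧ Psi = 0.
Proof.
rewrite ewedgeZl ewedge_suml big1 ?scaler0 // => j _.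
by rewrite -ewedgeA dwedgeC dwedge_Psi ewedge0r oppr0.
Qed.

(* The next three identities are obtained by contracting om /\ Psi = 0. *)
Lemma om_izPsi j : omJ ∧ iz j Psi = kap *: (db j ∧ Psi).
Proof.
have := congr1 (iz j) om_Psi; rewrite iz_om_wedge contract0 => /eqP.
by rewrite scaleNr addrC subr_eq0 => /eqP.
Qed.

Lemma om_iz2Psi l j :
  omJ ∧ iz l (iz j Psi) = kap *: (db l ∧ iz j Psi - db j ∧ iz l Psi).
Proof.
have := congr1 (iz l) (om_izPsi j); rewrite iz_om_wedge contractZ iz_db scaleNr.
by move/eqP; rewrite addrC subr_eq => /eqP ->; rewrite scalerBr scalerN addrC.
Qed.

Lemma om_iz3Psi k l j :
  omJ ∧ iz k (iz l (iz j Psi)) =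
  kap *: (db k ∧ iz l (iz j Psi) - db l ∧ iz k (iz j Psi) + db j ∧ iz k (iz l Psi)).
Proof.
have := congr1 (iz k) (om_iz2Psi l j).
rewrite iz_om_wedge contractZ contractD contractN !iz_db scaleNr.
move/eqP; rewrite addrC subr_eq => /eqP ->; rewrite -scalerDr; congr (_ *: _).
by rewrite opprK addrC addrA.
Qed.

(** One more factor om is moved past the barred one-forms of [om_iz3Psi], where [om_iz2Psi] applies.
    Each of the three cyclic terms then arises twice, which is the factor 2. *)
Lemma om2_iz3Psi k l j :
  omJ ∧ (omJ ∧ iz k (iz l (iz j Psi))) =
  (kap * kap *+ 2) *: (db k ∧ (db l ∧ iz j Psi) + db l ∧ (db j ∧ iz k Psi)
                       + db j ∧ (db k ∧ iz l Psi)).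
Proof.
have H i f : omJ ∧ (db i ∧ f) = db i ∧ (omJ ∧ f) by apply: om_pull; exact: dcoord_hom.
rewrite om_iz3Psi ewedgeZr !ewedgeDr !ewedgeNr !H !om_iz2Psi !ewedgeZr.
rewrite !ewedgeDr !ewedgeNr (dwedgeC (false, j) (false, k)) (dwedgeC (false, l) (false, k)).
rewrite (dwedgeC (false, j) (false, l)) !scalerDr !scalerN !scalerA.
set a := db k ∧ (db l ∧ _); set b := db k ∧ (db j ∧ _); set c := db l ∧ (db j ∧ _).
apply/funext => s; rewrite !(addTE, oppTE, scaleTE).
by move: (a s) (b s) (c s) ('i / 2) => u v w z; ring.
Qed.

(* Coordinates on the forms of type (n - 1, 2) and (n, 1). *)
Definition Qf (c : 'I_n -> 'I_n -> 'I_n -> C) : tensor C J :=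
  \sum_m \sum_l \sum_j c m l j *: (db m ∧ (db l ∧ iz j Psi)).

Definition Pf (u : 'I_n -> C) : tensor C J := \sum_l u l *: (db l ∧ Psi).

Lemma ty_Qf c p : p.+1 = n -> ty n.+1 2 (Qf c).
Proof.
move=> pn; apply: ty_sum => m _; apply: ty_sum => l _; apply: ty_sum => j _; apply: tyZ.
have tP : ty p 0 (iz j Psi) by apply: ty_iz; rewrite pn; exact: ty_Psi.
by have := ty_ewedge (ty_db C m) (ty_ewedge (ty_db C l) tP); rewrite -[(1 + (1 + p))%N]/p.+2 pn.
Qed.

Lemma ty_Pf u : ty n.+1 1 (Pf u).
Proof.
apply: ty_sum => m _; apply: tyZ.
exact: (ty_ewedge (ty_db _ m) (@ty_Psi C n)).
Qed.

Lemma QfD c d : Qf (fun m l j => c m l j + d m l j) = Qf c + Qf d.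
Proof.
rewrite /Qf -big_split; apply: eq_bigr => m _; rewrite -big_split; apply: eq_bigr => l _.
by rewrite -big_split; apply: eq_bigr => j _; rewrite scalerDl.
Qed.

Lemma QfZ a c : Qf (fun m l j => a * c m l j) = a *: Qf c.
Proof.
rewrite /Qf scaler_sumr; apply: eq_bigr => m _; rewrite scaler_sumr; apply: eq_bigr => l _.
by rewrite scaler_sumr; apply: eq_bigr => j _; rewrite scalerA.
Qed.

Lemma eq_Qf c d : (forall m l j, c m l j = d m l j) -> Qf c = Qf d.
Proof.
move=> e; apply: eq_bigr => m _; apply: eq_bigr => l _; apply: eq_bigr => j _.
by rewrite e.
Qed.

Lemma PfD u v : Pf (fun l => u l + v l) = Pf u + Pf v.
Proof. by rewrite /Pf -big_split; apply: eq_bigr => m _; rewrite scalerDl. Qed.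

Lemma PfZ a u : Pf (fun l => a * u l) = a *: Pf u.
Proof. by rewrite /Pf scaler_sumr; apply: eq_bigr => m _; rewrite scalerA. Qed.

Lemma eq_Pf u v : (forall l, u l = v l) -> Pf u = Pf v.
Proof. by move=> e; apply: eq_bigr => l _; rewrite e. Qed.

Lemma Qf_swap c : Qf (fun m l j => c l m j) = - Qf c.
Proof.
rewrite /Qf exchange_big -sumrN; apply: eq_bigr => m _; rewrite -sumrN; apply: eq_bigr => l _.
rewrite -sumrN; apply: eq_bigr => j _.
by rewrite dwedgeC scalerN.
Qed.

(** [Qf] depends only on the part of [c] skew in the two antiholomorphic indices; coefficients are
    compared after this doubling. *)
Lemma Qf_skew c : Qf (fun m l j => c m l j - c l m j) = Qf c *+ 2.
Proof.
have -> : Qf (fun m l j => c m l j - c l m j) = Qf (fun m l j => c m l j + -1 * c l m j).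
  by apply: eq_Qf => m l j; rewrite mulN1r.
rewrite (QfD c (fun m l j => -1 * c l m j)) (QfZ (-1) (fun m l j => c l m j)) (Qf_swap c).
by rewrite scaleN1r opprK mulr2n.
Qed.

Lemma ib_Pf m u : ib m (Pf u) = u m *: Psi.
Proof.
rewrite contract_sum (bigD1 m) //= contractZ ib_db eqxx scale1r ib_Psi ewedge0r subr0.
rewrite big1 ?addr0 // => l lm.
by rewrite contractZ ib_db eq_sym (negPf lm) scale0r ib_Psi ewedge0r subr0 scaler0.
Qed.

Lemma ib_izPsi i j : ib i (iz j Psi) = 0.
Proof. by rewrite (ib_iz _ _ skew_Psi) ib_Psi contract0 oppr0. Qed.

Lemma ib_Qf m c : ib m (Qf c) = \sum_l \sum_j (c m l j - c l m j) *: (db l ∧ iz j Psi).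
Proof.
rewrite contract_sum.
transitivity (\sum_m' \sum_l \sum_j c m' l j *:
   ((m == m')%:R *: (db l ∧ iz j Psi) - (m == l)%:R *: (db m' ∧ iz j Psi))).
  apply: eq_bigr => m' _; rewrite contract_sum; apply: eq_bigr => l _.
  rewrite contract_sum; apply: eq_bigr => j _; rewrite contractZ ib_db ib_db.
  by rewrite ib_izPsi ewedge0r subr0 ewedgeZr.
transitivity (\sum_m' \sum_l \sum_j (m == m')%:R *: (c m' l j *: (db l ∧ iz j Psi)) -
              \sum_m' \sum_l \sum_j (m == l)%:R *: (c m' l j *: (db m' ∧ iz j Psi))).
  rewrite -sumrB; apply: eq_bigr => m' _; rewrite -sumrB; apply: eq_bigr => l _.
  rewrite -sumrB; apply: eq_bigr => j _; rewrite scalerBr !scalerA.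
  by rewrite mulrC [X in _ - X *: _]mulrC.
have pick (G : 'I_n -> 'I_n -> 'I_n -> tensor C J) :
    \sum_m' \sum_l \sum_j (m == m')%:R *: G m' l j = \sum_l \sum_j G m l j.
  rewrite (bigD1 m) //= [X in _ + X]big1 ?addr0 => [|m' mm].
    by apply: eq_bigr => l _; apply: eq_bigr => j _; rewrite eqxx scale1r.
  by apply: big1 => l _; apply: big1 => j _; rewrite eq_sym (negPf mm) scale0r.
rewrite [X in _ - X]exchange_big pick.
rewrite (pick (fun l m' j => c m' l j *: (db m' ∧ iz j Psi))).
rewrite -sumrB; apply: eq_bigr => l _; rewrite -sumrB; apply: eq_bigr => j _.
by rewrite scalerBl.
Qed.

Lemma ib_db_sum l (F : 'I_n -> tensor C J) :
  (forall j, ib l (F j) = 0) -> ib l (\sum_j db j ∧ F j) = F l.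
Proof.
move=> F0; rewrite contract_sum (bigD1 l) //= ib_db eqxx scale1r F0 ewedge0r subr0.
rewrite big1 ?addr0 // => j jl.
by rewrite ib_db eq_sym (negPf jl) scale0r F0 ewedge0r subr0.
Qed.

Lemma dz_sum_izPsi j (h : 'I_n -> C) : dz j ∧ (\sum_k h k *: iz k Psi) = h j *: Psi.
Proof.
rewrite ewedge_sumr (bigD1 j) //= ewedgeZr dz_iz_Psi eqxx scale1r big1 ?addr0 // => k kj.
by rewrite ewedgeZr dz_iz_Psi (negPf kj) scale0r scaler0.
Qed.

Lemma ib2_Qf l m c : ib l (ib m (Qf c)) = \sum_j (c m l j - c l m j) *: iz j Psi.
Proof.
rewrite ib_Qf.
under eq_bigr => a _.
  under eq_bigr => j _ do rewrite -ewedgeZr.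
  rewrite -ewedge_sumr; over.
rewrite ib_db_sum // => a; rewrite contract_sum big1 // => j _.
by rewrite contractZ ib_izPsi scaler0.
Qed.

(** Two barred contractions followed by a wedge with dz_j turn [Qf c] into a multiple of Psi, whose
    coefficient is the skew part of [c]. *)
Lemma Qf_eq0 c : Qf c = 0 -> forall m l j, c m l j = c l m j.
Proof.
move=> c0 m l j; have := ib2_Qf l m c; rewrite c0 !contract0 => /esym E.
have := dz_sum_izPsi j (fun j => c m l j - c l m j); rewrite E ewedge0r => /esym/eqP.
by rewrite scaler_eq0 (negPf (Psi_neq0 C n)) orbF subr_eq0 => /eqP.
Qed.

Lemma Pf_eq0 u : Pf u = 0 -> forall l, u l = 0.
Proof.
move=> u0 l; have /esym/eqP := ib_Pf l u; rewrite u0 contract0 scaler_eq0.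
by rewrite (negPf (Psi_neq0 C n)) orbF => /eqP.
Qed.

Lemma om_Pf u : omJ ∧ Pf u = 0.
Proof.
rewrite ewedge_sumr big1 // => l _.
by rewrite ewedgeZr (om_pull _ (@dcoord_hom _ _ _)) om_Psi ewedge0r scaler0.
Qed.

Lemma om_Qf c :
  omJ ∧ Qf c = kap *: \sum_m \sum_l \sum_j c m l j *: (db m ∧ (db l ∧ (db j ∧ Psi))).
Proof.
rewrite ewedge_sumr scaler_sumr; apply: eq_bigr => m _.
rewrite ewedge_sumr scaler_sumr; apply: eq_bigr => l _.
rewrite ewedge_sumr scaler_sumr; apply: eq_bigr => j _.
rewrite ewedgeZr !(om_pull _ (@dcoord_hom _ _ _)) om_izPsi !ewedgeZr !scalerA.
by rewrite mulrC.
Qed.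

End FormIdentities.

(** * Expansions by type, and the alternation of Xi in components *)

Section Expansions.
Variables (C : numClosedFieldType) (n : nat).
Local Notation J := (bool * 'I_n)%type.
Implicit Types (f g : tensor C J) (x y : J) (s : seq J) (i j k l m : 'I_n).
Local Notation dz i := (dcoord C (true, i)).
Local Notation db i := (dcoord C (false, i)).
Local Notation Psi := (@Psi C n).
Local Notation omJ := (@omJ C n).
Local Notation ztop := (@ztop n).

Lemma euler_hom p f : hom p f -> skew f ->
  \sum_x dcoord C x ∧ contract x f = p%:R *: f.
Proof.
move=> hf sf; apply/funext => s; rewrite (@euler _ _ predT) // count_predT scaleTE.
by have [->//|/hf ->] := eqVneq (size s) p; rewrite !mulr0.
Qed.

Lemma euler_true p f : ty p 0 f -> \sum_i dz i ∧ iz i f = p%:R *: f.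
Proof.
move=> tf; case: (tf) => hf sf _; rewrite -(euler_hom hf sf) sumJ.
by rewrite [X in _ + X]big1 ?addr0 // => i _; rewrite (ty0_ib i tf) ewedge0r.
Qed.

Lemma euler_false p d f : ty p d f -> \sum_i db i ∧ ib i f = d%:R *: f.
Proof.
case=> hf sf tf; apply/funext => s.
transitivity ((\sum_(x : J | ~~ x.1) dcoord C x ∧ contract x f) s).
  by rewrite [in RHS]big_mkcond sumJ /= [X in _ = (X + _) _]big1 ?add0r.
rewrite euler // scaleTE -/(nfalse s).
by have [->//|/tf ->] := eqVneq (nfalse s) d; rewrite !mulr0.
Qed.

(** Euler's identity for the operators in the other order: they count the n - p missing indices.
    Raising the degree up to n in this way writes a holomorphic form as an iterated contraction of
    Psi. *)
Lemma holo_step p f : ty p 0 f -> (p < n)%N ->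
  f = (n - p)%:R^-1 *: \sum_j iz j (dz j ∧ f).
Proof.
move=> tf pn; under eq_bigr => j _ do rewrite iz_dz eqxx scale1r.
rewrite sumrB sumr_const card_ord (euler_true tf) -[f *+ n]scaler_nat -scalerBl.
by rewrite -natrB ?(ltnW pn) // scalerA mulVf ?scale1r // pnatr_eq0 subn_eq0 -ltnNge.
Qed.

Lemma expand_izPsi p f : p.+1 = n -> ty p 0 f ->
  f = \sum_j ((dz j ∧ f) ztop) *: iz j Psi.
Proof.
move=> pn tf; have pn' : (p < n)%N by rewrite -pn.
have e1 : (n - p)%N = 1%N by rewrite -pn subSnn.
rewrite {1}(holo_step tf pn') e1 invr1 scale1r.
apply: eq_bigr => j _; rewrite -contractZ -holo_Psi //.
by have := ty_ewedge (ty_dz C j) tf; rewrite add1n pn.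
Qed.

Lemma expand_iz2Psi p f : p.+2 = n -> ty p 0 f ->
  exists h : 'I_n -> 'I_n -> C, f = \sum_l \sum_j h l j *: iz l (iz j Psi).
Proof.
move=> pn tf; exists (fun l j => (n - p)%:R^-1 * (dz j ∧ (dz l ∧ f)) ztop).
have pn' : (p < n)%N by rewrite -pn.
rewrite {1}(holo_step tf pn') scaler_sumr; apply: eq_bigr => l _.
have tl : ty p.+1 0 (dz l ∧ f) by have := ty_ewedge (ty_dz C l) tf; rewrite add1n.
rewrite {1}(expand_izPsi pn tl) contract_sum scaler_sumr; apply: eq_bigr => j _.
by rewrite scalerA.
Qed.

Lemma expand_iz3Psi p f : p.+3 = n -> ty p 0 f ->
  exists h : 'I_n -> 'I_n -> 'I_n -> C,
    f = \sum_k \sum_l \sum_j h k l j *: iz k (iz l (iz j Psi)).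
Proof.
move=> pn tf.
have tl l : ty p.+1 0 (dz l ∧ f) by have := ty_ewedge (ty_dz C l) tf; rewrite add1n.
have /boolp.choice [h hE] := fun l => expand_iz2Psi pn (tl l).
exists (fun k l j => (n - p)%:R^-1 * h k l j).
have pn' : (p < n)%N by rewrite -pn !ltnS leqW.
rewrite {1}(holo_step tf pn') scaler_sumr; apply: eq_bigr => k _.
rewrite (hE k) contract_sum scaler_sumr; apply: eq_bigr => l _.
rewrite contract_sum scaler_sumr; apply: eq_bigr => j _.
by rewrite -scalerA.
Qed.

Lemma expand_Pf f : ty n.+1 1 f -> f = Pf (fun l => ib l f ztop).
Proof.
move=> tf; rewrite -[LHS]scale1r -(euler_false tf); apply: eq_bigr => l _.
by rewrite -ewedgeZr -holo_Psi //; exact: ty_ib.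
Qed.

Lemma expand_Qf p f : p.+1 = n -> ty n.+1 2 f ->
  f = Qf (fun m l j => 2^-1 * (dz j ∧ ib l (ib m f)) ztop).
Proof.
move=> pn tf.
have e1 : f = 2^-1 *: \sum_m db m ∧ ib m f.
  by rewrite (euler_false tf) scalerA mulVf ?pnatr_eq0 // scale1r.
rewrite {1}e1 scaler_sumr; apply: eq_bigr => m _.
have tm : ty n 1 (ib m f) by exact: ty_ib.
have e2 : ib m f = \sum_l db l ∧ ib l (ib m f) by rewrite (euler_false tm) scale1r.
rewrite {1}e2 ewedge_sumr scaler_sumr; apply: eq_bigr => l _.
have tl : ty p 0 (ib l (ib m f)) by apply: ty_ib; rewrite pn.
rewrite {1}(expand_izPsi pn tl) !ewedge_sumr scaler_sumr; apply: eq_bigr => j _.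
by rewrite !ewedgeZr scalerA.
Qed.

Lemma nfalse_swap s1 x y s2 : nfalse (s1 ++ x :: y :: s2) = nfalse (s1 ++ y :: x :: s2).
Proof. by rewrite /nfalse !count_cat /= !addnA (addnAC _ (~~ x.1)). Qed.

Definition part d f : tensor C J := fun s => if nfalse s == d then f s else 0.

Lemma ty_part p d f : hom p f -> skew f -> ty p d (part d f).
Proof.
move=> hf sf; split=> [s hs|s1 x y s2|s hs]; rewrite /part.
- by rewrite hf // if_same.
- by rewrite nfalse_swap; case: ifP => _; rewrite ?oppr0.
- by rewrite (negPf hs).
Qed.

Lemma expand_QPf f : (0 < n)%N -> hom n.+1 f -> skew f ->
  (forall s, (2 < nfalse s)%N -> f s = 0) -> exists c u, f = Qf c + Pf u.
Proof.
move=> n0 hf sf f2; have pn : n.-1.+1 = n by rewrite prednK.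
have -> : f = part 2 f + part 1 f.
  (* Type (n + 1, 0) is empty, so at most two antiholomorphic arguments means one or two. *)
  have -> : part 2 f + part 1 f = part 0 f + (part 2 f + part 1 f).
    by rewrite (holo_overflow (ty_part 0 hf sf)) ?add0r.
  apply/funext => s; rewrite !addTE /part; have := f2 s.
  by case: (nfalse s) => [|[|[|k]]] /=; rewrite ?add0r ?addr0 // => ->.
exists (fun m l j => 2^-1 * (dz j ∧ ib l (ib m (part 2 f))) ztop).
exists (fun l => ib l (part 1 f) ztop).
by rewrite -(expand_Qf pn (ty_part 2 hf sf)) -(expand_Pf (ty_part 1 hf sf)).
Qed.

Lemma QPf_real_eq0 c u : (3 < n)%N -> Qf c + Pf u + cj (Qf c + Pf u) = 0 ->
  Qf c = 0 :> tensor C J /\ Pf u = 0 :> tensor C J.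
Proof.
move=> n3 F0; have pn : n.-1.+1 = n by rewrite prednK // (leq_trans _ n3).
have [_ _ tQ] := ty_Qf (C:=C) c pn; have [_ _ tP] := ty_Pf (C:=C) u.
have [_ _ tQ'] : ty n.+1 n.-1 (cj (Qf c)).
  by apply: ty_cj (ty_Qf c pn); rewrite add2n pn.
have [_ _ tP'] : ty n.+1 n (cj (Pf u)) by apply: ty_cj (ty_Pf u); rewrite add1n.
have E s : Qf c s + Pf u s + (cj (Qf c) s + cj (Pf u) s) = 0.
  by have := congr1 (fun F => F s) F0; rewrite cjD.
(* The conjugate forms live on lists with n - 1 or n barred entries; the bound keeps them away from
   lists with at most two. *)
have n1 : (2 < n.-1)%N by rewrite -ltnS pn.
have lt2 d s : nfalse s = d -> (d <= 2)%N -> cj (Qf c) s = 0 /\ cj (Pf u) s = 0.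
  move=> sd d2; split; [apply: tQ'|apply: tP']; rewrite sd ltn_eqF //.
    exact: leq_ltn_trans n1.
  by apply: (leq_ltn_trans d2); exact: ltnW.
split; apply/funext => s.
  have [s2|/tQ//] := eqVneq (nfalse s) 2%N.
  have [e1 e2] := lt2 _ _ s2 isT; have := E s.
  by rewrite e1 e2 (tP s) ?s2 // !addr0.
have [s2|/tP//] := eqVneq (nfalse s) 1%N.
have [e1 e2] := lt2 _ _ s2 isT; have := E s.
by rewrite e1 e2 (tQ s) ?s2 // !addr0 add0r.
Qed.

(** By [om_Qf] this is om /\ [Qf c] up to the factor i/2, a form of type (n, 3). *)
Definition Rf (c : 'I_n -> 'I_n -> 'I_n -> C) : tensor C J :=
  \sum_m \sum_l \sum_j c m l j *: (db m ∧ (db l ∧ (db j ∧ Psi))).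

Lemma ty_Rf c : ty n.+3 3 (Rf c).
Proof.
apply: ty_sum => m _; apply: ty_sum => l _; apply: ty_sum => j _; apply: tyZ.
exact: (ty_ewedge (ty_db C m) (ty_ewedge (ty_db C l) (ty_ewedge (ty_db C j) (@ty_Psi C n)))).
Qed.

Lemma Rf_rot c : Rf (fun m l j => c l j m) = Rf c.
Proof.
rewrite /Rf.
transitivity (\sum_j \sum_m \sum_l c m l j *: (db m ∧ (db l ∧ (db j ∧ Psi)))).
  apply: eq_bigr => j _; apply: eq_bigr => m _; apply: eq_bigr => l _.
  by rewrite dwedgeC (dwedgeC (false, j) (false, l)) ewedgeNr opprK.
by rewrite exchange_big; apply: eq_bigr => m _; rewrite exchange_big.
Qed.

Lemma RfD c d : Rf (fun m l j => c m l j + d m l j) = Rf c + Rf d.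
Proof.
rewrite /Rf -big_split; apply: eq_bigr => m _; rewrite -big_split; apply: eq_bigr => l _.
by rewrite -big_split; apply: eq_bigr => j _; rewrite scalerDl.
Qed.

(** Rotating three anticommuting factors is an even permutation, so three times [Rf c] is [Rf] of
    the cyclic sum. *)
Lemma Rf_cyclic c : (forall m l j, c m l j + c l j m + c j m l = 0) -> Rf c = 0.
Proof.
move=> c0; have : Rf c *+ 3 = 0; last first.
  by move/eqP; rewrite -scaler_nat scaler_eq0 pnatr_eq0 => /eqP.
have e1 := Rf_rot c; have /= e2 := Rf_rot (fun m l j => c l j m).
have : Rf (fun m l j => c m l j + c l j m + c j m l) = 0.
  by apply: big1 => m _; apply: big1 => l _; apply: big1 => j _; rewrite c0 scale0r.
rewrite (RfD (fun m l j => c m l j + c l j m) (fun m l j => c j m l)) e2.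
by rewrite (RfD c (fun m l j => c l j m)) e1 !mulrS mulr0n addr0 addrA.
Qed.

Lemma ib_sum a (F : 'I_n -> tensor C J) :
  ib a (\sum_l db l ∧ F l) = F a - \sum_l db l ∧ ib a (F l).
Proof.
rewrite contract_sum; under eq_bigr => l _ do rewrite ib_db.
rewrite sumrB (bigD1 a) //= eqxx scale1r big1 ?addr0 // => l la.
by rewrite eq_sym (negPf la) scale0r.
Qed.

(** Three barred contractions extract the alternating sum over all six orders; skewness in the last
    two indices folds it into twice the cyclic sum. *)
Lemma Rf_eq0 c : Rf c = 0 -> (forall m l j, c m l j = - c m j l) ->
  forall m l j, c m l j + c l j m + c j m l = 0.
Proof.
move=> R0 csk a b d.
(* [G] and [H] are the inner sums of [Rf c]; [L] is what remains of [G] when a contraction hits the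
   innermost barred factor. *)
pose H m l := \sum_j db j ∧ (c m l j *: Psi).
pose G m := \sum_l db l ∧ H m l.
have ibP i e : ib i (e *: Psi) = 0 by rewrite contractZ ib_Psi scaler0.
have ibH i m l : ib i (H m l) = c m l i *: Psi by rewrite ib_db_sum.
pose L m i := \sum_l db l ∧ (c m l i *: Psi).
have ibL i m k : ib i (L m k) = c m i k *: Psi by rewrite ib_db_sum.
have ibG i m : ib i (G m) = H m i - L m i.
  by rewrite ib_sum; congr (_ - _); apply: eq_bigr => l _; rewrite ibH.
have RE : Rf c = \sum_m db m ∧ G m.
  apply: eq_bigr => m _; rewrite ewedge_sumr; apply: eq_bigr => l _.
  by rewrite !ewedge_sumr; apply: eq_bigr => j _; rewrite !ewedgeZr.
have s1 : ib a (Rf c) = G a - \sum_m db m ∧ (H m a - L m a).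
  by rewrite RE ib_sum; congr (_ - _); apply: eq_bigr => m _; rewrite ibG.
have s2 : ib b (ib a (Rf c)) =
    H a b - L a b - (H b a - L b a - \sum_m db m ∧ ((c m a b - c m b a) *: Psi)).
  rewrite s1 contractD contractN ibG ib_sum; congr (_ - (_ - _)); apply: eq_bigr => m _.
  by rewrite contractD contractN ibH ibL -scalerBl.
have s3 : ib d (ib b (ib a (Rf c))) =
    (c a b d - c a d b - (c b a d - c b d a - (c d a b - c d b a))) *: Psi.
  rewrite s2 !(contractD, contractN) !ibH !ibL ib_db_sum //.
  by rewrite -!(scalerBl, scalerDl).
move/esym: s3; rewrite R0 !contract0 => /eqP.
rewrite scaler_eq0 (negPf (Psi_neq0 C n)) orbF => /eqP E.
have : (c a b d + c b d a + c d a b) *+ 2 = 0.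
  by rewrite -[RHS]E (csk a d b) (csk b a d) (csk d b a); ring.
by move/eqP; rewrite -mulr_natr mulf_eq0 pnatr_eq0 orbF => /eqP.
Qed.

(* The image under Xi_+ of the tensor with components A. *)
Definition XiT (A : J -> 'I_n -> 'I_n -> C) : tensor C J := fun s =>
  if s is x :: s' then ((2 * 'i)^-1 *: \sum_j \sum_l A x j l *: (db l ∧ iz j Psi)) s' else 0.

Lemma contract_XiT A x :
  contract x (XiT A) = (2 * 'i)^-1 *: \sum_j \sum_l A x j l *: (db l ∧ iz j Psi).
Proof. by []. Qed.

(** A barred leading index just adds a barred factor. A holomorphic one meets the contraction of
    Psi, where [dz_iz_Psi] leaves only the trace; the minus sign comes from passing the barred
    factor. *)
Lemma alt_XiT A :
  alt (XiT A) = Qf (fun m l j => (2 * 'i)^-1 * A (false, m) j l)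
              + Pf (fun l => - (2 * 'i)^-1 * \sum_j A (true, j) j l).
Proof.
rewrite alt_dcoord sumJ addrC; congr (_ + _).
  apply: eq_bigr => m _; rewrite contract_XiT ewedgeZr exchange_big ewedge_sumr scaler_sumr.
  apply: eq_bigr => l _; rewrite ewedge_sumr scaler_sumr; apply: eq_bigr => j _.
  by rewrite ewedgeZr scalerA.
transitivity (\sum_i \sum_l (- (2 * 'i)^-1 * A (true, i) i l) *: (db l ∧ Psi)).
  apply: eq_bigr => i _; rewrite contract_XiT ewedgeZr exchange_big ewedge_sumr scaler_sumr.
  apply: eq_bigr => l _; rewrite ewedge_sumr (bigD1 i) //= ewedgeZr dwedgeC dz_iz_Psi eqxx.
  rewrite big1 ?addr0 => [|j ji]; first by rewrite scale1r !scalerN scalerA mulNr scaleNr.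
  by rewrite ewedgeZr dwedgeC dz_iz_Psi (negPf ji) scale0r ewedge0r oppr0 scaler0.
rewrite exchange_big; apply: eq_bigr => l _.
by rewrite -scaler_suml mulr_sumr.
Qed.

(** The two terms of [om_iz2Psi] agree after exchanging j and l because [A] is skew; together they
    carry 2 * i/2 = i, which the factor ['i^-1] removes. *)
Lemma XiT_om (A : 'I_n -> 'I_n -> C) : (forall j l, A j l = - A l j) ->
  \sum_j \sum_l A j l *: (db l ∧ iz j Psi) =
  omJ ∧ ('i^-1 *: \sum_j \sum_l A j l *: iz l (iz j Psi)).
Proof.
move=> Ask; rewrite ewedgeZr ewedge_sumr.
under [in RHS]eq_bigr => j _.
  rewrite ewedge_sumr.
  under eq_bigr => l _ do rewrite ewedgeZr om_iz2Psi scalerA scalerBr.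
  rewrite sumrB; over.
rewrite /= sumrB.
have -> : \sum_j \sum_l (A j l * ('i / 2)) *: (db j ∧ iz l Psi) =
  - \sum_j \sum_l (A j l * ('i / 2)) *: (db l ∧ iz j Psi).
  rewrite exchange_big -sumrN; apply: eq_bigr => j _; rewrite -sumrN; apply: eq_bigr => l _.
  by rewrite Ask mulNr scaleNr.
rewrite opprK -mulr2n -scaler_nat scalerA scaler_sumr; apply: eq_bigr => j _.
rewrite scaler_sumr; apply: eq_bigr => l _; rewrite scalerA; congr (_ *: _).
by rewrite mulrCA mulrA mulrCA mulrA; field; rewrite neq0Ci.
Qed.

(* Recovers a tensor skew in its last two arguments from its alternation in the
   first two, as in the Koszul formula for a connection without torsion. *)
Definition koszul (c : 'I_n -> 'I_n -> 'I_n -> C) m j l : C :=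
  let D m l j := c m l j - c l m j in
  'i * (D m l j - D m j l + D j l m).

Lemma koszul_skew c m j l : koszul c m j l = - koszul c m l j.
Proof. rewrite /koszul /=; ring. Qed.

(** Both sides have the same part skew in m and l. Thus each Q c is the alternation of an array with
    the symmetry required of T^* (x) u(n)^perp. *)
Lemma Qf_koszul c : Qf (fun m l j => (2 * 'i)^-1 * koszul c m j l) = Qf c :> tensor C J.
Proof.
suff : Qf (fun m l j => (2 * 'i)^-1 * koszul c m j l) *+ 2 = Qf c *+ 2 :> tensor C J.
  move/eqP; rewrite -subr_eq0 -mulrnBl -scaler_nat scaler_eq0 pnatr_eq0 /= subr_eq0.
  by move/eqP.
rewrite -!Qf_skew; apply: eq_Qf => m l j; rewrite /koszul.
by field; rewrite neq0Ci.
Qed.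

End Expansions.

(** * Contractions of a top form and the Hodge star in components *)

Section IteratedSums.
Variables (I : finType) (M : nmodType).

(** A sum over lists of length k unfolded one entry at a time, so that the k frame sums in the Hodge
    star can be treated by induction. *)
Fixpoint itsum k (G : seq I -> M) : M :=
  if k is k'.+1 then \sum_x itsum k' (fun l => G (x :: l)) else G [::].

Lemma eq_itsum k G H : (forall l, size l = k -> G l = H l) -> itsum k G = itsum k H.
Proof.
elim: k G H => [|k IH] G H e; first exact: e.
by apply: eq_bigr => x _; apply: IH => l lk; apply: e; rewrite /= lk.
Qed.

Lemma itsum_tuple k G : itsum k G = \sum_(y : k.-tuple I) G y.
Proof.
elim: k G => [|k IH] G.
  rewrite (big_pred1 [tuple]) => // m; rewrite /= [m]tuple0.
  by apply/esym/eqP/val_inj.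
rewrite (reindex (fun bt : I * k.-tuple I => [tuple of bt.1 :: bt.2])) /=.
  by rewrite -(pair_bigA _ (fun x (t : k.-tuple I) => G (x :: t))) /=; apply: eq_bigr => x _; rewrite IH.
exists (fun m => (thead m, [tuple of behead m])) => [[b t] _|m _] /=.
  by congr pair; apply/val_inj.
by case/tupleP: m => b t; apply/val_inj.
Qed.

End IteratedSums.

Definition conl (K V : Type) (y : seq V) (nu : seq V -> K) : seq V -> K := fun s => nu (y ++ s).

Section Contractions.
Variables (K : numFieldType) (J : finType).
Implicit Types (f nu : tensor K J) (x : J) (s y : seq J).

Lemma conl_rcons y x nu : conl (rcons y x) nu = contract x (conl y nu).
Proof. by apply/funext => s; rewrite /conl /contract cat_rcons. Qed.

Lemma conl_skew y nu : skew nu -> skew (conl y nu).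
Proof. by move=> snu s1 a b s2; rewrite /conl !catA snu. Qed.

Lemma conl_hom p y nu : hom (size y + p)%N nu -> hom p (conl y nu).
Proof. by move=> h s hs; apply: h; rewrite size_cat eqn_add2l. Qed.

(** Induction on the last entry x of the list: without x the product has degree above the top and
    vanishes, and contracting this zero by x gives the claim. The sign for bringing x to the front
    of [f] cancels the sign of the Leibniz rule. *)
Lemma wedge_conl k f nu y : skew f -> hom k f -> skew nu -> hom #|J| nu -> size y = k ->
  f ∧ conl y nu = f y *: nu.
Proof.
move=> + + snu hnu; elim/last_ind: y k f => [|y x IH] k f skf hf yk.
  have f0 : f = f [::] *: tensor_one.
    apply/funext => -[|z s]; rewrite scaleTE /tensor_one ?mulr1 // mulr0.
    by rewrite -yk in hf; exact: hf.
  by rewrite {1}f0 ewedgeZl ewedge1l.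
rewrite size_rcons in yk; case: k yk hf => // k [yk] hf.
have [Jk|Jk] := ltnP #|J| k.+1.
  by rewrite (skew_overflow skf hf Jk) ewedge0l scale0r.
have hc : hom (#|J| - k)%N (conl y nu) by apply: conl_hom; rewrite yk subnKC // ltnW.
have z0 : f ∧ conl y nu = 0.
  apply: (skew_overflow _ (ewedge_hom hf hc)); first exact: skew_ewedge (conl_skew _ _).
  by rewrite addSn subnKC // ltnW.
have := contract_ewedge x f (conl y nu).
rewrite z0 contract0 (sg_hom hf) ewedgeZl -conl_rcons.
rewrite (IH k) //; [|exact: skew_contract|exact: hom_contract].
move/esym/eqP; rewrite addrC addr_eq0 => /eqP E.
have sq : (-1) ^+ k.+1 * (-1) ^+ k.+1 = 1 :> K by rewrite -expr2 sqrr_sign.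
rewrite -[LHS]scale1r -sq -scalerA E scalerN -scaleNr scalerA; congr (_ *: _).
by rewrite -cats1 skew_move // cats0 yk exprS !mulN1r opprK.
Qed.

(** Contracting each product again and summing over the indices gives (#|J| - p) f by Euler's
    identity. *)
Lemma dwedge_inj p f : skew f -> hom p f -> (p < #|J|)%N ->
  (forall x, dcoord K x ∧ f = 0) -> f = 0.
Proof.
move=> sf hf pJ d0; have : \sum_x contract x (dcoord K x ∧ f) = 0.
  by apply: big1 => x _; rewrite d0.
under eq_bigr => x _ do rewrite contract_dwedge eqxx scale1r.
rewrite sumrB sumr_const -[f *+ _]scaler_nat.
have -> : \sum_x dcoord K x ∧ contract x f = p%:R *: f.
  apply/funext => s; rewrite (@euler _ _ predT) // count_predT scaleTE.
  by have [->//|/hf ->] := eqVneq (size s) p; rewrite !mulr0.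
rewrite -scalerBl -natrB ?(ltnW pJ) // => /eqP.
by rewrite scaler_eq0 pnatr_eq0 subn_eq0 leqNgt pJ => /eqP.
Qed.

Lemma dwedge_notin x f s : x \notin s -> (dcoord K x ∧ f) s = 0.
Proof.
elim: s f => [|y s IH] f; first by rewrite ewedge_nil mul0r.
rewrite inE negb_or => /andP[xy xs].
rewrite -[LHS]/(contract y _ s) contract_dwedge eq_sym (negPf xy) scale0r sub0r oppTE.
by rewrite IH // oppr0.
Qed.

End Contractions.

Section StarPairing.
Variables (C : numClosedFieldType) (n : nat).
Local Notation J := (bool * 'I_n)%type.
Implicit Types (f g nu : tensor C J) (x : J) (s y : seq J) (i j l m : 'I_n) (k : nat).
Local Notation dz i := (dcoord C (true, i)).
Local Notation db i := (dcoord C (false, i)).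
Local Notation Psi := (@Psi C n).
Local Notation omJ := (@omJ C n).

(* The pairing of z_i with its conjugate turns the sum over an orthonormal frame in
   the Hodge star into a sum over an index and its conjugate. *)
Definition starJ k f nu : tensor C J :=
  \sum_(y : k.-tuple J) f y *: conl (map (@barJ n) y) nu.

Definition pairJ k f g : C := \sum_(y : k.-tuple J) g y * f (map (@barJ n) y).

Lemma cardJ : #|[the finType of J]| = n.*2.
Proof. by rewrite card_prod card_bool card_ord mul2n. Qed.

(** The defining property of the star, with an arbitrary top form in place of Vol and an
    unnormalized bilinear pairing. *)
Lemma wedge_starJ k f g nu : skew f -> hom k f -> skew nu -> hom n.*2 nu ->
  f ∧ starJ k g nu = pairJ k f g *: nu.
Proof.
move=> sf hf snu hnu; rewrite ewedge_sumr scaler_suml; apply: eq_bigr => y _.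
rewrite ewedgeZr (wedge_conl sf hf) ?cardJ ?scalerA //.
by rewrite size_map size_tuple.
Qed.

(** psi_+ and psi_- are the cases a = 1/2 and a = 1/(2i); keeping [a] free treats both signs at
    once. *)
Definition psiJ (a : C) : tensor C J := a *: Psi + a^* *: cj Psi.

Lemma db_psiJ a m : db m ∧ psiJ a = a *: (db m ∧ Psi).
Proof.
rewrite ewedgeDr !ewedgeZr (_ : db m ∧ cj Psi = 0) ?scaler0 ?addr0 //.
by rewrite -[db m](cj_dcoord C (true, m)) -cj_ewedge dwedge_Psi cj0.
Qed.

Lemma dz_psiJ a m : dz m ∧ psiJ a = a^* *: (dz m ∧ cj Psi).
Proof. by rewrite ewedgeDr !ewedgeZr dwedge_Psi scaler0 add0r. Qed.

Lemma skew_psiJ a : skew (psiJ a).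
Proof. by apply: skewD; apply: skewZ; [|apply: cj_skew]; exact: skew_Psi. Qed.

Lemma hom_psiJ a : hom n (psiJ a).
Proof. by case: (@ty_Psi C n) => h _ _; apply: homD; apply: homZ => //; exact: cj_hom. Qed.

(** If the last factor is nonzero, [y] has n or 1 barred entries, whereas [g] and its conjugate need
    2 or n - 1. *)
Lemma ty_bar_eq0 d f g (y : n.+1.-tuple J) : (d == 1%N) || (d == n) -> (3 < n)%N ->
  ty n.+1 d f -> ty n.+1 2 g -> (g y + cj g y) * f (map (@barJ n) y) = 0.
Proof.
move=> dn n3 [_ _ tf] [_ _ tg].
have [hd|/tf ->] := eqVneq (nfalse (map (@barJ n) y)) d; last by rewrite mulr0.
have := nfalse_bar y; rewrite size_tuple hd => hy.
have -> : g y = 0.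
  apply: tg; apply/eqP => y2; move: hy dn n3; rewrite y2 addn2 => -[/eqP d1].
  by case/orP => /eqP d2; move: d1; rewrite d2 => /eqP; [move=> <-|move/eqP; rewrite eqn_leq ltnn].
rewrite /cj tg ?rmorph0 ?addr0 ?mul0r // hd; case/orP: dn => /eqP -> //.
by rewrite gtn_eqF // (leq_trans _ n3).
Qed.

(** Wedging with all one-forms turns the left side into orthogonality of b to T^* /\ psi. The Q part
    and its conjugate are orthogonal to it by type, and P u lies in it up to its conjugate, so
    pairing b with P u gives a norm of P u. *)
Lemma star_psi_eq0 (a : C) (c : 'I_n -> 'I_n -> 'I_n -> C) (u : 'I_n -> C) nu : a != 0 -> (3 < n)%N -> skew nu -> hom n.*2 nu -> nu != 0 ->
  let b := Qf c + Pf u + cj (Qf c + Pf u) in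
  (starJ n.+1 b nu ∧ psiJ a = 0) <-> Pf u = 0 :> tensor C J.
Proof.
move=> a0 n3 snu hnu nu0 b.
have pn : n.-1.+1 = n by rewrite prednK // (leq_trans _ n3).
have n1 : (n.+1 <= n.*2)%N by rewrite -addnn -addn1 leq_add2l (leq_trans _ n3).
pose q := (n.*2 - n.+1)%N.
have hs : hom q (starJ n.+1 b nu).
  apply: hom_sum => y _; apply: homZ; apply: conl_hom.
  by rewrite size_map size_tuple subnKC.
have ss : skew (starJ n.+1 b nu).
  by apply: skew_sum => y _; apply: skewZ; exact: conl_skew.
have eqv : (starJ n.+1 b nu ∧ psiJ a = 0) <-> psiJ a ∧ starJ n.+1 b nu = 0.
  rewrite (ewedgeC hs (hom_psiJ a)); split=> [/eqP|->]; last by rewrite scaler0.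
  by rewrite scaler_eq0 signr_eq0 => /eqP.
have dE x : dcoord C x ∧ (psiJ a ∧ starJ n.+1 b nu) = pairJ n.+1 (dcoord C x ∧ psiJ a) b *: nu.
  rewrite ewedgeA wedge_starJ //.
    by apply: skew_ewedge; [exact: dcoord_skew|exact: skew_psiJ].
  by apply: (ewedge_hom (@dcoord_hom _ _ x)); exact: hom_psiJ.
have dEf x : psiJ a ∧ starJ n.+1 b nu = 0 -> pairJ n.+1 (dcoord C x ∧ psiJ a) b = 0.
  by move=> e; move/esym/eqP: (dE x); rewrite e ewedge0r scaler_eq0 (negPf nu0) orbF => /eqP.
have tdz m : ty n.+1 1 (db m ∧ Psi) by exact: (ty_ewedge (ty_db C m) (@ty_Psi C n)).
rewrite eqv; split=> [e|u0].
  (* The weights u_m / a assemble P u from the forms dzb_m /\ psi, on which psi acts as a Psi. *)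
  have E : \sum_(y : n.+1.-tuple J) b y * Pf u (map (@barJ n) y) = 0.
    have : \sum_m (u m / a) * pairJ n.+1 (db m ∧ psiJ a) b = 0.
      by apply: big1 => m _; rewrite dEf ?mulr0.
    rewrite /pairJ; under eq_bigr do rewrite mulr_sumr.
    rewrite exchange_big => E; rewrite -[RHS]E; apply: eq_bigr => y _; rewrite /Pf fct_sumE mulr_sumr.
    apply: eq_bigr => m _; rewrite db_psiJ !scaleTE; field; exact: a0.
  (* Only the conjugate of P u in b has the type dual to P u, and its value at [y] is the conjugate
     of P u at the conjugated list. *)
  have E2 (y : n.+1.-tuple J) : b y * Pf u (map (@barJ n) y) = `|Pf u (map (@barJ n) y)| ^+ 2.
    rewrite normCK /b cjD [X in X _ * _]addrACA addTE mulrDl.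
    rewrite !addTE (@ty_bar_eq0 1 _ _ y isT n3 (ty_Pf u) (ty_Qf c pn)) add0r.
    have [_ _ tP] := ty_Pf (C := C) u.
    have [h1|/tP ->] := eqVneq (nfalse (map (@barJ n) y)) 1%N; last by rewrite !mulr0 mul0r.
    rewrite (tP y) ?add0r; first by rewrite mulrC.
    have := nfalse_bar y; rewrite h1 size_tuple add1n => -[->].
    by rewrite gtn_eqF // (leq_trans _ n3).
  move: E; under eq_bigr do rewrite E2.
  move/eqP; rewrite psumr_eq0 => [/allP E|y _]; last exact: exprn_ge0.
  have [hP _ _] := ty_Pf (C := C) u.
  apply/funext => s; have [ss1|/hP//] := eqVneq (size s) n.+1.
  have sb : size (map (@barJ n) s) == n.+1 by rewrite size_map ss1.
  have := E (Tuple sb) (mem_index_enum _).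
  by rewrite /= -map_comp (eq_map (@barJK n)) map_id sqrf_eq0 normr_eq0 => /eqP.
(* n + q = 2n - 1 is below the top degree, so wedging with one-forms detects the product. *)
apply: (@dwedge_inj _ _ (n + q)).
- exact: skew_ewedge (skew_psiJ a) ss.
- exact: ewedge_hom (hom_psiJ a) hs.
- by rewrite cardJ /q; lia.
move=> x; rewrite dE (_ : pairJ _ _ _ = 0) ?scale0r //.
apply: big1 => y _; rewrite /b u0 addr0 addTE; case: x => -[] m.
  rewrite dz_psiJ scaleTE mulrCA (@ty_bar_eq0 n _ _ y _ n3 _ (ty_Qf c pn)) ?mulr0 ?eqxx ?orbT //.
  by rewrite -[dz m](cj_dcoord C (false, m)) -cj_ewedge; apply: ty_cj (tdz m); rewrite add1n.
by rewrite db_psiJ scaleTE mulrCA (@ty_bar_eq0 1 _ _ y isT n3 (tdz m) (ty_Qf c pn)) mulr0.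
Qed.

Definition omk k : tensor C J := iter k (@ewedge C J omJ) tensor_one.

Lemma omk_hom k : hom k.*2 (omk k) /\ skew (omk k).
Proof.
elim: k => [|k [h s]].
  by split=> [[]//|[|u s1] x y s2]; rewrite /tensor_one /= oppr0.
case: (ty_omJ C n) => h2 s2 _; split; last exact: skew_ewedge.
exact: (ewedge_hom h2 h).
Qed.

Lemma iz_omk j k : iz j (omk k.+1) = (k.+1%:R * (- ('i / 2))) *: (db j ∧ omk k).
Proof.
elim: k => [|k IH].
  by rewrite [omk 1]/= iz_om_wedge [iz j tensor_one](_ : _ = 0) // ewedge0r addr0 mul1r.
rewrite [omk k.+2]/= iz_om_wedge -/(omk k.+1) IH ewedgeZr (om_pull _ (@dcoord_hom _ _ _)).
by rewrite -[omJ ∧ _]/(omk k.+1) -scalerDl; congr (_ *: _); rewrite [in RHS]mulrS mulrDl mul1r.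
Qed.

(** The value at z_1, zb_1, z_2, zb_2, ... is nonzero: by [iz_omk] each pair removes one power of om
    at the cost of a nonzero factor. *)
Lemma omk_neq0 : omk n != 0.
Proof.
pose zz (r : seq 'I_n) : seq J := flatten [seq [:: (true, j); (false, j)] | j <- r].
have zzP j r : ((false, j) \in zz r) = (j \in r).
  elim: r => // i r IH; rewrite [zz _]/= !inE IH xpair_eqE /=.
  by rewrite xpair_eqE eqxx.
have H r : uniq r -> omk (size r) (zz r) != 0.
  elim: r => [|j r IH] /=; first by rewrite /tensor_one oner_neq0.
  case/andP=> jr ur.
  rewrite -[(_ ∧ _) _]/(iz j (omk (size r).+1) ((false, j) :: zz r)) iz_omk scaleTE.
  rewrite mulf_neq0 //.
    by rewrite mulf_neq0 ?pnatr_eq0 // oppr_eq0 mulf_neq0 ?neq0Ci // invr_eq0 pnatr_eq0.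
  rewrite -[(_ ∧ _) _]/(ib j _ (zz r)) ib_db eqxx scale1r addTE oppTE dwedge_notin ?zzP //.
  by rewrite subr0 IH.
apply/eqP => om0; have := H (enum 'I_n) (enum_uniq _).
by rewrite size_enum_ord om0 eqxx.
Qed.

End StarPairing.

(** * Real tensors and their complex components *)

Section RealParts.
Variables (R : realType) (V : Type).
Implicit Types (a b : tensor R V) (F G : tensor R[i] V) (X : V) (s : seq V).

Definition rc b : tensor R[i] V := fun s => ((b s)%:C)%C.
Definition rep F : tensor R V := fun s => complex.Re (F s).

Lemma ReD (x y : R[i]) : complex.Re (x + y) = complex.Re x + complex.Re y.
Proof. by case: x y => [? ?] [? ?]. Qed.

Lemma ReN (x : R[i]) : complex.Re (- x) = - complex.Re x.
Proof. by case: x. Qed.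

Lemma Re_real (x : R) : complex.Re (x%:C)%C = x.
Proof. by []. Qed.

Lemma ReZ (c : R) (x : R[i]) : complex.Re ((c%:C)%C * x) = c * complex.Re x.
Proof. by case: x => a b /=; rewrite mul0r subr0. Qed.

Lemma Re_sum (I : Type) (r : seq I) (P : pred I) (F : I -> R[i]) :
  complex.Re (\sum_(j <- r | P j) F j) = \sum_(j <- r | P j) complex.Re (F j).
Proof. by elim/big_rec2: _ => [|j a b _ <-] //; rewrite ReD. Qed.

Lemma Re_conj (x : R[i]) : ((complex.Re x)%:C)%C = 2^-1 * (x + x^*) :> R[i].
Proof. by rewrite ReJ_add mulrC. Qed.

Lemma complex_iE (u v : R) : (u +i* v)%C = (u%:C)%C + 'i * (v%:C)%C.
Proof. by rewrite [LHS]complexE /= complexiE. Qed.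

Lemma real_complex_sign (k : nat) : (((-1) ^+ k : R)%:C)%C = (-1) ^+ k :> R[i].
Proof. by rewrite rmorphXn rmorphN1. Qed.

Lemma rep_rc b : rep (rc b) = b. Proof. by []. Qed.

Lemma rc_inj a b : rc a = rc b -> a = b.
Proof. by move=> e; rewrite -(rep_rc a) e. Qed.

Lemma repD F G : rep (F + G) = rep F + rep G.
Proof. by apply/funext => s; rewrite /rep !addTE ReD. Qed.

Lemma repN F : rep (- F) = - rep F.
Proof. by apply/funext => s; rewrite /rep !oppTE ReN. Qed.

Lemma repZ (c : R) F : rep ((c%:C)%C *: F) = c *: rep F.
Proof. by apply/funext => s; rewrite /rep !scaleTE ReZ. Qed.

Lemma rep_sum (I : Type) (r : seq I) (P : pred I) (F : I -> tensor R[i] V) :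
  rep (\sum_(j <- r | P j) F j) = \sum_(j <- r | P j) rep (F j).
Proof. by elim/big_rec2: _ => [|j a b _ <-] //; rewrite repD. Qed.

Lemma contract_rep X F : contract X (rep F) = rep (contract X F). Proof. by []. Qed.
Lemma rep_wedge_rc F b : rep (F ∧ rc b) = rep F ∧ b.
Proof.
apply/funext => s; rewrite /rep !ewedgeE Re_sum; apply: eq_bigr => m _.
by rewrite /rc mulrAC -real_complex_sign -rmorphM ReZ mulrAC.
Qed.

Lemma rep_alt F : rep (alt F) = alt (rep F).
Proof.
apply/funext => s; rewrite /rep /alt Re_sum; apply: eq_bigr => m _.
by rewrite -real_complex_sign ReZ.
Qed.

Lemma rc_one : rc tensor_one = tensor_one.
Proof. by apply/funext => s; rewrite /rc /tensor_one rmorph_nat. Qed.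

End RealParts.

Section SkewAlternating.
Variables (R : realType) (V : lmodType R).
Implicit Types (b : tensor R V) (X Y : V) (s : seq V).

Lemma skew_alternating b : skew b -> alternating b.
Proof.
move=> sb s1 s2 s3 X; have : skew (conl s1 b) by move=> t1 x y t2; rewrite /conl !catA sb.
rewrite -/(conl s1 b _); elim: s2 (conl s1 b) => [|Y s2 IH] f sf.
  by have := congr1 (fun g => g s3) (skew_contract2 X sf).
rewrite cat_cons -[f _]opprK -(sf [::]) /=.
by rewrite -[f _]/(contract Y f _) IH ?oppr0 //; exact: skew_contract.
Qed.

Lemma alternating_skew b : multilinear b -> alternating b -> skew b.
Proof.
move=> mb ab s1 X Y s2; apply/eqP; rewrite -addr_eq0; apply/eqP.
have := ab s1 [::] s2 (1 *: X + Y); rewrite /= mb mul1r.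
have e Z : b (s1 ++ Z :: (1 *: X + Y) :: s2) = b (s1 ++ Z :: X :: s2) + b (s1 ++ Z :: Y :: s2).
  by have := mb (s1 ++ [:: Z]) s2 1 X Y; rewrite -!catA mul1r.
rewrite !e.
have a0 Z : b (s1 ++ Z :: Z :: s2) = 0 by exact: (ab s1 [::]).
by rewrite !a0 add0r addr0.
Qed.

Lemma multilinear_contract b X : multilinear b -> multilinear (contract X b).
Proof. by move=> mb s1; exact: (mb (X :: s1)). Qed.

Lemma multilinear_sum b (I : Type) (r : seq I) (P : pred I) (c : I -> R) (F : I -> V) s1 s2 :
  multilinear b ->
  b (s1 ++ (\sum_(j <- r | P j) c j *: F j) :: s2) =
  \sum_(j <- r | P j) c j * b (s1 ++ F j :: s2).
Proof.
move=> mb; have b0 : b (s1 ++ 0 :: s2) = 0.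
  by rewrite -(addNr 0) -scaleN1r mb mulN1r addNr.
by elim/big_rec2: _ => [|j x y _ <-] //; rewrite mb.
Qed.

End SkewAlternating.

Section RealFibre.
Variables (R : realType) (V : lmodType R) (D : su_data V) (n : nat).
Local Notation C := (R[i]).
Local Notation J := (bool * 'I_n)%type.
Local Notation I := (acs D).
Local Notation g := (met D).

(* E (true, i) is e_i and E (false, i) is I e_i. *)
Record sframe (E : J -> V) := SFrame {
  gL : forall c X Y Z, g (c *: X + Y) Z = c * g X Z + g Y Z;
  gC : forall X Y, g X Y = g Y X;
  IL : forall c X Y, I (c *: X + Y) = c *: I X + I Y;
  IK : forall X, I (I X) = - X;
  gI : forall X Y, g (I X) (I Y) = g X Y;
  gE : forall x y, g (E x) (E y) = (x == y)%:R;
  EI : forall i, E (false, i) = I (E (true, i));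
  EX : forall X, X = \sum_x g (E x) X *: E x;
  Epsi : forall s, (psi_plus D s +i* psi_minus D s)%C =
                (\big[@ewedge R[i] V/tensor_one]_(i < n) theta D (E (true, i))) s }.

Variables (E : J -> V) (HE : sframe E).

Lemma gLr c X Y Z : g Z (c *: X + Y) = c * g Z X + g Z Y.
Proof. by rewrite (gC HE) (gL HE) !(gC HE Z). Qed.

Lemma gIr X Y : g X (I Y) = - g (I X) Y.
Proof.
rewrite -(gI HE) (IK HE).
have -> : - Y = (-1) *: Y + 0 by rewrite scaleN1r addr0.
have g0 Z : g Z 0 = 0.
  by rewrite -(addNr 0) -scaleN1r gLr mulN1r addNr.
by rewrite gLr g0 addr0 mulN1r.
Qed.

Definition Th X (x : J) : C :=
  if x.1 then (g (E (true, x.2)) X +i* g (E (false, x.2)) X)%C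
  else (g (E (true, x.2)) X -i* g (E (false, x.2)) X)%C.

Lemma Th_bar X x : Th X (barJ x) = (Th X x)^*.
Proof. by case: x => -[] i; rewrite /Th /=; congr (_ +i* _)%C; rewrite ?opprK. Qed.

Lemma ThL c X Y x : Th (c *: X + Y) x = (c%:C)%C * Th X x + Th Y x.
Proof.
by case: x => -[] i; rewrite /Th /= !gLr; congr (_ +i* _)%C; rewrite !(mul0r, mulr0, addr0, subr0, add0r) //= ?opprD ?mulrN.
Qed.

Lemma ThI X x : Th (I X) x = (if x.1 then 'i else - 'i) * Th X x.
Proof.
have e i : g (E (false, i)) (I X) = g (E (true, i)) X by rewrite (EI HE) (gI HE).
have e2 i : g (E (true, i)) (I X) = - g (E (false, i)) X by rewrite gIr (EI HE).
case: x => -[] i; rewrite /Th /= e e2 -complexiE; simpc; congr (_ +i* _)%C; ring.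
Qed.

Local Notation dec := (lin_subst Th).
(** The real part of the complex tensor with components [f] in the coframe dz_i and its conjugate.
    Many [f] give the same tensor; for instance [f] and [cj f] do. *)
Definition rho (f : tensor C J) : tensor R V := rep (dec f).

Lemma conj_dec f s : (dec f s)^* = dec (cj f) s.
Proof.
elim: s f => [|X s IH] f //; rewrite !dec_cons rmorph_sum (reindex_inj (inv_inj (@barJK n))).
apply: eq_bigr => x _; rewrite rmorphM /= IH -Th_bar barJK; congr (_ * _).
Qed.

Lemma rc_rho f : rc (rho f) = dec (2^-1 *: (f + cj f)).
Proof.
apply/funext => s; rewrite /rc /rho /rep Re_conj decZ decD scaleTE addTE.
by rewrite conj_dec.
Qed.

Lemma rc_rho_real f : cj f = f -> rc (rho f) = dec f.
Proof.
by move=> fr; rewrite rc_rho fr -mulr2n -[f *+ 2]scaler_nat scalerA mulVf ?scale1r //.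
Qed.

Lemma rhoD f h : rho (f + h) = rho f + rho h.
Proof. by rewrite /rho decD repD. Qed.
Lemma rhoN f : rho (- f) = - rho f.
Proof. by rewrite /rho decN repN. Qed.
Lemma rhoB f h : rho (f - h) = rho f - rho h.
Proof. by rewrite rhoD rhoN. Qed.
Lemma rhoZ (c : R) f : rho ((c%:C)%C *: f) = c *: rho f.
Proof. by rewrite /rho decZ repZ. Qed.
Lemma rho0 : rho 0 = 0.
Proof. by rewrite /rho dec0. Qed.
Lemma rho_sum (K : Type) (r : seq K) (P : pred K) (F : K -> tensor C J) :
  rho (\sum_(j <- r | P j) F j) = \sum_(j <- r | P j) rho (F j).
Proof. by rewrite /rho dec_sum rep_sum. Qed.

Lemma rho_cj f : rho (cj f) = rho f.
Proof. by apply: rc_inj; rewrite !rc_rho cjK addrC. Qed.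

Lemma rho_real f : rho f = rho (2^-1 *: (f + cj f)).
Proof.
by apply: rc_inj; rewrite rc_rho rc_rho_real // cjZ cjD cjK addrC fmorphV rmorph_nat.
Qed.

Lemma rho_wedge f h : cj h = h -> rho f ∧ rho h = rho (f ∧ h).
Proof. by move=> hr; rewrite -rep_wedge_rc rc_rho_real // -dec_ewedge. Qed.

Lemma alt_rho f : alt (rho f) = rho (alt f).
Proof. by rewrite -rep_alt -dec_alt. Qed.

Lemma contract_rho X f : contract X (rho f) = rho (\sum_x Th X x *: contract x f).
Proof. by rewrite contract_rep contract_dec. Qed.

Lemma rho_nil f : rho f [::] = complex.Re (f [::]). Proof. by []. Qed.

Lemma dec_map (W : Type) (h : W -> V) f s : dec f (map h s) = lin_subst (fun X => Th (h X)) f s.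
Proof. by elim: s f => [|X s IH] f //; rewrite map_cons !dec_cons; apply: eq_bigr => x _; rewrite IH. Qed.

(** Row [x] lists the coefficients of the vector dual to the coframe, (e_i - i Ie_i)/2 or its
    conjugate, in the frame [E]. *)
Definition Nm (x y : J) : C :=
  if x.2 == y.2 then
    (if y.1 then 2^-1 else if x.1 then - ('i / 2) else 'i / 2) else 0.

Lemma Nm_Th x z : \sum_y Nm x y * Th (E y) z = (x == z)%:R.
Proof.
rewrite sumJ /Nm; case: x z => b i [b' j] /=.
rewrite (bigD1 i) //= eqxx big1 ?addr0 => [|k ki]; last by rewrite eq_sym (negPf ki) mul0r.
rewrite (bigD1 i) //= eqxx big1 ?addr0 => [|k ki]; last by rewrite eq_sym (negPf ki) mul0r.
rewrite /Th /= !(gE HE) !xpair_eqE /= (eq_sym j).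
have h2 : 2^-1 + 2^-1 = 1 :> C by field.
set d : C := (i == j)%:R.
have ed : (((i == j)%:R : R)%:C)%C = d by rewrite /d rmorph_nat.
have q : 'i / 2 * ('i * d) = - (2^-1 * d) by rewrite mulrACA -expr2 sqrCi mulN1r.
have s1 : (((i == j)%:R : R) +i* 0)%C = d by rewrite complex_iE rmorph0 mulr0 addr0.
have s2 : (((i == j)%:R : R) -i* 0)%C = d by rewrite oppr0 s1.
have s3 : (0 +i* ((i == j)%:R : R))%C = 'i * d by rewrite complex_iE rmorph0 add0r ed.
have s4 : (0 -i* ((i == j)%:R : R))%C = - ('i * d) by rewrite complex_iE rmorph0 add0r -ed -mulrN -rmorphN.
rewrite s1 s2 s3 s4; case: b b' => -[] /=.
- by rewrite mulNr q opprK -mulrDl h2 mul1r.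
- by rewrite mulrNN q subrr.
- by rewrite q subrr.
- by rewrite mulrN q opprK -mulrDl h2 mul1r.
Qed.

End RealFibre.

Lemma conj_i2 (C : numClosedFieldType) : ('i / 2 : C)^* = - ('i / 2).
Proof. by rewrite rmorphM /= fmorphV rmorph_nat conjCi mulNr. Qed.

Lemma conj_2i (C : numClosedFieldType) : ((2 * 'i)^-1 : C)^* = - (2 * 'i)^-1.
Proof. by rewrite fmorphV rmorphM /= rmorph_nat conjCi mulrN invrN. Qed.

Lemma conj_iM (C : numClosedFieldType) (u v : C) :
  (u^* * ('i * v))^* = - ('i * (u * v^*)).
Proof. by rewrite !rmorphM /= conjCK conjCi; ring. Qed.

Section Spans.
Variables (R : nzRingType) (W : lmodType R).
Implicit Types A S : set W.

Lemma lin_span_sub S A : is_subspace A -> S `<=` A -> lin_span S `<=` A.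
Proof.
case=> A0 AD SA w [k [c [v [vS ->]]]]; elim/big_rec: _ => // i x _ Ax.
by apply: AD => //; exact: SA.
Qed.

Lemma lin_span_subspace S : is_subspace (lin_span S).
Proof.
split; first by exists 0%N, (fun _ => 0), (fun _ => 0); split=> [[]//|]; rewrite big_ord0.
move=> c u v [k [a [x [xS ->]]]] [k' [a' [x' [x'S ->]]]].
exists (k + k')%N, (fun i => match fintype.split i with inl i => c * a i | inr i => a' i end).
exists (fun i => match fintype.split i with inl i => x i | inr i => x' i end); split.
  by move=> i; case: fintype.splitP => j _.
rewrite big_split_ord scaler_sumr /=; congr (_ + _); apply: eq_bigr => i _.
  by rewrite (unsplitK (inl i)) scalerA.
by rewrite (unsplitK (inr i)).
Qed.

Lemma sub_lin_span S : S `<=` lin_span S.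
Proof.
move=> w Sw; exists 1%N, (fun _ => 1), (fun _ => w).
by split=> //; rewrite big_ord1 scale1r.
Qed.

Lemma subspace_sum A (I : Type) (r : seq I) (P : pred I) (F : I -> W) :
  is_subspace A -> (forall i, P i -> A (F i)) -> A (\sum_(i <- r | P i) F i).
Proof.
case=> A0 AD AF; elim/big_rec: _ => // i x Pi Ax.
by rewrite -[F i]scale1r; apply: AD => //; exact: AF.
Qed.

Lemma subspaceD A u v : is_subspace A -> A u -> A v -> A (u + v).
Proof. by case=> _ AD Au Av; rewrite -[u]scale1r; exact: AD. Qed.

End Spans.

(** * Components of real tensors, of the metric, om and psi *)

Section FibreCoordinates.
Variables (R : realType) (V : lmodType R) (D : su_data V) (n : nat).
Local Notation C := (R[i]).
Local Notation J := (bool * 'I_n)%type.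
Local Notation I := (acs D).
Local Notation g := (met D).
Local Notation dz i := (dcoord C (true, i)).
Local Notation db i := (dcoord C (false, i)).
Local Notation Psi := (@Psi C n).
Local Notation omJ := (@omJ C n).
Local Notation psiJ := (@psiJ C n).
Variables (E : J -> V) (HE : sframe D E).
Local Notation Th := (Th D E).
Local Notation dec := (lin_subst Th).
Local Notation rho := (@rho R V D n E).

(** Evaluating on the frame and substituting [Nm] undoes the substitution of [Th]. *)
Lemma dec_inj f : dec f = 0 -> f = 0 :> tensor C J.
Proof.
move=> f0; rewrite -[f]dec_id.
have -> : (fun x y : J => (x == y)%:R) = (fun x z => \sum_y @Nm R n x y * Th (E y) z).
  by apply/funext => x; apply/funext => z; rewrite (Nm_Th HE).
rewrite -dec_comp (_ : lin_subst _ f = 0) ?dec0 //.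
by apply/funext => s; rewrite -dec_map f0.
Qed.

Lemma rho_eq0 f : rho f = 0 -> f + cj f = 0.
Proof.
move=> f0; have : dec (2^-1 *: (f + cj f)) = 0 by rewrite -(rc_rho D E) f0.
by move/dec_inj/eqP; rewrite scaler_eq0 invr_eq0 pnatr_eq0 => /eqP.
Qed.

Lemma rho_real_inj f h : cj f = f -> cj h = h -> rho f = rho h -> f = h.
Proof.
move=> fr hr e; have /rho_eq0 : rho (f - h) = 0 by rewrite rhoB e subrr.
rewrite cjD cjN fr hr -mulr2n => /eqP.
by rewrite -scaler_nat scaler_eq0 pnatr_eq0 subr_eq0 => /eqP.
Qed.

(** The values of [b] on the complex dual vectors, obtained from its values on the real frame; on
    multilinear tensors this is a section of [rho] with real components. *)
Definition comp (b : tensor R V) : tensor C J :=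
  lin_subst (@Nm R n) (fun s => rc b (map E s)).

Lemma Th_Nm X y : \sum_x Th X x * @Nm R n x y = ((g (E y) X)%:C)%C.
Proof.
rewrite sumJ /Nm; case: y => b i /=.
rewrite (bigD1 i) //= eqxx big1 ?addr0 => [|k ki]; last by rewrite (negPf ki) mulr0.
rewrite (bigD1 i) //= eqxx big1 ?addr0 => [|k ki]; last by rewrite (negPf ki) mulr0.
rewrite /Th /= !complex_iE rmorphN /=.
case: b; first by field.
have q (u w : C) : (u + 'i * w) * - ('i / 2) + (u + 'i * - w) * ('i / 2) = - ('i ^+ 2) * w.
  by field.
by rewrite q sqrCi opprK mul1r.
Qed.

Lemma dec_expand b : multilinear b ->
  lin_subst (fun X y => ((g (E y) X)%:C)%C) (fun s => rc b (map E s)) = rc b.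
Proof.
move=> mb; apply/funext => s; elim: s b mb => [|X s IH] b mb //.
rewrite dec_cons [in RHS](EX HE X) /rc (@multilinear_sum _ _ _ _ _ _ _ _ [::] s mb).
rewrite rmorph_sum; apply: eq_bigr => y _ /=; rewrite rmorphM; congr (_ * _).
by rewrite -[RHS](IH (contract (E y) b)) //; exact: multilinear_contract.
Qed.

Lemma rc_comp b : multilinear b -> rc b = dec (comp b).
Proof.
move=> mb; rewrite /comp dec_comp -[LHS](dec_expand mb); congr (lin_subst _ _).
by apply/funext => X; apply/funext => y; rewrite Th_Nm.
Qed.

Lemma rho_comp b : multilinear b -> b = rho (comp b).
Proof. by move=> mb; rewrite /rho -(rc_comp mb) rep_rc. Qed.

Lemma comp_real b : multilinear b -> cj (comp b) = comp b.
Proof.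
move=> mb; apply/eqP; rewrite -subr_eq0; apply/eqP/dec_inj.
rewrite decD decN -(rc_comp mb); apply/eqP; rewrite subr_eq0; apply/eqP/funext => s.
by rewrite -(conj_dec D E) -(rc_comp mb) /rc; exact: conjc_real.
Qed.

Lemma comp_hom p b : homogeneous p b -> hom p (comp b).
Proof.
move=> hb; apply: dec_hom => s hs; rewrite /rc hb ?rmorph0 // size_map.
by [].
Qed.

Lemma comp_skew b : skew b -> skew (comp b).
Proof.
by move=> sb; apply: dec_skew => s1 x y s2; rewrite /rc !map_cat /= sb rmorphN.
Qed.

Lemma rho_multilinear f : multilinear (rho f).
Proof.
move=> s1; elim: s1 f => [|Z s1 IH] f s2 c X Y.
  rewrite /rho /rep !cat0s !dec_cons -[RHS]/(c * complex.Re _ + complex.Re _) -ReZ -ReD.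
  rewrite mulr_sumr -big_split /=; congr complex.Re; apply: eq_bigr => x _.
  by rewrite (ThL HE) mulrDl mulrA.
by rewrite -![rho f _]/(contract Z (rho f) _) !contract_rho; exact: IH.
Qed.

Lemma rho_form p f : hom p f -> skew f -> kforms p (rho f).
Proof.
move=> hf sf; split; [|exact: rho_multilinear|].
  by move=> s hs; rewrite /rho /rep (dec_hom _ hf).
apply: skew_alternating => s1 x y s2.
by rewrite /rho /rep (dec_skew _ sf) ReN.
Qed.

Lemma form_rho p b : kforms p b -> exists f, [/\ hom p f, skew f, cj f = f & b = rho f].
Proof.
case=> hb mb ab; exists (comp b); split; [exact: comp_hom| |exact: comp_real|exact: rho_comp].
exact/comp_skew/alternating_skew.
Qed.

Lemma met_Th X Y : g X Y = complex.Re (\sum_i Th X (false, i) * Th Y (true, i)).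
Proof.
rewrite Re_sum [X in g X _](EX HE X).
have -> Z : g (\sum_x g (E x) X *: E x) Z = \sum_x g (E x) X * g (E x) Z.
  have g0 : g 0 Z = 0.
    by rewrite -(addNr 0) -scaleN1r (gL HE) mulN1r addNr.
  by elim/big_rec2: _ => [|j x y _ <-] //; rewrite (gL HE).
rewrite sumJ -big_split; apply: eq_bigr => i _; rewrite /Th /=.
by rewrite mulNr opprK.
Qed.

Lemma flat_rho X : flat D X = rho (\sum_i Th X (false, i) *: dz i).
Proof.
apply/funext => s; rewrite /rho dec_sum /rep fct_sumE.
under eq_bigr => i _ do rewrite decZ scaleTE dec_dcoord.
case: s => [|Y [|Z s]] /=.
- by rewrite big1 // => i _; rewrite mulr0.
- by rewrite met_Th.
- by rewrite big1 // => i _; rewrite mulr0.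
Qed.

Lemma cj_om : cj omJ = omJ.
Proof.
rewrite /omJ cjZ cj_sum rmorphN /= conj_i2 opprK.
have -> : \sum_(i < n) cj (dz i ∧ db i) = - \sum_(i < n) dz i ∧ db i.
  rewrite -sumrN; apply: eq_bigr => i _; rewrite cj_ewedge !cj_dcoord.
  by rewrite (ewedgeC (@dcoord_hom _ _ _) (@dcoord_hom _ _ _)) expr1 scaleN1r opprK.
by rewrite scalerN scaleNr.
Qed.

Lemma om_rho : kahler D = rho omJ.
Proof.
apply/funext => s; have [s2|s2] := eqVneq (size s) 2%N; last first.
  rewrite /rho /rep (dec_hom _ _ s2); first by case: s s2 => [|X [|Y [|Z s]]].
  by case: (ty_omJ C n).
case: s s2 => [|X [|Y [|Z s]]] //= _.
rewrite met_Th /rho /rep /omJ decZ dec_sum scaleTE fct_sumE.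
have w2 (a b : tensor C V) : a [::] = 0 -> b [::] = 0 -> (forall X Y, a [:: X; Y] = 0) ->
    (forall X Y, b [:: X; Y] = 0) -> (a ∧ b) [:: X; Y] = a [:: X] * b [:: Y] - a [:: Y] * b [:: X].
  move=> a0 b0 a2 b2; rewrite !ewedge_cons !ewedge_nil /contract /sg /= a2 b2 a0 b0.
  by rewrite !(mul0r, mulr0, addr0, add0r, mulN1r, mul1r, expr1, expr0, mulNr).
have tb i Z : Th Z (false, i) = (Th Z (true, i))^* by rewrite -(Th_bar D E).
rewrite !Re_sum mulr_sumr Re_sum; apply: eq_bigr => i _.
have tI : Th (I Y) (true, i) = 'i * Th Y (true, i) by exact: (ThI HE Y (true, i)).
rewrite dec_ewedge w2 ?dec_dcoord // tI !tb.
set u := Th X _; set v := Th Y _.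
rewrite -[LHS]Re_real Re_conj conj_iM; congr complex.Re.
by field.
Qed.

(** From psi_+ = (Psi + conj Psi)/2 and psi_- = (Psi - conj Psi)/(2i); the sign in the second is the
    conjugation of 1/(2i). *)
Definition av (eps : bool) : C := if eps then 2^-1 else (2 * 'i)^-1.

Lemma av_neq0 eps : av eps != 0.
Proof. by case: eps; rewrite /av invr_eq0 ?mulf_neq0 ?neq0Ci ?pnatr_eq0. Qed.

Lemma psiJ_real a : cj (psiJ a) = psiJ a.
Proof. by rewrite /psiJ cjD !cjZ cjK conjCK addrC. Qed.

Lemma dec_Psi s : dec Psi s = (psi_plus D s +i* psi_minus D s)%C.
Proof.
rewrite (Epsi HE) /Psi.
suff -> : dec (\big[@ewedge C J/tensor_one]_(i < n) dz i) =
          \big[@ewedge R[i] V/tensor_one]_(i < n) theta D (E (true, i)) by [].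
elim/big_rec2: _ => [|i x y _ <-]; first exact: dec_one.
rewrite dec_ewedge dec_dcoord; congr (ewedge _ _); apply/funext => -[|X [|Y s']] //=.
by rewrite /theta /= /Th /= (EI HE).
Qed.

Lemma psi_rho eps : psi D eps = rho (psiJ (av eps)).
Proof.
apply: rc_inj; rewrite (rc_rho_real D E (psiJ_real _)); apply/funext => s.
rewrite /psiJ decD !decZ addTE !scaleTE -(conj_dec D E) dec_Psi /rc.
have e' (u v : R) : (u +i* v)%C^* = (u%:C)%C - 'i * (v%:C)%C :> C.
  by rewrite -[LHS]/((u -i* v)%C) complex_iE rmorphN mulrN.
rewrite complex_iE e' /psi; case: eps; rewrite /av.
  by rewrite fmorphV rmorph_nat; field.
rewrite conj_2i; move: ('i : C) (neq0Ci C) => w w0.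
by field; exact: w0.
Qed.

End FibreCoordinates.

Lemma conj_sgi (C : numClosedFieldType) (b : bool) :
  (if b then - 'i else 'i : C)^* = if ~~ b then - 'i else 'i.
Proof. by case: b; rewrite ?rmorphN /= conjCi ?opprK. Qed.

Lemma sgi_neq (C : numClosedFieldType) (a b : bool) (x : C) : a != b ->
  (if a then - 'i else 'i) * ((if b then - 'i else 'i) * x) = x.
Proof.
have e : - ('i * 'i) = 1 :> C by rewrite -expr2 sqrCi opprK.
by case: a b => -[] // _; rewrite mulrA; [rewrite mulNr|rewrite mulrN]; rewrite e mul1r.
Qed.

(** * The action of I on slots, and the spaces [[lambda^(p,0)]] and T^* (x) u(n)^perp *)

Section TensorCoordinates.
Variables (R : realType) (V : lmodType R) (D : su_data V) (n : nat).
Local Notation C := (R[i]).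
Local Notation J := (bool * 'I_n)%type.
Local Notation I := (acs D).
Variables (E : J -> V) (HE : sframe D E).
Local Notation Th := (Th D E).
Local Notation dec := (lin_subst Th).
Local Notation rho := (@rho R V D n E).

Lemma rho_hom p f : hom p f -> hom p (rho f).
Proof. by move=> hf s hs; rewrite /rho /rep (dec_hom _ hf). Qed.

(** [Iact] on components: I is i on dz and -i on its conjugate, and [Iact] carries a minus sign. A
    position beyond the list reads the default [true], hence the bounds on [k] in the lemmas. *)
Definition slot k (f : tensor C J) : tensor C J := fun s =>
  (if nth true (map fst s) k then - 'i else 'i) * f s.

Lemma Iact_cons0 b X s : Iact D 0 b (X :: s) = - b (I X :: s).
Proof.
rewrite /Iact /= /mkseq /= -[1%N]addn0 iotaDl -map_comp; congr (- b (_ :: _)).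
by rewrite -[RHS](mkseq_nth 0); apply: eq_map => k.
Qed.

Lemma Iact_consS k b X s : Iact D k.+1 b (X :: s) = Iact D k (contract X b) s.
Proof.
rewrite /Iact /= /mkseq /= -[1%N]addn0 iotaDl -map_comp; congr (- b (_ :: _)).
Qed.

Lemma slotD k f h : slot k (f + h) = slot k f + slot k h.
Proof. by apply/funext => s; rewrite /slot !addTE mulrDr. Qed.

Lemma slotZ k c f : slot k (c *: f) = c *: slot k f.
Proof. by apply/funext => s; rewrite /slot !scaleTE mulrCA. Qed.

Lemma slot0 k : slot k 0 = 0.
Proof. by have := slotZ k 0 0; rewrite !scale0r. Qed.

Lemma slot_sum k (K : Type) (r : seq K) (P : pred K) (F : K -> tensor C J) :
  slot k (\sum_(j <- r | P j) F j) = \sum_(j <- r | P j) slot k (F j).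
Proof. by elim/big_rec2: _ => [|j a b _ <-]; rewrite ?slot0 ?slotD. Qed.

Lemma Iact_rho k f s : (k < size s)%N -> Iact D k (rho f) s = rho (slot k f) s.
Proof.
elim: k f s => [|k IH] f [|X s] //= ks.
  rewrite Iact_cons0 -[rho f _]/(contract (I X) (rho f) s) contract_rho.
  rewrite -[RHS]/(contract X (rho _) s) contract_rho -oppTE -rhoN; congr (rho _ s).
  rewrite -sumrN; apply: eq_bigr => x _; rewrite (ThI HE) -scaleNr.
  apply/funext => s'; rewrite !scaleTE /contract /slot /= mulrA; congr (_ * _).
  by rewrite [RHS]mulrC; case: (x.1); rewrite ?mulNr ?opprK.
rewrite Iact_consS contract_rho IH // -[RHS]/(contract X (rho _) s) contract_rho.
congr (rho _ s); rewrite slot_sum; apply: eq_bigr => x _.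
by rewrite slotZ.
Qed.

Lemma Iact2_rho i j f s : (i < size s)%N -> (j < size s)%N ->
  Iact D i (Iact D j (rho f)) s = rho (slot i (slot j f)) s.
Proof.
move=> si sj; rewrite -Iact_rho // {1 3}/Iact Iact_rho //.
by rewrite size_mkseq.
Qed.

Lemma cj_slot k f s : (k < size s)%N -> cj (slot k f) s = slot k (cj f) s.
Proof.
move=> ks; rewrite /cj /slot rmorphM; congr (_ * _).
have -> : nth true (map fst (map (@barJ n) s)) k = ~~ nth true (map fst s) k.
  by rewrite -map_comp (@eq_map _ _ _ (negb \o fst)) // map_comp (nth_map true) // size_map.
by rewrite [LHS]conj_sgi negbK.
Qed.

Lemma slot_hom p k f : hom p f -> hom p (slot k f).
Proof. by move=> hf s hs; rewrite /slot hf ?mulr0. Qed.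

Lemma slot2_holo p i j f : ty p 0 f -> slot i (slot j f) = - f.
Proof.
case=> _ _ tf; apply/funext => s; rewrite /slot oppTE.
have [s0|/tf ->] := eqVneq (nfalse s) 0%N; last by rewrite !mulr0 oppr0.
have nt k : nth true (map fst s) k = true.
  by elim: s k s0 => [|[[] a] s IH] [|k] //= s0; exact: IH.
by rewrite !nt mulrA mulrNN -expr2 sqrCi mulN1r.
Qed.

(** The conditions on pairs of slots force all arguments to be of one kind, so a real form in [lam]
    is a (p, 0) form plus its conjugate. *)
Lemma lam_rho p b : (0 < p)%N -> lam D p b <-> exists2 f, ty p 0 f & b = rho f.
Proof.
move=> p0; split; last first.
  case=> f tf ->; case: (tf) => hf sf _; split; first exact: rho_form.
  move=> i j /andP[ij jp]; apply/funext => s; have [sp|sp] := eqVneq (size s) p; last first.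
    have [hb _ _] := rho_form HE hf sf.
    by rewrite oppTE [rho f s]hb // /Iact hb ?oppr0 // !size_mkseq.
  by rewrite Iact2_rho ?sp //; [rewrite (slot2_holo _ _ tf) rhoN|exact: ltn_trans jp].
case=> /(form_rho HE)[f [hf sf fr ->]] Ib.
have f2 i j s : (i < j < p)%N -> size s = p -> slot i (slot j f) s = - f s.
  move=> ij sp; have /andP[ij1 jp] := ij.
  have /(rho_eq0 HE) : rho (slot i (slot j f) + f) = 0.
    apply/eqP; rewrite rhoD addr_eq0 -(Ib i j ij); apply/eqP/funext => t.
    have [tp|tp] := eqVneq (size t) p.
      by rewrite Iact2_rho ?tp //; exact: ltn_trans jp.
    have [hb' _ _] := rho_form HE hf sf.
    rewrite [LHS](rho_hom (slot_hom i (slot_hom j hf)) tp).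
    by rewrite /Iact hb' ?oppr0 // !size_mkseq.
  move/(congr1 (fun F => F s)); rewrite addTE cjD !addTE fr.
  have -> : cj (slot i (slot j f)) s = slot i (slot j f) s.
    rewrite cj_slot ?sp 1?(ltn_trans ij1) // /slot; congr (_ * _).
    by rewrite -[LHS]/(cj (slot j f) s) cj_slot ?sp // fr.
  by rewrite -mulr2n => /eqP; rewrite mulrn_eq0 /= addr_eq0 => /eqP.
have fz s : nfalse s != 0%N -> nfalse s != p -> f s = 0.
  move=> s0 s1; have [sp|/hf//] := eqVneq (size s) p.
  apply/eqP; apply: contraTT s1 => fs; apply/negP; apply/negP; rewrite negbK.
  pose m := map fst s; have ms : size m = p by rewrite size_map.
  (* If entries 0 and i were of different kinds, the factors -i and i would multiply to 1 and the
     condition would read f s = - f s. *)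
  have mi i : (i < p)%N -> nth true m i = nth true m 0.
    case: i => // i ip; have := f2 0%N i.+1 s ip sp; rewrite /slot -/m => e.
    apply/eqP; apply: contraNT fs => mm; move: e; rewrite sgi_neq; last by rewrite eq_sym.
    by move/eqP; rewrite -addr_eq0 -mulr2n mulrn_eq0.
  have mE : m = nseq p (nth true m 0).
    by rewrite -ms; apply/all_pred1P/(all_nthP true) => i; rewrite ms => /mi ->; rewrite /= eqxx.
  have : nfalse s = count negb m by rewrite /nfalse count_map.
  by rewrite mE count_nseq; case: (nth true m 0) => /= e; rewrite e ?mul0n ?mul1n // in s0 *.
(* f is its (p, 0) part plus the conjugate of that part, and both summands have the same image under
   [rho]. *)
exists (2 *: part 0 f); first by apply: tyZ; exact: ty_part.
rewrite -[X in X *: _]/(1 + 1) scalerDl scale1r rhoD -[in X in _ = _ + X]rho_cj -rhoD.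
congr rho; apply/funext => s; rewrite addTE /cj /part.
have [sp|sp] := eqVneq (size s) p; last first.
  by rewrite hf // [f (map _ _)]hf ?size_map // !if_same rmorph0 addr0.
have nb := nfalse_bar s; rewrite sp in nb.
have fb' : (f (map (@barJ n) s))^* = f s by rewrite -[in RHS]fr.
case: (eqVneq (nfalse s) 0%N) nb => [s0|s0] nb.
  by rewrite ifF ?rmorph0 ?addr0 //; rewrite s0 addn0 in nb; rewrite nb gtn_eqF.
rewrite add0r; case: eqP => [b0|b0]; first by rewrite fb'.
by rewrite rmorph0 fz //; apply: contra_not_neq b0 => e; move: nb; rewrite e; lia.
Qed.

Lemma tensor_expand t : multilinear t -> t [::] = 0 ->
  t = \sum_x otimes (flat D (E x)) (contract (E x) t).
Proof.
move=> mt t0; apply/funext => s; rewrite fct_sumE; case: s => [|X s].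
  by rewrite t0 big1 // => x _; rewrite /otimes /= mul0r.
rewrite [in LHS](EX HE X) (@multilinear_sum _ _ _ _ _ _ _ _ [::] s mt).
by apply: eq_bigr => x _; rewrite /otimes /= take0.
Qed.

Definition tJ (A : J -> 'I_n -> 'I_n -> C) : tensor C J := fun s =>
  if s is [:: x; y; z] then (if y.1 || z.1 then 0 else A x y.2 z.2) else 0.

Lemma tJD A B : tJ (fun x j l => A x j l + B x j l) = tJ A + tJ B.
Proof.
apply/funext => s; rewrite addTE /tJ; case: s => [|x [|y [|z [|w s]]]]; rewrite ?addr0 //.
by case: ifP => _; rewrite ?addr0.
Qed.

Lemma tJZ c A : tJ (fun x j l => c * A x j l) = c *: tJ A.
Proof.
apply/funext => s; rewrite scaleTE /tJ; case: s => [|x [|y [|z [|w s]]]]; rewrite ?mulr0 //.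
by case: ifP => _; rewrite ?mulr0.
Qed.

Lemma tJ_ty A x : (forall j l, A x j l = - A x l j) -> ty 2 2 (contract x (tJ A)).
Proof.
move=> sA; split.
- by move=> [|y [|z [|w s]]].
- move=> [|u [|v [|w s1]]] y z s2; rewrite /contract /= ?oppr0 //.
  case: s2 => [|? ?] /=; rewrite ?oppr0 //.
  by rewrite orbC sA; case: ifP; rewrite ?oppr0.
- move=> [|y [|z [|w s]]] //; rewrite /nfalse /contract /=.
  by case: (y.1) => //; case: (z.1).
Qed.

Lemma TU_rho a : TU D a <->
  exists2 A, (forall x j l, A x j l = - A x l j) & a = rho (tJ A).
Proof.
split.
  pose S : set (tensor R V) := [set a | exists2 A,
    (forall x j l, A x j l = - A x l j) & a = rho (tJ A)].
  apply: (@lin_span_sub _ _ _ S).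
    split.
      exists (fun _ _ _ => 0) => [x j l|]; first by rewrite oppr0.
      rewrite (_ : tJ _ = 0) ?rho0 //; apply/funext => -[|x [|y [|z [|w s]]]] //=.
      by rewrite if_same.
    move=> c u v [A sA ->] [B sB ->]; exists (fun x j l => (c%:C)%C * A x j l + B x j l).
      by move=> x j l; rewrite sA sB opprD mulrN.
    by rewrite tJD tJZ rhoD rhoZ.
  move=> _ [mu /(form_rho HE) [m [hm _ mr ->]]] [b /(lam_rho _ (isT : 0 < 2)%N) [f tf ->] <-].
  have [hf sf tf2] := ty_cj (erefl : (0 + 2)%N = 2%N) tf.
  exists (fun x j l => m [:: x] * cj f [:: (false, j); (false, l)]).
    by move=> x j l; rewrite (sf [::]) mulrN.
  (* The conjugate of f is of type (0, 2), and [tJ] keeps only barred form slots. *)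
  rewrite -[in LHS](rho_cj D E f).
  have -> : otimes (rho m) (rho (cj f)) = rho (otimes m (cj f)).
    apply/funext => s; rewrite /rho dec_otimes /rep -[dec m]rc_rho_real // /otimes.
    by rewrite /rc ReZ.
  congr rho; apply/funext => s; rewrite /otimes /tJ.
  case: s => [|x s]; first by rewrite hm // mul0r.
  rewrite /= take0; case: s => [|[c j] [|[d l] [|z s]]]; [by rewrite hf ?mulr0|by rewrite hf ?mulr0| |by rewrite hf ?mulr0].
  case: c => /=; first by rewrite [cj f _]tf2 ?mulr0 //; case: d.
  by case: d => //=; rewrite [cj f _]tf2 ?mulr0.
case=> A sA ->; rewrite (tensor_expand (rho_multilinear HE _)) //.
apply: subspace_sum; first exact: lin_span_subspace.
move=> x _; apply: sub_lin_span; exists (flat D (E x)).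
  rewrite (flat_rho HE); apply: rho_form => //.
    by apply: hom_sum => i _; apply: homZ; exact: dcoord_hom.
  by apply: skew_sum => i _; apply: skewZ; exact: dcoord_skew.
exists (contract (E x) (rho (tJ A))) => //.
rewrite lam_rho // contract_rho -rho_cj.
exists (cj (\sum_y Th (E x) y *: contract y (tJ A))) => //.
apply: (@ty_cj _ _ 2 2 0) => //; apply: ty_sum => y _; apply: tyZ; apply: tJ_ty.
by move=> j l; exact: sA.
Qed.

End TensorCoordinates.

(** * The maps Xi in components *)

Section FibreOperators.
Variables (R : realType) (V : lmodType R) (D : su_data V) (n : nat).
Local Notation C := (R[i]).
Local Notation J := (bool * 'I_n)%type.
Local Notation g := (met D).
Local Notation db i := (dcoord C (false, i)).
Local Notation Psi := (@Psi C n).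
Local Notation psiJ := (@psiJ C n).
Variables (E : J -> V) (HE : sframe D E).
Local Notation Th := (Th D E).
Local Notation rho := (@rho R V D n E).
Variable e : 'I_(n.*2) -> V.
Hypothesis parseval : forall u v, \sum_i g u (e i) * g v (e i) = g u v.

(** Parseval in complex form: dz_i has bilinear square 0, and its product with its conjugate is
    2. *)
Lemma Th_sum x y : \sum_i Th (e i) x * Th (e i) y = (y == barJ x)%:R * 2.
Proof.
pose sn (b : bool) : C := if b then 1 else -1.
have ThE X z : Th X z = ((g (E (true, z.2)) X)%:C)%C + sn z.1 * 'i * ((g (E (false, z.2)) X)%:C)%C.
  case: z => -[] i; rewrite /Th /= complex_iE /sn; first by rewrite mul1r.
  by rewrite rmorphN mulrN !mulNr mul1r.
have P u v : \sum_i ((g u (e i))%:C)%C * ((g v (e i))%:C)%C = ((g u v)%:C)%C :> C.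
  by rewrite -parseval rmorph_sum; apply: eq_bigr => i _; rewrite rmorphM.
transitivity (\sum_i ((((g (E (true, x.2)) (e i))%:C)%C * ((g (E (true, y.2)) (e i))%:C)%C)
  + (sn y.1 * 'i) * (((g (E (true, x.2)) (e i))%:C)%C * ((g (E (false, y.2)) (e i))%:C)%C)
  + (sn x.1 * 'i) * (((g (E (false, x.2)) (e i))%:C)%C * ((g (E (true, y.2)) (e i))%:C)%C)
  + (sn x.1 * sn y.1 * ('i * 'i)) * (((g (E (false, x.2)) (e i))%:C)%C * ((g (E (false, y.2)) (e i))%:C)%C))).
  apply: eq_bigr => i _; rewrite !ThE.
  move: (sn x.1) (sn y.1) ('i : C) ((g _ _)%:C)%C ((g _ _)%:C)%C ((g _ _)%:C)%C ((g _ _)%:C)%C.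
  by move=> *; ring.
rewrite !big_split -!mulr_sumr !P !(gE HE) !xpair_eqE /= !mulr0 !addr0.
rewrite -expr2 sqrCi rmorph_nat; case: x y => b i [c j] /=.
rewrite /barJ xpair_eqE /= (eq_sym j); case: (i == j); last by rewrite !andbF rmorph0 mulr0 addr0 mul0r.
by rewrite andbT rmorph1 /sn; case: b c => -[] /=; ring.
Qed.

(** Component form of [Xi_with]: the sum over the frame becomes a sum over an index and its
    conjugate, and the 2 from [Th_sum] cancels the factor 1/2. *)
Definition XiJ (p h : tensor C J) : tensor C J := fun s =>
  if s is x :: s' then
    (\sum_y contract y (contract x h) ∧ contract (barJ y) p) s' else 0.

Lemma contract_real X f : cj f = f -> cj (\sum_y Th X y *: contract y f) = \sum_y Th X y *: contract y f.
Proof.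
move=> fr; rewrite cj_sum (reindex_inj (inv_inj (@barJK n))); apply: eq_bigr => y _.
by rewrite cjZ Th_bar conjCK -[in RHS]fr contract_cj.
Qed.

Lemma Xi_with_rho (p h : tensor C J) : cj p = p -> Xi_with e (rho p) (rho h) = rho (XiJ p h).
Proof.
move=> pr; apply/funext => -[|X s]; first by rewrite rho_nil.
rewrite -[RHS]/(contract X (rho _) s) contract_rho /=; congr (_ s).
pose hX := \sum_x Th X x *: contract x h.
transitivity (rho (2^-1 *: \sum_i (\sum_y Th (e i) y *: contract y hX)
    ∧ (\sum_z Th (e i) z *: contract z p))).
  have -> : (2^-1 : C) = ((2^-1 : R)%:C)%C by rewrite fmorphV rmorph_nat.
  rewrite rhoZ rho_sum; congr (_ *: _); apply: eq_bigr => i _.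
  by rewrite !contract_rho rho_wedge //; exact: contract_real.
congr rho.
transitivity (2^-1 *: \sum_y \sum_z (\sum_i Th (e i) y * Th (e i) z) *: (contract y hX ∧ contract z p)).
  congr (_ *: _).
  transitivity (\sum_i \sum_y \sum_z (Th (e i) y * Th (e i) z) *: (contract y hX ∧ contract z p)).
    apply: eq_bigr => i _; rewrite ewedge_suml; apply: eq_bigr => y _.
    rewrite ewedge_sumr; apply: eq_bigr => z _.
    by rewrite ewedgeZl ewedgeZr scalerA.
  rewrite exchange_big; apply: eq_bigr => y _; rewrite exchange_big; apply: eq_bigr => z _.
  by rewrite scaler_suml.
transitivity (\sum_y contract y hX ∧ contract (barJ y) p).
  rewrite scaler_sumr; apply: eq_bigr => y _; rewrite (bigD1 (barJ y)) //= [X in _ *: (_ + X)]big1 ?addr0 => [|z zy].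
    by rewrite Th_sum eqxx mul1r scalerA mulVf ?scale1r // pnatr_eq0.
  by rewrite Th_sum (negPf zy) mul0r scale0r.
rewrite /hX; transitivity (\sum_y \sum_x Th X x *: (contract y (contract x h) ∧ contract (barJ y) p)).
  apply: eq_bigr => y _; rewrite contract_sum ewedge_suml; apply: eq_bigr => x _.
  by rewrite contractZ ewedgeZl.
rewrite exchange_big; apply: eq_bigr => x _; rewrite -scaler_sumr; congr (_ *: _).
Qed.

Lemma Xi_rho A : Xi_plus D e (rho (tJ A)) = rho (XiT A).
Proof.
rewrite /Xi_plus (_ : psi_minus D = rho (psiJ (av R false))); last by rewrite -(psi_rho HE).
rewrite Xi_with_rho ?psiJ_real //; congr rho; apply/funext => -[|x s] //=.
congr (_ s); rewrite sumJ big1 ?add0r => [|j _]; last first.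
  rewrite (_ : contract _ _ = 0) ?ewedge0l //; apply/funext => t.
  by rewrite /contract /=; case: t => [|z [|w t]].
rewrite scaler_sumr; apply: eq_bigr => j _.
have -> : contract (false, j) (contract x (tJ A)) = \sum_l A x j l *: db l.
  apply/funext => t; rewrite fct_sumE /contract /=; case: t => [|[b l] [|w t]].
  - by rewrite big1 // => l _; rewrite scaleTE /dcoord mulr0.
  - rewrite (bigD1 l) //= scaleTE /dcoord big1 ?addr0 => [|k kl].
      by rewrite eqseq_cons eqxx andbT xpair_eqE eqxx andbT; case: b; rewrite ?mulr1 ?mulr0.
    by rewrite scaleTE /dcoord eqseq_cons xpair_eqE (eq_sym l) (negPf kl) andbF mulr0.
  - by rewrite big1 // => l' _; rewrite scaleTE /dcoord eqseq_cons andbF mulr0.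
(* The conjugated index is holomorphic, so the contraction kills the conjugate of Psi and leaves the
   factor 1/(2i) of psi_-. *)
have -> : contract (barJ (false, j)) (psiJ (av R false)) = (2 * 'i)^-1 *: iz j Psi.
  rewrite /psiJ contractD !contractZ contract_cj ib_Psi cj0 scaler0 addr0.
  by [].
rewrite ewedgeZr; congr (_ *: _); rewrite ewedge_suml; apply: eq_bigr => l _.
by rewrite ewedgeZl.
Qed.

End FibreOperators.

(** * The Gray-Hervella modules in components *)

Section FibreModules.
Variables (R : realType) (V : lmodType R) (D : su_data V) (n : nat).
Local Notation C := (R[i]).
Local Notation J := (bool * 'I_n)%type.
Local Notation I := (acs D).
Local Notation g := (met D).
Variables (E : J -> V) (HE : sframe D E).
Local Notation Th := (Th D E).
Local Notation dec := (lin_subst Th).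
Local Notation rho := (@rho R V D n E).
Variable e : 'I_(n.*2) -> V.
Hypothesis parseval : forall u v, \sum_i g u (e i) * g v (e i) = g u v.
Implicit Types (A : J -> 'I_n -> 'I_n -> C).

Local Notation skewA A := (forall x j l, A x j l = - A x l j).

Lemma skew_rho f : skew (rho f) -> skew (f + cj f).
Proof.
move=> sr; have mr := rho_multilinear HE f.
have e1 : rho (comp E (rho f)) = rho (2^-1 *: (f + cj f)).
  by rewrite -(rho_comp HE mr) -rho_real.
have fr : cj (2^-1 *: (f + cj f)) = 2^-1 *: (f + cj f).
  by rewrite cjZ cjD cjK addrC fmorphV rmorph_nat.
have := comp_skew E sr; rewrite (rho_real_inj HE (comp_real HE mr) fr e1) => sk.
by have := skewZ 2 sk; rewrite scalerA mulfV ?scale1r // pnatr_eq0.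
Qed.

Lemma tJ_hom A : hom 3 (tJ A).
Proof. by move=> [|x [|y [|z [|w s]]]]. Qed.

Lemma cjtJ A x y z : cj (tJ A) [:: x; y; z] =
  if y.1 && z.1 then (A (barJ x) y.2 z.2)^* else 0.
Proof.
rewrite /cj /= -negb_and; case: (y.1 && z.1) => //=.
by rewrite rmorph0.
Qed.

(** Total skewness moves a holomorphic leading index into a form slot, where [tJ] vanishes; only
    barred indices survive. *)
Lemma W1_rho a : W1 D a <-> exists2 B : 'I_n -> 'I_n -> 'I_n -> C,
  (forall m j l, B m j l = - B m l j) /\ (forall m j l, B m j l = - B j m l) &
  a = rho (tJ (fun x => if x.1 then fun _ _ => 0 else B x.2)).
Proof.
split=> [[/(TU_rho HE)[A sA ->] alt_a]|[B [B1 B2] ->]].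
  have sk := skew_rho (alternating_skew (rho_multilinear HE _) alt_a).
  have tz m j l : A (true, m) j l = 0.
    have := sk [::] (true, m) (false, j) [:: (false, l)].
    by rewrite /= !addTE !cjtJ /= !addr0 oppr0.
  have ff m j l : A (false, m) j l = - A (false, j) m l.
    have := sk [::] (false, m) (false, j) [:: (false, l)].
    by rewrite /= !addTE !cjtJ /= !addr0.
  exists (fun m => A (false, m)); first by split=> // m j l; exact: sA.
  congr (rho (tJ _)); apply/funext => -[] [] i //=.
  by apply/funext => j; apply/funext => l; rewrite tz.
pose A x := if x.1 then fun _ _ : 'I_n => 0 else B x.2.
have sA : skewA A by move=> [[] m] j l; rewrite /A /= ?oppr0.
split; first by apply/(TU_rho HE); exists A.
suff sk : skew (tJ A) by have [] := rho_form HE (tJ_hom A) sk.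
move=> [|u [|v [|w s1]]] x y s2.
- case: s2 => [|z [|w s2]]; rewrite /= ?oppr0 //.
  by case: x y z => [[] x] [[] y] [[] z] /=; rewrite /A /= ?oppr0.
- case: s2 => [|z s2]; rewrite /= ?oppr0 // orbC sA.
  by case: ifP => _; rewrite ?oppr0.
- by rewrite /= oppr0.
- by case: s1 => [|? ?]; rewrite /= oppr0.
Qed.

Definition rot3 (f : tensor C J) : tensor C J := fun s =>
  if s is [:: x; y; z] then f [:: y; z; x] else 0.

Lemma dec3 f X Y Z : dec f [:: X; Y; Z] =
  \sum_x \sum_y \sum_z Th X x * (Th Y y * (Th Z z * f [:: x; y; z])).
Proof.
rewrite dec_cons; apply: eq_bigr => x _; rewrite dec_cons mulr_sumr; apply: eq_bigr => y _.
by rewrite dec_cons !mulr_sumr; apply: eq_bigr => z _.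
Qed.

Lemma dec_rot3 f X Y Z : dec (rot3 f) [:: X; Y; Z] = dec f [:: Y; Z; X].
Proof.
rewrite !dec3 exchange_big; apply: eq_bigr => y _; rewrite exchange_big; apply: eq_bigr => z _.
apply: eq_bigr => x _ /=; ring.
Qed.

(** With one holomorphic index, two of the three cyclic terms have it in a form slot and vanish, so
    the third vanishes too. *)
Lemma W2_rho a : W2 D a <-> exists2 B : 'I_n -> 'I_n -> 'I_n -> C,
  (forall m j l, B m j l = - B m l j) /\ (forall m j l, B m j l + B j l m + B l m j = 0) &
  a = rho (tJ (fun x => if x.1 then fun _ _ => 0 else B x.2)).
Proof.
have cyc f X Y Z : rho f [:: X; Y; Z] + rho f [:: Y; Z; X] + rho f [:: Z; X; Y] =
    rho (f + rot3 f + rot3 (rot3 f)) [:: X; Y; Z].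
  by rewrite !rhoD !addTE /rho /rep !dec_rot3.
split=> [[/(TU_rho HE)[A sA ->] cyc_a]|[B [B1 B2] ->]].
  have /(rho_eq0 HE) c0 : rho (tJ A + rot3 (tJ A) + rot3 (rot3 (tJ A))) = 0.
    apply/funext => s; have [s3|s3] := eqVneq (size s) 3%N; last first.
      rewrite (@rho_hom _ _ _ _ E 3) //; apply: homD; first apply: homD.
      - exact: tJ_hom.
      - by move=> [|x [|y [|z [|w t]]]].
      - by move=> [|x [|y [|z [|w t]]]].
    by case: s s3 => [|X [|Y [|Z [|W s]]]] // _; rewrite -cyc cyc_a.
  have ev x y z := congr1 (fun F => F [:: x; y; z]) c0.
  have tz m j l : A (true, m) j l = 0.
    have := ev (true, m) (false, j) (false, l).
    by rewrite !addTE /cj !addTE /= !(addr0, add0r, rmorph0).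
  have ff m j l : A (false, m) j l + A (false, j) l m + A (false, l) m j = 0.
    have := ev (false, m) (false, j) (false, l).
    by rewrite !addTE /cj !addTE /= !(addr0, add0r, rmorph0).
  exists (fun m => A (false, m)); first by split=> // m j l; exact: sA.
  congr (rho (tJ _)); apply/funext => -[] [] i //=.
  by apply/funext => j; apply/funext => l; rewrite tz.
pose A x := if x.1 then fun _ _ : 'I_n => 0 else B x.2.
have sA : skewA A by move=> [[] m] j l; rewrite /A /= ?oppr0.
split; first by apply/(TU_rho HE); exists A.
move=> X Y Z; rewrite cyc (_ : _ + _ + _ = 0) ?rho0 //; apply/funext => s.
rewrite !addTE; case: s => [|x [|y [|z [|w s]]]]; rewrite /= ?addr0 //.
by case: x y z => [[] x] [[] y] [[] z] /=; rewrite /A /= ?addr0 //; exact: B2.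
Qed.

(** Applying I to the first two arguments multiplies a component of [tJ] by -1 if the leading index
    is barred and by 1 otherwise. The metric trace then pairs a holomorphic leading index with a
    barred form index. *)
Lemma W3_rho a : W3 D e a <-> exists2 B : 'I_n -> 'I_n -> 'I_n -> C,
  (forall m j l, B m j l = - B m l j) /\ (forall l, \sum_j B j j l = 0) &
  a = rho (tJ (fun x => if x.1 then B x.2 else fun _ _ => 0)).
Proof.
pose th (x : J) : C := if x.1 then 'i else - 'i.
pose eps (f : tensor C J) : tensor C J := fun s =>
  if s is [:: x; y; z] then th x * th y * f [:: x; y; z] else 0.
have epsE f X Y Z : rho f [:: I X; I Y; Z] = rho (eps f) [:: X; Y; Z].
  rewrite /rho /rep !dec3; congr complex.Re; apply: eq_bigr => x _; apply: eq_bigr => y _.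
  by apply: eq_bigr => z _; rewrite /= !(ThI HE) -/(th x) -/(th y); ring.
have th_sq b c i j : th (b, i) * th (c, j) = if b == c then -1 else 1.
  have sq : 'i * 'i = -1 :> C by rewrite -expr2 sqrCi.
  by case: b c => -[]; rewrite /th /= ?mulNr ?mulrN sq ?opprK.
pose tr f : tensor C J := fun s =>
  if s is [:: z] then 2 * \sum_x f [:: x; barJ x; z] else 0.
have trE f Z : \sum_i rho f [:: e i; e i; Z] = rho (tr f) [:: Z].
  rewrite /rho /rep -Re_sum; congr complex.Re; rewrite dec_cons.
  transitivity (\sum_x \sum_y \sum_z (\sum_i Th (e i) x * Th (e i) y) * (Th Z z * f [:: x; y; z])).
    under eq_bigr do rewrite dec3.
    rewrite exchange_big; apply: eq_bigr => x _; rewrite exchange_big; apply: eq_bigr => y _.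
    rewrite exchange_big; apply: eq_bigr => z _; rewrite mulr_suml; apply: eq_bigr => i _.
    by rewrite !mulrA.
  transitivity (\sum_x \sum_z 2 * (Th Z z * f [:: x; barJ x; z])).
    apply: eq_bigr => x _; rewrite (bigD1 (barJ x)) //= [X in _ + X]big1 ?addr0 => [|y yx].
      by apply: eq_bigr => z _; rewrite (Th_sum HE parseval) eqxx mul1r.
    by apply: big1 => z _; rewrite (Th_sum HE parseval) (negPf yx) !mul0r.
  rewrite exchange_big; apply: eq_bigr => z _.
  rewrite /= /contract mulrA [_ * 2]mulrC mulr_sumr.
  by apply: eq_bigr => x _; rewrite mulrA.
have trA A b l : \sum_x tJ A [:: x; barJ x; (b, l)] =
    if b then 0 else \sum_j A (true, j) j l.
  rewrite sumJ /= [X in _ + X]big1 ?addr0 //.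
  by case: b => //=; rewrite big1.
split=> [[/(TU_rho HE)[A sA ->] [inv_a tr_a]]|[B [B1 B2] ->]].
  have /(rho_eq0 HE) i0 : rho (eps (tJ A) - tJ A) = 0.
    apply/funext => s; have [s3|s3] := eqVneq (size s) 3%N; last first.
      rewrite (@rho_hom _ _ _ _ E 3) //; apply: homD; last first.
        by move=> t /tJ_hom h; rewrite oppTE h oppr0.
      by move=> [|x [|y [|z [|w t]]]].
    case: s s3 => [|X [|Y [|Z [|W s]]]] // _.
    by rewrite rhoB addTE oppTE -epsE inv_a subrr.
  have ff m j l : A (false, m) j l = 0.
    have := congr1 (fun F => F [:: (false, m); (false, j); (false, l)]) i0.
    rewrite addTE /cj !addTE !oppTE /= !mulr0 subrr rmorph0 addr0 th_sq eqxx mulN1r.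
    move/eqP; rewrite -opprD oppr_eq0 -mulr2n -mulr_natl mulf_eq0 pnatr_eq0 /=.
    by move/eqP.
  have /(rho_eq0 HE) t0 : rho (tr (tJ A)) = 0.
    apply/funext => -[|Z [|W s]]; rewrite ?rho_nil //.
      by rewrite -trE tr_a.
    rewrite (@rho_hom _ _ _ _ E 1) //.
    by move=> [|x [|y t]].
  have tt l : \sum_j A (true, j) j l = 0.
    have := congr1 (fun F => F [:: (false, l)]) t0.
    rewrite addTE /cj /= !trA mulr0 rmorph0 addr0 => /eqP.
    by rewrite mulf_eq0 pnatr_eq0 => /eqP.
  exists (fun m => A (true, m)); first by split=> // m j l; exact: sA.
  congr (rho (tJ _)); apply/funext => -[] [] i //=.
  by apply/funext => j; apply/funext => l; rewrite ff.
pose A x := if x.1 then B x.2 else fun _ _ : 'I_n => 0.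
have sA : skewA A by move=> [[] m] j l; rewrite /A /= ?oppr0.
split; first by apply/(TU_rho HE); exists A.
split.
  move=> X Y Z; rewrite epsE; congr (rho _ _); apply/funext => s.
  case: s => [|x [|y [|z [|w s]]]] //=; case: x y z => [[] x] [[] y] [[] z] /=; rewrite ?mulr0 //.
  by rewrite th_sq /= mul1r.
have tz z : tr (tJ A) [:: z] = 0.
  by case: z => b l; rewrite /tr trA; case: b; rewrite ?mulr0 // B2 mulr0.
by move=> Z; rewrite trE (_ : tr _ = 0) ?rho0 //; apply/funext => -[|z [|w s]] //; exact: tz.
Qed.

End FibreModules.

(** * The module W4 and the Hodge star in components *)

Section FibreStar.
Variables (R : realType) (V : lmodType R) (D : su_data V) (n : nat).
Local Notation C := (R[i]).
Local Notation J := (bool * 'I_n)%type.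
Local Notation I := (acs D).
Local Notation g := (met D).
Local Notation dz i := (dcoord C (true, i)).
Local Notation db i := (dcoord C (false, i)).
Variables (E : J -> V) (HE : sframe D E).
Local Notation Th := (Th D E).
Local Notation dec := (lin_subst Th).
Local Notation rho := (@rho R V D n E).
Local Notation omk := (@omk C n).
Variable e : 'I_(n.*2) -> V.
Hypothesis parseval : forall u v, \sum_i g u (e i) * g v (e i) = g u v.
Implicit Types (A : J -> 'I_n -> 'I_n -> C).

(** The pure trace arrays: the components of the elements of W4. *)
Definition A4 (w : 'I_n -> C) (x : J) (j l : 'I_n) : C :=
  if x.1 then (x.2 == j)%:R * w l - (x.2 == l)%:R * w j else 0.

Lemma A4_skew w x j l : A4 w x j l = - A4 w x l j.
Proof. by rewrite /A4; case: ifP => _; rewrite ?opprB ?oppr0. Qed.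

Lemma parseval_sum (F : V -> R) u :
  (forall c X Y, F (c *: X + Y) = c * F X + F Y) ->
  \sum_i g u (e i) * F (e i) = F u.
Proof.
move=> FL; have F0 : F 0 = 0.
  by rewrite -(addNr 0) -scaleN1r FL mulN1r addNr.
have FE X : F X = \sum_x g (E x) X * F (E x).
  rewrite {1}(EX HE X); elim/big_rec2: _ => [|j x y _ <-] //.
transitivity (\sum_x (\sum_i g u (e i) * g (E x) (e i)) * F (E x)).
  under eq_bigr => i _ do rewrite FE mulr_sumr.
  rewrite exchange_big; apply: eq_bigr => x _; rewrite mulr_suml; apply: eq_bigr => i _.
  by rewrite mulrA.
by rewrite [RHS]FE; apply: eq_bigr => x _; rewrite parseval (gC HE).
Qed.

Definition W4form (mu : tensor R V) : tensor R V :=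
  \sum_i otimes (flat D (e i))
     (flat D (e i) ∧ mu - flat D (I (e i)) ∧ Iact D 0 mu).

(** The sum over the frame collapses by Parseval. The result no longer mentions the frame, which
    gives both the components and the equivariance. *)
Lemma W4form_contract mu X :
  contract X (W4form mu) = flat D X ∧ mu - flat D (I X) ∧ Iact D 0 mu.
Proof.
apply/funext => s; rewrite /contract /W4form fct_sumE.
pose F Y : R := (flat D Y ∧ mu - flat D (I Y) ∧ Iact D 0 mu) s.
have fl c Y Z : flat D (c *: Y + Z) = c *: flat D Y + flat D Z.
  apply/funext => -[|W [|W' t]]; rewrite addTE scaleTE /= ?mulr0 ?addr0 //.
  by rewrite (gL HE).
rewrite -[RHS]/(F X) -(@parseval_sum F).
  by apply: eq_bigr => i _; rewrite /otimes /= take0 (gC HE).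
move=> c Y Z; rewrite /F !addTE !oppTE (IL HE) !fl !ewedgeDl !ewedgeZl !addTE !scaleTE.
by rewrite mulrBr opprD addrACA.
Qed.

Lemma Iact0_rho m : hom 1 m -> cj m = m ->
  Iact D 0 (rho m) = rho (slot 0 m) /\ cj (slot 0 m) = slot 0 m.
Proof.
move=> hm mr; split.
  apply/funext => -[|Y t]; last by rewrite (Iact_rho HE).
  by rewrite rho_nil /Iact /= rho_nil /slot hm // mulr0 oppr0.
apply/funext => -[|x t]; last by rewrite cj_slot // mr.
by rewrite /cj /slot /= hm // mulr0 rmorph0.
Qed.

(** The two wedge terms combine into a single product with mu + i I mu, which is twice the (1, 0)
    part of mu. Conjugation then puts the form indices in barred position. *)
Lemma W4form_rho m : hom 1 m -> cj m = m ->
  W4form (rho m) = rho (tJ (A4 (fun l => 2 * m [:: (false, l)]))).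
Proof.
move=> hm mr; apply/funext => -[|X s].
  rewrite rho_nil /= /W4form fct_sumE big1 // => i _.
  by rewrite /otimes /= mul0r.
rewrite -[LHS]/(contract X _ s) -[RHS]/(contract X _ s); congr (_ s).
rewrite W4form_contract contract_rho.
have [Im sr] := Iact0_rho hm mr.
pose ph := \sum_i Th X (false, i) *: dz i.
have phI : \sum_i Th (I X) (false, i) *: dz i = - 'i *: ph.
  by rewrite scaler_sumr; apply: eq_bigr => i _; rewrite (ThI HE) scalerA.
rewrite Im !(flat_rho HE) phI !rho_wedge // -rhoB.
have -> : ph ∧ m - (- 'i *: ph) ∧ slot 0 m = ph ∧ (m + 'i *: slot 0 m).
  by rewrite ewedgeDr ewedgeZl ewedgeZr scaleNr opprK.
have -> : m + 'i *: slot 0 m = 2 *: \sum_l m [:: (true, l)] *: dz l.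
  apply/funext => t; rewrite addTE !scaleTE fct_sumE /slot.
  case: t => [|[b l] [|z t]].
  - by rewrite hm // !mulr0 addr0 big1 ?mulr0 // => l _; rewrite scaleTE /dcoord mulr0.
  - under eq_bigr do rewrite scaleTE /dcoord eqseq_cons andbT xpair_eqE.
    have sq : 'i * 'i = -1 :> C by rewrite -expr2 sqrCi.
    case: b => /=; rewrite mulrA ?mulrN sq.
      rewrite opprK mul1r (bigD1 l) //= eqxx mulr1 big1 ?addr0; first by rewrite mulr_natl mulr2n.
      by move=> k kl; rewrite eq_sym (negPf kl) mulr0.
    by rewrite mulN1r subrr big1 ?mulr0 // => k _; rewrite mulr0.
  - by rewrite hm // !mulr0 addr0 big1 ?mulr0 // => k _; rewrite scaleTE /dcoord eqseq_cons andbF mulr0.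
rewrite -rho_cj; congr rho.
rewrite cj_ewedge cjZ rmorph_nat !cj_sum sumJ [X in _ + X]big1 ?addr0 => [|i _]; last first.
  rewrite (_ : contract _ _ = 0) ?scaler0 //; apply/funext => t.
  by rewrite /contract /=; case: t => [|y [|z [|w t]]] //=; rewrite /A4 /= if_same.
rewrite ewedge_suml; apply: eq_bigr => i _.
rewrite cjZ cj_dcoord -(Th_bar D E) ewedgeZl; congr (_ *: _).
have -> : 2 *: \sum_l cj (m [:: (true, l)] *: dz l) = \sum_l (2 * m [:: (false, l)]) *: db l.
  rewrite scaler_sumr; apply: eq_bigr => l _; rewrite cjZ cj_dcoord scalerA; congr (_ * _ *: _).
  by rewrite -[in RHS]mr.
set G := \sum_l _; have hG : hom 1 G by apply: hom_sum => l _; apply: homZ; exact: dcoord_hom.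
have GE l : G [:: (false, l)] = 2 * m [:: (false, l)].
  rewrite /G fct_sumE (bigD1 l) //= scaleTE /dcoord eqxx mulr1 big1 ?addr0 // => k kl.
  by rewrite scaleTE eqseq_cons xpair_eqE (eq_sym l) (negPf kl) mulr0.
have GT l : G [:: (true, l)] = 0.
  by rewrite /G fct_sumE big1 // => k _; rewrite scaleTE /dcoord eqseq_cons xpair_eqE mulr0.
apply/funext => t; have [t2|t2] := eqVneq (size t) 2%N; last first.
  rewrite (ewedge_hom (@dcoord_hom _ _ _) hG) // /contract /=.
  by case: t t2 => [|y [|z [|w t]]].
case: t t2 => [|y [|z [|w t]]] // _.
rewrite -[LHS]/(contract y _ [:: z]) contract_dwedge addTE oppTE scaleTE.
have -> : contract y G = G [:: y] *: tensor_one.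
  apply/funext => -[|x t]; rewrite scaleTE /contract /tensor_one ?mulr1 //.
  by rewrite hG // mulr0.
rewrite ewedgeZr ewedge1r scaleTE /dcoord eqseq_cons andbT /contract /=.
case: y z => -[] y [[] z]; rewrite ?GE ?GT !xpair_eqE /=; rewrite ?mulr0 ?mul0r ?subr0 //.
by rewrite /A4 /= !(eq_sym i) [_ * (z == i)%:R]mulrC.
Qed.

Lemma ffun_itsum (I0 : finType) (W : Type) (M : nmodType) k (h : I0 -> W) (F : seq W -> M) :
  \sum_(j : {ffun 'I_k -> I0}) F [seq h (j i) | i : 'I_k] = itsum k (fun l => F (map h l)).
Proof.
rewrite itsum_tuple (reindex (fun t : k.-tuple I0 => [ffun i => tnth t i])) /=; last first.
  exists (fun f => [tuple f i | i < k]) => [t _|f _].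
    by apply: eq_from_tnth => i; rewrite tnth_mktuple ffunE.
  by apply/ffunP => i; rewrite ffunE tnth_mktuple.
apply: eq_bigr => t _; congr F; rewrite /image_mem -[in RHS](map_tnth_enum t) -map_comp.
by apply: eq_map => i; rewrite /= ffunE.
Qed.

(** Each of the k sums over the frame pairs an index with its conjugate and contributes a factor 2,
    by [Th_sum]. *)
Lemma itsum_frame k f nu s :
  itsum k (fun l => dec f (map e l) * dec nu (map e l ++ s)) =
  2 ^+ k * dec (starJ k f nu) s.
Proof.
have -> : dec (starJ k f nu) s =
    itsum k (fun y => f y * dec (conl (map (@barJ n) y) nu) s).
  rewrite itsum_tuple /starJ dec_sum fct_sumE; apply: eq_bigr => y _.
  by rewrite decZ.
elim: k f nu => [|k IH] f nu; first by rewrite /= mul1r.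
rewrite [LHS]/=.
transitivity (\sum_i itsum k (fun l =>
    dec (\sum_x Th (e i) x *: contract x f) (map e l) *
    dec (\sum_x Th (e i) x *: contract x nu) (map e l ++ s))).
  apply: eq_bigr => i _; apply: eq_itsum => l _.
  by rewrite -!contract_dec.
under eq_bigr do rewrite IH itsum_tuple.
rewrite -mulr_sumr exprS -mulrA mulrCA; congr (_ * _).
rewrite exchange_big /=.
under [in RHS]eq_bigr do rewrite itsum_tuple.
rewrite [in RHS]exchange_big mulr_sumr; apply: eq_bigr => y _.
transitivity (\sum_x \sum_z (\sum_i Th (e i) x * Th (e i) z) *
   (f (x :: y) * dec (conl (map (@barJ n) y) (contract z nu)) s)).
  transitivity (\sum_i \sum_x \sum_z (Th (e i) x * Th (e i) z) *
     (f (x :: y) * dec (conl (map (@barJ n) y) (contract z nu)) s)).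
    apply: eq_bigr => i _; rewrite fct_sumE mulr_suml; apply: eq_bigr => x _.
    have -> : conl (map (@barJ n) y) (\sum_z Th (e i) z *: contract z nu) =
       \sum_z Th (e i) z *: conl (map (@barJ n) y) (contract z nu).
      by apply/funext => t; rewrite /conl !fct_sumE.
    rewrite dec_sum fct_sumE mulr_sumr; apply: eq_bigr => z _.
    by rewrite decZ !scaleTE /contract; ring.
  rewrite exchange_big; apply: eq_bigr => x _; rewrite exchange_big; apply: eq_bigr => z _.
  by rewrite mulr_suml.
rewrite mulr_sumr; apply: eq_bigr => x _.
rewrite (bigD1 (barJ x)) //= [X in _ + X]big1 ?addr0 => [|z zx].
  by rewrite (Th_sum HE parseval) eqxx mul1r.
by rewrite (Th_sum HE parseval) (negPf zx) !mul0r.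
Qed.

Lemma cj_one : cj tensor_one = tensor_one :> tensor C J.
Proof. by apply/funext => -[|x s]; rewrite /cj /tensor_one /= ?rmorph1 ?rmorph0. Qed.

Lemma cj_omk k : cj (omk k) = omk k.
Proof. by elim: k => [|k IH]; [exact: cj_one|rewrite [omk _]/= cj_ewedge IH cj_om]. Qed.

Lemma rho_omk k : rho (omk k) = iter k (@ewedge R V (kahler D)) tensor_one.
Proof.
elim: k => [|k IH]; first by rewrite /rho dec_one -rc_one rep_rc.
by rewrite [omk _]/= -rho_wedge ?cj_omk // IH -(om_rho HE).
Qed.

(** The factor collects 1/k!, the normalization of Vol and 2^k. It only needs to be nonzero, because
    the star enters through a vanishing condition. *)
Lemma star_rho k f : cj f = f ->
  exists2 a : R, a != 0 & star D e k (rho f) = a *: rho (starJ k f (omk n)).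
Proof.
move=> fr; have [v v0 volE] : exists2 v : R, v != 0 & vol D n = v *: rho (omk n).
  exists ((-1) ^+ (n * n.+1)./2 / n`!%:R); last by rewrite rho_omk /vol big_const_ord.
  by rewrite mulf_neq0 ?signr_eq0 // invr_eq0 pnatr_eq0 -lt0n fact_gt0.
exists ((k`!%:R)^-1 * v * 2 ^+ k).
  by rewrite !mulf_neq0 ?expf_neq0 ?invr_eq0 ?pnatr_eq0 -?lt0n ?fact_gt0.
apply/funext => s; rewrite scaleTE /star -!mulrA; congr (_ * _).
rewrite (ffun_itsum k e (fun l => rho f l * vol D n (l ++ s))) volE itsum_tuple.
rewrite -[in RHS]ReZ rmorphXn rmorph_nat -itsum_frame itsum_tuple Re_sum mulr_sumr.
apply: eq_bigr => y _; rewrite scaleTE mulrCA; congr (_ * _).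
by rewrite -ReZ -[dec f _]/(dec f (map e y)) -(rc_rho_real D E fr).
Qed.

End FibreStar.

Section AltOtimes.
Variables (K : numFieldType) (V : Type).

Lemma alt_otimes (mu b : tensor K V) : hom 1 mu -> alt (otimes mu b) = ewedge mu b.
Proof.
move=> hm; apply/funext => s; elim: s b => [|X s IH] b.
  by rewrite alt_nil ewedge_nil hm // mul0r.
rewrite alt_cons ewedge_cons (sg_hom hm) expr1 scaleN1r ewedgeNl.
have -> : contract X mu = mu [:: X] *: tensor_one.
  by apply/funext => -[|Y t]; rewrite scaleTE /contract /tensor_one ?mulr1 // hm // mulr0.
have -> : swp X (otimes mu b) = otimes mu (contract X b).
  by apply/funext => -[|Y t]; rewrite /otimes /= ?take0 // hm // mul0r.
by rewrite IH ewedgeZl ewedge1l /otimes /= take0.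
Qed.

End AltOtimes.

Lemma image_lin_span (R : nzRingType) (W W' : lmodType R) (f : W -> W') (S : set W) :
  (forall c u v, f (c *: u + v) = c *: f u + f v) ->
  f @` lin_span S = lin_span (f @` S).
Proof.
move=> fL; have f0 : f 0 = 0.
  by rewrite -(addNr 0) -scaleN1r fL scaleN1r addNr.
apply/seteqP; split.
  move=> _ [_ [k [c [v [Sv ->]]]] <-]; exists k, c, (fun i => f (v i)); split.
    by move=> i; exists (v i).
  by elim/big_rec2: _ => [|i x y _ <-] //; rewrite fL.
apply: lin_span_sub.
  have [s0 sD] := lin_span_subspace S; split; first by exists 0.
  move=> c _ _ [u Su <-] [v Sv <-]; exists (c *: u + v); [exact: sD|exact: fL].
by move=> _ [v Sv <-]; exists v => //; exact: sub_lin_span.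
Qed.

(** * Images under the alternation map *)

Section FibreAlternation.
Variables (R : realType) (V : lmodType R) (D : su_data V) (n : nat).
Local Notation C := (R[i]).
Local Notation J := (bool * 'I_n)%type.
Local Notation db i := (dcoord C (false, i)).
Local Notation Psi := (@Psi C n).
Variables (E : J -> V) (HE : sframe D E).
Local Notation Th := (Th D E).
Local Notation rho := (@rho R V D n E).
Local Notation XiT := (@XiT C n).
Implicit Types (A : J -> 'I_n -> 'I_n -> C) (c : 'I_n -> 'I_n -> 'I_n -> C) (u w : 'I_n -> C).
Local Notation skewA A := (forall x j l, A x j l = - A x l j).
Hypothesis n3 : (3 < n)%N.

Let n2_gt0 : (0 < n - 2)%N. Proof. by lia. Qed.
Let n2E : (n - 2).+2 = n. Proof. by lia. Qed.

Lemma rho_wedge_real m f : cj m = m -> rho m ∧ rho f = rho (m ∧ f).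
Proof.
move=> mr; rewrite /rho dec_ewedge -(rc_rho_real D E mr).
apply/funext => s; rewrite /rep !ewedgeE Re_sum; apply: eq_bigr => k _.
by rewrite /rc -real_complex_sign -rmorphM ReZ.
Qed.

Lemma otimes_rho m f : cj m = m -> otimes (rho m) (rho f) = rho (otimes m f).
Proof.
move=> mr; apply/funext => s; rewrite /rho dec_otimes /rep -[lin_subst _ m](rc_rho_real D E mr).
by rewrite /otimes /rc ReZ.
Qed.

Lemma XiTD A B : XiT (fun x j l => A x j l + B x j l) = XiT A + XiT B.
Proof.
apply/funext => -[|x s]; rewrite addTE /= ?addr0 // -addTE -scalerDr; congr ((_ *: _) _).
rewrite -big_split; apply: eq_bigr => j _; rewrite -big_split; apply: eq_bigr => l _.
by rewrite scalerDl.
Qed.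

Lemma XiTZ a A : XiT (fun x j l => a * A x j l) = a *: XiT A.
Proof.
apply/funext => -[|x s]; rewrite scaleTE /= ?mulr0 // -scaleTE scalerA [a * _]mulrC -scalerA.
congr ((_ *: _) _); rewrite scaler_sumr; apply: eq_bigr => j _; rewrite scaler_sumr.
by apply: eq_bigr => l _; rewrite scalerA.
Qed.

Lemma XiT0 : XiT (fun _ _ _ => 0) = 0.
Proof.
have <- : XiT (fun _ _ _ => 0 * 0) = XiT (fun _ _ _ => 0) by rewrite mul0r.
by rewrite (XiTZ 0 (fun _ _ _ => 0)) scale0r.
Qed.

Lemma eq_XiT A B : (forall x j l, A x j l = B x j l) -> XiT A = XiT B.
Proof.
by move=> h; congr XiT; apply/funext => x; apply/funext => j; apply/funext => l.
Qed.

Lemma ty_iz2Psi j l : ty (n - 2) 0 (iz l (iz j Psi)).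
Proof.
have e : (n - 2).+2 = n by lia.
by apply: ty_iz; apply: ty_iz; rewrite e; exact: ty_Psi.
Qed.

Lemma ty_iz3Psi k j l : ty (n - 3) 0 (iz k (iz l (iz j Psi))).
Proof.
by apply: ty_iz; rewrite (_ : (n - 3).+1 = (n - 2)%N); [exact: ty_iz2Psi|lia].
Qed.

Lemma ty_izPsi j : ty (n - 1) 0 (iz j Psi).
Proof. by apply: ty_iz; rewrite (_ : (n - 1).+1 = n); [exact: ty_Psi|lia]. Qed.

Lemma WXi_total_rho t : WXi_total D n t <-> exists2 A, skewA A & t = rho (XiT A).
Proof.
split.
  pose S : set (tensor R V) := [set t | exists2 A, skewA A & t = rho (XiT A)].
  apply: (@lin_span_sub _ _ _ S).
    split; first by exists (fun _ _ _ => 0); rewrite ?XiT0 ?rho0 // => *; rewrite oppr0.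
    move=> c _ _ [A sA ->] [B sB ->]; exists (fun x j l => (c%:C)%C * A x j l + B x j l).
      by move=> x j l; rewrite sA sB opprD mulrN.
    by rewrite (XiTD (fun x j l => (c%:C)%C * A x j l)) XiTZ rhoD rhoZ.
  move=> _ [_ /(form_rho HE)[m [hm _ mr ->]]] [_ [_ /(lam_rho HE _ n2_gt0)[f tf ->] <-] <-].
  have [h fE] := expand_iz2Psi n2E tf.
  (* Neither halved nor of the expected sign: this offsets (2i)^-1 * i^-1 = -1/2, the product of the
     constants of [XiT] and [XiT_om]. *)
  pose H j l := - (h l j - h j l).
  exists (fun x j l => m [:: x] * H j l).
    by move=> x j l; rewrite /H !opprB -mulrN opprB.
  rewrite (om_rho HE) rho_wedge ?cj_om // otimes_rho //; congr rho.
  have HfE : \sum_j \sum_l H j l *: iz l (iz j Psi) = - 2 *: f.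
    rewrite scaleNr scaler_nat mulr2n {1}fE [X in X + _]exchange_big /= fE.
    rewrite -[X in _ = - (_ + X)]opprK.
    have -> : - (\sum_l \sum_j h l j *: iz l (iz j Psi)) = \sum_j \sum_l h j l *: iz l (iz j Psi).
      rewrite -sumrN; apply: eq_bigr => l _; rewrite -sumrN; apply: eq_bigr => j _.
      by rewrite (skew_contractC (true, j) (true, l) (@skew_Psi C n)) scalerN.
    rewrite opprB -sumrB; apply: eq_bigr => j _; rewrite -sumrB; apply: eq_bigr => l _.
    by rewrite -scalerBl /H opprB.
  have [hf _ _] := tf.
  apply/funext => -[|x s]; first by rewrite /otimes /= hm // mul0r.
  rewrite /otimes /= take0 -scaleTE; congr (_ s).
  have -> : \sum_j \sum_l (m [:: x] * H j l) *: (db l ∧ iz j Psi) =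
      m [:: x] *: \sum_j \sum_l H j l *: (db l ∧ iz j Psi).
    rewrite scaler_sumr; apply: eq_bigr => j _; rewrite scaler_sumr; apply: eq_bigr => l _.
    by rewrite scalerA.
  rewrite XiT_om; last by move=> j l; rewrite /H !opprB.
  rewrite HfE (om_comm hf) !ewedgeZr !scalerA; congr (_ *: _).
  have sq := sqrCi C; move: ('i : C) (neq0Ci C) sq => i i0 sq.
  rewrite -[LHS]mul1r -[X in X * _ = _](_ : - (i ^+ 2)^-1 = 1); last by rewrite sq invrN1 opprK.
  by field.
case=> A sA ->; rewrite (tensor_expand HE (rho_multilinear HE _)) //.
apply: subspace_sum; first exact: lin_span_subspace.
move=> x _; apply: sub_lin_span; exists (flat D (E x)).
  rewrite (flat_rho HE); apply: rho_form => //.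
    by apply: hom_sum => i _; apply: homZ; exact: dcoord_hom.
  by apply: skew_sum => i _; apply: skewZ; exact: dcoord_skew.
exists (contract (E x) (rho (XiT A))) => //.
rewrite contract_rho.
exists (rho (\sum_y Th (E x) y *: ((2 * 'i)^-1 *: ('i^-1 *: \sum_j \sum_l A y j l *: iz l (iz j Psi))))).
  apply/(lam_rho HE); first by lia.
  eexists; last by [].
  apply: ty_sum => y _; do 3 apply: tyZ; apply: ty_sum => j _; apply: ty_sum => l _.
  by apply: tyZ; exact: ty_iz2Psi.
rewrite (om_rho HE) rho_wedge ?cj_om //; congr rho; rewrite ewedge_suml.
apply: eq_bigr => y _; rewrite ewedgeZl contract_XiT; congr (_ *: _).
rewrite XiT_om; last by move=> j l; exact: sA.
rewrite ewedgeZl (om_comm (p := n - 2)) //.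
have [] : ty (n - 2) 0 ('i^-1 *: \sum_j \sum_l A y j l *: iz l (iz j Psi)) => //.
apply: tyZ; apply: ty_sum => j _; apply: ty_sum => l _.
by apply: tyZ; exact: ty_iz2Psi.
Qed.

End FibreAlternation.

Section FibreImages.
Variables (R : realType) (V : lmodType R) (D : su_data V) (n : nat).
Local Notation C := (R[i]).
Local Notation J := (bool * 'I_n)%type.
Local Notation g := (met D).
Local Notation db i := (dcoord C (false, i)).
Local Notation Psi := (@Psi C n).
Local Notation omJ := (@omJ C n).
Local Notation psiJ := (@psiJ C n).
Variables (E : J -> V) (HE : sframe D E).
Local Notation rho := (@rho R V D n E).
Local Notation XiT := (@XiT C n).
Local Notation Qf := (@Qf C n).
Local Notation Pf := (@Pf C n).
Implicit Types (A : J -> 'I_n -> 'I_n -> C) (c : 'I_n -> 'I_n -> 'I_n -> C) (u w : 'I_n -> C).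
Local Notation skewA A := (forall x j l, A x j l = - A x l j).
Hypothesis n3 : (3 < n)%N.
Variable e : 'I_(n.*2) -> V.
Hypothesis parseval : forall X Y, \sum_i g X (e i) * g Y (e i) = g X Y.

Let n1E : (n - 1).+1 = n. Proof. by lia. Qed.
Let n2_gt0 : (0 < n - 2)%N. Proof. by lia. Qed.
Let n2E : (n - 2).+2 = n. Proof. by lia. Qed.
Let n1_gt0 : (0 < n - 1)%N. Proof. by lia. Qed.

(** The coefficients of the Q part in [alt_XiT]. [Qf] takes the contracted index last, so the two
    form indices of [B] change places. *)
Definition cB (B : 'I_n -> 'I_n -> 'I_n -> C) m l j : C := (2 * 'i)^-1 * B m j l.
Definition uC (B : 'I_n -> 'I_n -> 'I_n -> C) l : C := - (2 * 'i)^-1 * \sum_j B j j l.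

Lemma alt_rho_XiT A : alt (rho (XiT A)) =
  rho (Qf (cB (fun m => A (false, m))) + Pf (uC (fun m => A (true, m)))).
Proof. by rewrite alt_rho alt_XiT. Qed.

Lemma alt_WXi_total t : WXi_total D n t -> Wa D n (alt t).
Proof.
move=> Wt; have : (alt @` WXi_total D n) (alt t) by exists t.
rewrite image_lin_span; last by move=> c u v; rewrite altD altZ.
move=> [k [c [v [Sv ->]]]].
have /boolp.choice [z zP] : forall i, exists z, wedge_space (kforms 1%N) (lam D (n - 2)%N) z
    /\ v i = z ∧ kahler D.
  move=> i; have [_ [mu kmu [_ [b lb <-] <-]] <-] := Sv i.
  exists (mu ∧ b); split; first by apply: sub_lin_span; exists mu => //; exists b.
  by case: kmu => hm _ _; rewrite alt_otimes // ewedgeA.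
exists (\sum_i c i *: z i).
  have [s0 sD] := lin_span_subspace [set a ∧ b | a in @kforms R V 1%N & b in lam D (n - 2)%N].
  apply: (@big_ind _ (fun x => wedge_space (kforms 1%N) (lam D (n - 2)%N) x)) => //.
    by move=> x y; exact: subspaceD (lin_span_subspace _).
  by move=> i _; rewrite -[_ *: _]addr0; apply: sD => //; case: (zP i).
rewrite ewedge_suml; apply: eq_bigr => i _; rewrite ewedgeZl.
by case: (zP i) => _ ->.
Qed.

(** A preimage under alternation is given: the Koszul array in barred directions for Q c, a pure
    trace array in holomorphic ones for P u. *)
Lemma QP_rho_Wa c u : Wa D n (rho (Qf c + Pf u)).
Proof.
(* The trace of [A4 w] is (n - 1) w and alternation multiplies it by -(2i)^-1; w inverts both
   factors. *)
pose w l := - u l * (2 * 'i) / (n - 1)%:R.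
pose A x := if x.1 then A4 w x else koszul c x.2.
have sA : skewA A.
  move=> [[] m] j l; rewrite /A; [exact: A4_skew|exact: koszul_skew].
have -> : rho (Qf c + Pf u) = alt (rho (XiT A)).
  rewrite alt_rho_XiT -(Qf_koszul c); congr (rho (_ + _)); apply: eq_Pf => l.
  rewrite /uC /A /A4 /=.
  have -> : \sum_j ((j == j)%:R * w l - (j == l)%:R * w j) = (n - 1)%:R * w l.
    rewrite sumrB; under eq_bigr do rewrite eqxx mul1r.
    rewrite sumr_const card_ord (bigD1 l) //= eqxx mul1r big1 ?addr0; last first.
      by move=> j /negPf ->; rewrite mul0r.
    by rewrite natrB ?(leq_trans _ n3) // mulrBl mul1r mulr_natl.
  rewrite /w; field; rewrite neq0Ci pnatr_eq0.
  by rewrite -lt0n n1_gt0.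
apply: alt_WXi_total; apply/(WXi_total_rho HE n3).
by exists A.
Qed.

Lemma Wa_rho b : Wa D n b <-> exists c u, b = rho (Qf c + Pf u).
Proof.
split=> [|[c [u ->]]]; last exact: QP_rho_Wa.
pose S : set (tensor R V) := [set z | exists c u, z ∧ kahler D = rho (Qf c + Pf u)].
case=> z zW <-; suff : S z by [].
apply: (@lin_span_sub _ _ _ S) zW.
  split.
    exists (fun _ _ _ => 0 * 0), (fun _ => 0 * 0).
    by rewrite ewedge0l (QfZ 0 (fun _ _ _ => 0)) (PfZ 0 (fun _ => 0)) !scale0r addr0 rho0.
  move=> a x y [c [u xE]] [d [v yE]].
  exists (fun m l j => (a%:C)%C * c m l j + d m l j), (fun l => (a%:C)%C * u l + v l).
  rewrite ewedgeDl ewedgeZl xE yE -rhoZ -rhoD; congr rho.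
  rewrite (QfD (fun m l j => (a%:C)%C * c m l j)) QfZ (PfD (fun l => (a%:C)%C * u l)) PfZ.
  by rewrite scalerDr addrACA.
move=> _ [_ /(form_rho HE)[m [hm sm mr ->]]] [_ /(lam_rho HE _ n2_gt0)[f tf ->] <-].
rewrite /S /= rho_wedge_real // (om_rho HE) rho_wedge ?cj_om // -ewedgeA.
(* Against f /\ om, of type (n - 1, 1), the (1, 0) part of m yields a form P u and the (0, 1) part a
   form Q c. *)
have mE : m = part 0 m + part 1 m.
  apply/funext => s; rewrite addTE /part; have [s1|s1] := eqVneq (size s) 1%N; last first.
    by rewrite hm // !if_same addr0.
  by case: s s1 => [|[[] i] [|y s]] //=; rewrite ?addr0 ?add0r.
have tfo : ty n 1 (f ∧ omJ).
  by have := ty_ewedge tf (ty_omJ C n); rewrite add0n addn2 n2E.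
rewrite mE ewedgeDl.
have t1 := ty_ewedge (ty_part 0 hm sm) tfo; have t2 := ty_ewedge (ty_part 1 hm sm) tfo.
eexists; eexists; rewrite addrC; congr (rho (_ + _)).
  exact: (expand_Qf n1E t2).
exact: (expand_Pf t1).
Qed.

Lemma hom1_real (m : 'I_n -> C) : exists f : tensor C J,
  [/\ hom 1 f, skew f, cj f = f & forall l, f [:: (false, l)] = m l].
Proof.
pose h := \sum_l m l *: db l.
have hh : hom 1 h by apply: hom_sum => l _; apply: homZ; exact: dcoord_hom.
have sh : skew h by apply: skew_sum => l _; apply: skewZ; exact: dcoord_skew.
have hE b l : h [:: (b, l)] = if b then 0 else m l.
  rewrite /h fct_sumE; under eq_bigr do rewrite scaleTE /dcoord eqseq_cons andbT xpair_eqE.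
  case: b => /=; first by rewrite big1 // => k _; rewrite mulr0.
  by rewrite (bigD1 l) //= eqxx mulr1 big1 ?addr0 // => k /negPf; rewrite eq_sym => ->; rewrite mulr0.
exists (h + cj h); split.
- by apply: homD => //; exact: cj_hom.
- by apply: skewD => //; exact: cj_skew.
- by rewrite cjD cjK addrC.
- by move=> l; rewrite addTE hE /cj /= hE rmorph0 addr0.
Qed.

(** The product is P of a m plus its conjugate; both have the same real part, whence the factor
    2. *)
Lemma wedge_psiJ m a : hom 1 m -> cj m = m ->
  rho m ∧ rho (psiJ a) = rho (Pf (fun l => 2 * a * m [:: (false, l)])).
Proof.
move=> hm mr; rewrite rho_wedge ?psiJ_real //.
pose F := Pf (fun l => a * m [:: (false, l)]).
have -> : m ∧ psiJ a = F + cj F.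
  have {1}-> : m = \sum_x m [:: x] *: dcoord C x.
    apply/funext => s; rewrite fct_sumE; case: s => [|x [|y s]].
    - by rewrite hm // big1 // => x _; rewrite scaleTE /dcoord mulr0.
    - rewrite (bigD1 x) //= scaleTE /dcoord eqxx mulr1 big1 ?addr0 // => y yx.
      by rewrite scaleTE eqseq_cons eq_sym (negPf yx) mulr0.
    - by rewrite hm // big1 // => z _; rewrite scaleTE /dcoord eqseq_cons andbF mulr0.
  rewrite ewedge_suml sumJ addrC; congr (_ + _).
    by apply: eq_bigr => l _; rewrite ewedgeZl db_psiJ scalerA mulrC.
  rewrite cj_sum; apply: eq_bigr => l _.
  rewrite ewedgeZl dz_psiJ scalerA cjZ cj_ewedge cj_dcoord rmorphM mulrC; congr (_ * _ *: _).
  by rewrite -[in LHS]mr.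
rewrite rhoD rho_cj -rhoD -mulr2n -scaler_nat -PfZ; congr rho.
by apply: eq_Pf => l; rewrite mulrA.
Qed.

(** The sign enters only through the nonzero constant [av], which the one-form absorbs; so the
    description is the same for psi_+ and psi_-. *)
Lemma W45a_rho eps b : W45a D eps b <-> exists u, b = rho (Pf u).
Proof.
split=> [|[u ->]].
  pose S : set (tensor R V) := [set z | exists u, z = rho (Pf u)].
  apply: (@lin_span_sub _ _ _ S).
    split; first by exists (fun _ => 0 * 0); rewrite (PfZ 0 (fun _ => 0)) scale0r rho0.
    move=> a _ _ [u ->] [v ->]; exists (fun l => (a%:C)%C * u l + v l).
    by rewrite (PfD (fun l => (a%:C)%C * u l)) PfZ rhoD rhoZ.
  move=> _ [_ /(form_rho HE)[m [hm sm mr ->]]] [_ -> <-].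
  rewrite (psi_rho HE) wedge_psiJ //; by eexists.
have [m [hm sm mr mE]] := hom1_real (fun l => u l / (2 * av R eps)).
have -> : rho (Pf u) = rho m ∧ psi D eps.
  rewrite (psi_rho HE) wedge_psiJ //; congr rho; apply: eq_Pf => l.
  by rewrite mE; field; rewrite av_neq0.
apply: sub_lin_span; exists (rho m); first exact: rho_form.
by exists (psi D eps).
Qed.

Lemma lam_wedge_om_rho b : lam_wedge_om D (n - 1)%N b <-> exists u, b = rho (Pf u).
Proof.
have k0 : 'i / 2 != 0 :> C by rewrite mulf_neq0 ?neq0Ci // invr_eq0 pnatr_eq0.
have oP (h : 'I_n -> C) : rho (\sum_j h j *: iz j Psi) ∧ kahler D = rho (Pf (fun j => 'i / 2 * h j)).
  rewrite (om_rho HE) rho_wedge ?cj_om //; congr rho.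
  have [hf _ _] : ty (n - 1) 0 (\sum_j h j *: iz j Psi).
    by apply: ty_sum => j _; apply: tyZ; apply: ty_izPsi.
  rewrite (om_comm hf) ewedge_sumr; apply: eq_bigr => j _.
  by rewrite ewedgeZr om_izPsi scalerA mulrC.
split=> [[_ /(lam_rho HE _ n1_gt0)[f tf ->] <-]|[u ->]].
  by rewrite (expand_izPsi n1E tf) oP; eexists.
exists (rho (\sum_j (u j / ('i / 2)) *: iz j Psi)).
  apply/(lam_rho HE _ n1_gt0); eexists; last by [].
  by apply: ty_sum => j _; apply: tyZ; apply: ty_izPsi.
rewrite oP; congr rho; apply: eq_Pf => j.
by rewrite mulrC divfK.
Qed.

End FibreImages.

(** * The modules W1a and W2a in components *)

Section FibreComponents.
Variables (R : realType) (V : lmodType R) (D : su_data V) (n : nat).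
Local Notation C := (R[i]).
Local Notation J := (bool * 'I_n)%type.
Local Notation g := (met D).
Local Notation db i := (dcoord C (false, i)).
Local Notation Psi := (@Psi C n).
Local Notation omJ := (@omJ C n).
Variables (E : J -> V) (HE : sframe D E).
Local Notation rho := (@rho R V D n E).
Local Notation Qf := (@Qf C n).
Local Notation Pf := (@Pf C n).
Implicit Types (A : J -> 'I_n -> 'I_n -> C) (c : 'I_n -> 'I_n -> 'I_n -> C) (u w : 'I_n -> C).
Hypothesis n3 : (3 < n)%N.
Variable e : 'I_(n.*2) -> V.
Hypothesis parseval : forall X Y, \sum_i g X (e i) * g Y (e i) = g X Y.

Let n1E : (n - 1).+1 = n. Proof. by lia. Qed.
Let n3_gt0 : (0 < n - 3)%N. Proof. by lia. Qed.
Let n3E : (n - 3).+3 = n. Proof. by lia. Qed.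
Let n1_gt0 : (0 < n - 1)%N. Proof. by lia. Qed.

Local Notation cB := (@cB R n).

(** By [om2_iz3Psi] multiplication by om^2 replaces a coefficient array by its sum over rotations,
    so only totally skew arrays matter. *)
Lemma W1a_rho b : W1a D n b <-> exists2 B : 'I_n -> 'I_n -> 'I_n -> C,
  (forall m j l, B m j l = - B m l j) /\ (forall m j l, B m j l = - B j m l) &
  b = rho (Qf (cB B)).
Proof.
pose k2 : C := 'i / 2 * ('i / 2) *+ 2.
have k20 : k2 != 0.
  by rewrite /k2 -mulr_natl !mulf_neq0 ?neq0Ci ?invr_eq0 ?pnatr_eq0.
have oQ (h : 'I_n -> 'I_n -> 'I_n -> C) :
    (rho (\sum_k \sum_l \sum_j h k l j *: iz k (iz l (iz j Psi))) ∧ kahler D) ∧ kahler D =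
    rho (Qf (fun k l j => k2 * (h k l j + h j k l + h l j k))).
  rewrite (om_rho HE) !rho_wedge ?cj_om //; congr rho.
  set f := \sum_k _.
  have [hf _ _] : ty (n - 3) 0 f.
    apply: ty_sum => k _; apply: ty_sum => l _; apply: ty_sum => j _; apply: tyZ.
    exact: ty_iz3Psi.
  have hf2 : hom (2 + (n - 3))%N (omJ ∧ f) by apply: ewedge_hom => //; case: (ty_omJ C n).
  rewrite (om_comm hf) (om_comm hf2) /f.
  pose T k l j : tensor C J := db k ∧ (db l ∧ iz j Psi).
  transitivity (\sum_k \sum_l \sum_j (k2 * h k l j) *: (T k l j + T l j k + T j k l)).
    rewrite !ewedge_sumr; apply: eq_bigr => k _; rewrite !ewedge_sumr; apply: eq_bigr => l _.
    rewrite !ewedge_sumr; apply: eq_bigr => j _.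
    by rewrite !ewedgeZr om2_iz3Psi scalerA mulrC.
  have rot (F : 'I_n -> 'I_n -> 'I_n -> tensor C J) :
     \sum_k \sum_l \sum_j F k l j = \sum_k \sum_l \sum_j F j k l.
    rewrite [RHS](eq_bigr (fun k => \sum_j \sum_l F j k l)); last by move=> k _; rewrite exchange_big.
    by rewrite [RHS]exchange_big; apply: eq_bigr => j _.
  under eq_bigr do under eq_bigr do under eq_bigr do rewrite !scalerDr.
  under eq_bigr do under eq_bigr do rewrite !big_split.
  under eq_bigr do rewrite !big_split.
  rewrite !big_split /=.
  rewrite [X in _ + X + _ = _]rot [X in _ + _ + X = _]rot [X in _ + _ + X = _]rot.
  rewrite -!big_split; apply: eq_bigr => k _; rewrite -!big_split; apply: eq_bigr => l _.
  rewrite -!big_split; apply: eq_bigr => j _ /=.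
  by rewrite !mulrDr !scalerDl.
split.
  case=> _ /(lam_rho HE _ n3_gt0)[f tf ->] <-.
  have [h ->] := expand_iz3Psi n3E tf; rewrite oQ.
  pose c k l j := k2 * (h k l j + h j k l + h l j k).
  (* c is invariant under rotation, so its part skew in two indices is totally skew. *)
  have Qc : Qf c = Qf (fun m l j => 2^-1 * (c m l j - c l m j)).
    by rewrite (QfZ 2^-1 (fun m l j => c m l j - c l m j)) Qf_skew -[Qf c *+ 2]scaler_nat scalerA mulVf ?scale1r ?pnatr_eq0.
  exists (fun m j l => 'i * (c m l j - c l m j)).
    by split=> m j l; rewrite /c; ring.
  rewrite -/c Qc; congr rho; apply: eq_Qf => m l j; rewrite /cB.
  move: (c m l j) (c l m j) ('i : C) (neq0Ci C) => x y i i0.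
  by field; exact: i0.
case=> B [B1 B2] ->.
(* For totally skew B the three rotations coincide, hence 3; [k2] is the constant of
   [om2_iz3Psi]. *)
pose h k l j := cB B k l j / (3 * k2).
exists (rho (\sum_k \sum_l \sum_j h k l j *: iz k (iz l (iz j Psi)))).
  apply/(lam_rho HE _ n3_gt0); eexists; last by [].
  apply: ty_sum => k _; apply: ty_sum => l _; apply: ty_sum => j _; apply: tyZ.
  exact: ty_iz3Psi.
rewrite oQ; congr rho; apply: eq_Qf => k l j; rewrite /h /cB.
rewrite (B2 j l k) (B1 l j k) opprK (B1 l k j) (B2 l j k) opprK (B1 j l k) (B2 j k l) opprK.
rewrite (B1 k j l).
clear oQ h; move: (B k l j) ((2 * 'i)^-1) => x y; clearbody k2; move: k2 k20 => w w0.
by field; exact: w0.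
Qed.

Lemma cj_starJ k (f nu : tensor C J) : cj (starJ k f nu) = starJ k (cj f) (cj nu).
Proof.
rewrite /starJ cj_sum.
rewrite (reindex (fun y : k.-tuple J => [tuple of map (@barJ n) y])) /=; last first.
  exists (fun y : k.-tuple J => [tuple of map (@barJ n) y]) => y _;
  by apply/val_inj; rewrite /= -map_comp (eq_map (@barJK n)) map_id.
apply: eq_bigr => y _; rewrite cjZ; congr (_ *: _).
apply/funext => s; rewrite /cj /conl map_cat -map_comp.
by rewrite (eq_map (@barJK n)) map_id.
Qed.

Lemma starJZ k (a : C) (f nu : tensor C J) : starJ k (a *: f) nu = a *: starJ k f nu.
Proof. by rewrite scaler_sumr; apply: eq_bigr => y _; rewrite scaleTE scalerA. Qed.

(** The star, psi and the symmetrized form have real components, so [rho] loses nothing and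
    [star_psi_eq0] applies with om^n as top form. *)
Lemma star_psi_rho c u eps :
  star D e n.+1 (rho (Qf c + Pf u)) ∧ psi D eps = 0 <-> Pf u = 0.
Proof.
pose F := Qf c + Pf u; pose f := F + cj F.
have fr : cj f = f by rewrite /f cjD cjK addrC.
have hr : cj (2^-1 *: f) = 2^-1 *: f by rewrite cjZ fr fmorphV rmorph_nat.
have [hn sn] := @omk_hom C n n.
rewrite -(star_psi_eq0 c u (av_neq0 R eps) n3 sn hn (@omk_neq0 C n)) -/F -/f.
rewrite [rho _]rho_real -/f.
have [a a0 ->] := star_rho HE parseval n.+1 hr.
rewrite starJZ ewedgeZl (psi_rho HE) rho_wedge ?psiJ_real // ewedgeZl.
set G := _ ∧ _; have Gr : cj G = G.
  by rewrite /G cj_ewedge cj_starJ fr cj_omk psiJ_real.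
split=> [|->]; last by rewrite scaler0 rho0 scaler0.
move/eqP; rewrite scaler_eq0 (negPf a0) => /eqP/(rho_eq0 HE).
rewrite cjZ Gr fmorphV rmorph_nat -scalerDl (_ : 2^-1 + 2^-1 = 1 :> C) ?scale1r //.
by field.
Qed.

(** The star condition removes P u for either sign. What remains is represented by its Koszul array,
    on which b /\ om = 0 says that the cyclic sum vanishes. *)
Lemma W2a_rho eps b : W2a D e eps b <-> exists2 B : 'I_n -> 'I_n -> 'I_n -> C,
  (forall m j l, B m j l = - B m l j) /\ (forall m j l, B m j l + B j l m + B l m j = 0) &
  b = rho (Qf (cB B)).
Proof.
have k0 : 'i / 2 != 0 :> C by rewrite mulf_neq0 ?neq0Ci // invr_eq0 pnatr_eq0.
have oQ c u : rho (Qf c + Pf u) ∧ kahler D = rho (('i / 2) *: Rf c).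
  have [hQ _ _] := ty_Qf (C := C) c n1E; have [hP _ _] := ty_Pf (C := C) u.
  rewrite (om_rho HE) rho_wedge ?cj_om // (om_comm (homD hQ hP)) ewedgeDr om_Pf addr0.
  by rewrite om_Qf.
have P0 : Pf (fun _ => 0) = 0 by apply: big1 => l _; rewrite scale0r.
split=> [[/(Wa_rho HE n3)[c [u ->]] ob /star_psi_rho u0]|[B [B1 B2] ->]].
  pose B := koszul c.
  have QB : Qf (cB B) = Qf c by exact: Qf_koszul.
  have B1 m j l : B m j l = - B m l j by exact: koszul_skew.
  exists B; last by rewrite u0 addr0 QB.
  split=> // m j l.
  move: ob; rewrite -QB oQ => /(rho_eq0 HE) R0.
  have tR : ty n.+3 3 (('i / 2) *: Rf (cB B)) by apply: tyZ; exact: ty_Rf.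
  have tR' : ty n.+3 n (cj (('i / 2) *: Rf (cB B))) by apply: ty_cj tR; rewrite add3n.
  (* The form and its conjugate have 3 and n antiholomorphic factors, which differ since n > 3. *)
  have := ty_disjoint tR tR' _ R0; rewrite ltn_eqF // => /(_ isT)/eqP.
  rewrite scaler_eq0 (negPf k0) => /eqP/Rf_eq0 cyc.
  have := cyc _ m l j; rewrite /cB -!mulrDr => /(_ _)/eqP.
  have i20 : (2 * 'i)^-1 != 0 :> C by rewrite invr_eq0 mulf_neq0 ?neq0Ci ?pnatr_eq0.
  rewrite mulf_eq0 (negPf i20) /= => e0; apply/eqP.
  rewrite addrAC; apply: e0 => m' l' j'.
  by rewrite B1 mulrN.
have QE : Qf (cB B) = Qf (cB B) + Pf (fun _ => 0) by rewrite P0 addr0.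
split; first by apply/(Wa_rho HE n3); exists (cB B), (fun _ => 0); rewrite -QE.
  rewrite QE oQ Rf_cyclic ?scaler0 ?rho0 // => m l j.
  rewrite /cB -!mulrDr -[X in _ * X](_ : B m j l + B j l m + B l m j = _) ?B2 ?mulr0 //.
  by rewrite addrAC.
by rewrite QE; apply/star_psi_rho.
Qed.

End FibreComponents.

Section DirectSums.
Variables (R : nzRingType) (W : lmodType R).

Lemma direct_sum3 (A B F S : set W) :
  (forall w, S w <-> exists a b f, [/\ A a, B b, F f & w = a + b + f]) ->
  (forall a b f, A a -> B b -> F f -> a + b + f = 0 -> [/\ a = 0, b = 0 & f = 0]) ->
  is_direct_sum [:: A; B; F] S.
Proof.
move=> SE inj; split.
  apply/seteqP; split=> [w /SE[a [b [f [Aa Bb Ff ->]]]]|w [u [uP ->]]].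
    exists (fun i : 'I_3 => nth 0 [:: a; b; f] i); split.
      by move=> -[[|[|[|k]]] //= ki].
    by rewrite !big_ord_recl big_ord0 /= addr0 addrA.
  apply/SE; exists (u ord0), (u (lift ord0 ord0)), (u (lift ord0 (lift ord0 ord0))).
  split; [exact: (uP ord0)|exact: (uP (lift ord0 ord0))|exact: (uP (lift ord0 (lift ord0 ord0)))|].
  by rewrite !big_ord_recl big_ord0 addr0 addrA.
move=> u uP; rewrite !big_ord_recl big_ord0 addr0 addrA => u0.
have [e0 e1 e2] := inj _ _ _ (uP ord0) (uP (lift ord0 ord0)) (uP (lift ord0 (lift ord0 ord0))) u0.
move=> [[|[|[|k]]] ki]; last by [].
- by rewrite -[RHS]e0; congr u; exact: val_inj.
- by rewrite -[RHS]e1; congr u; exact: val_inj.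
- by rewrite -[RHS]e2; congr u; exact: val_inj.
Qed.

Lemma direct_sum2 (A B S : set W) :
  (forall w, S w <-> exists a b, [/\ A a, B b & w = a + b]) ->
  (forall a b, A a -> B b -> a + b = 0 -> a = 0 /\ b = 0) ->
  is_direct_sum [:: A; B] S.
Proof.
move=> SE inj; split.
  apply/seteqP; split=> [w /SE[a [b [Aa Bb ->]]]|w [u [uP ->]]].
    exists (fun i : 'I_2 => nth 0 [:: a; b] i); split.
      by move=> -[[|[|k]] //= ki].
    by rewrite !big_ord_recl big_ord0 /= addr0.
  apply/SE; exists (u ord0), (u (lift ord0 ord0)).
  split; [exact: (uP ord0)|exact: (uP (lift ord0 ord0))|].
  by rewrite !big_ord_recl big_ord0 addr0.
move=> u uP; rewrite !big_ord_recl big_ord0 addr0 => u0.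
have [e0 e1] := inj _ _ (uP ord0) (uP (lift ord0 ord0)) u0.
move=> [[|[|k]] ki]; last by [].
- by rewrite -[RHS]e0; congr u; exact: val_inj.
- by rewrite -[RHS]e1; congr u; exact: val_inj.
Qed.

End DirectSums.

(** * Alternation of the images of the W_i, and the decomposition of Wa *)

Section FibreDecomposition.
Variables (R : realType) (V : lmodType R) (D : su_data V) (n : nat).
Local Notation C := (R[i]).
Local Notation J := (bool * 'I_n)%type.
Local Notation g := (met D).
Variables (E : J -> V) (HE : sframe D E).
Local Notation rho := (@rho R V D n E).
Local Notation XiT := (@XiT C n).
Local Notation Qf := (@Qf C n).
Local Notation Pf := (@Pf C n).
Implicit Types (A : J -> 'I_n -> 'I_n -> C) (c : 'I_n -> 'I_n -> 'I_n -> C) (u w : 'I_n -> C).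
Hypothesis n3 : (3 < n)%N.
Variable e : 'I_(n.*2) -> V.
Hypothesis parseval : forall X Y, \sum_i g X (e i) * g Y (e i) = g X Y.

Let n1_gt0 : (0 < n - 1)%N. Proof. by lia. Qed.

Local Notation cB := (@cB R n).
Local Notation uC := (@uC R n).

(** Three skew and three symmetric exchanges in alternation return to the starting order with sign
    -1, as in the uniqueness of the Levi-Civita connection. *)
Lemma skew12_sym13_eq0 (B : 'I_n -> 'I_n -> 'I_n -> C) :
  (forall m j l, B m j l = - B m l j) -> (forall m j l, B m j l = B l j m) ->
  forall m j l, B m j l = 0.
Proof.
move=> sk sy m j l; have e1 : B m j l = - B m j l.
  by rewrite {1}(sk m j l) (sy m l j) (sk j l m) opprK (sy j m l) (sk l m j) (sy l j m).
by apply/eqP; move/eqP: e1; rewrite -addr_eq0 -mulr2n mulrn_eq0.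
Qed.

Lemma Qf_cB_inj (B : 'I_n -> 'I_n -> 'I_n -> C) :
  (forall m j l, B m j l = - B m l j) -> Qf (cB B) = 0 -> forall m j l, B m j l = 0.
Proof.
move=> sk /Qf_eq0 e0; apply: skew12_sym13_eq0 => // m j l.
have i20 : (2 * 'i)^-1 != 0 :> C by rewrite invr_eq0 mulf_neq0 ?neq0Ci ?pnatr_eq0.
exact: (mulfI i20 (e0 m l j)).
Qed.

Lemma cBD (B B' : 'I_n -> 'I_n -> 'I_n -> C) :
  Qf (cB (fun m j l => B m j l + B' m j l)) = Qf (cB B) + Qf (cB B').
Proof. by rewrite -QfD; apply: eq_Qf => m l j; rewrite /cB mulrDr. Qed.

Lemma Qf0 : Qf (cB (fun _ _ _ => 0)) = 0.
Proof.
by apply: big1 => m _; apply: big1 => l _; apply: big1 => j _; rewrite /cB mulr0 scale0r.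
Qed.

Lemma Pf0 u : (forall l, u l = 0) -> Pf u = 0.
Proof. by move=> u0; apply: big1 => l _; rewrite u0 scale0r. Qed.

Lemma uC0 : Pf (uC (fun _ _ _ => 0)) = 0.
Proof. by apply: Pf0 => l; rewrite /uC big1 // mulr0. Qed.

Lemma uC_A4 w l : uC (fun m => A4 w (true, m)) l = - (2 * 'i)^-1 * ((n - 1)%:R * w l).
Proof.
rewrite /uC /A4 /=; congr (_ * _).
rewrite sumrB; under eq_bigr do rewrite eqxx mul1r.
rewrite sumr_const card_ord (bigD1 l) //= eqxx mul1r big1 ?addr0; last first.
  by move=> j /negPf ->; rewrite mul0r.
by rewrite natrB ?(leq_trans _ n3) // mulrBl mul1r mulr_natl.
Qed.

Let nR0 : (n - 1)%:R != 0 :> C. Proof. by rewrite pnatr_eq0 -lt0n. Qed.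
Let i20 : (2 * 'i)^-1 != 0 :> C.
Proof. by rewrite invr_eq0 mulf_neq0 ?neq0Ci ?pnatr_eq0. Qed.

Lemma alt_Xi_B (B : 'I_n -> 'I_n -> 'I_n -> C) :
  alt (rho (XiT (fun x => if x.1 then fun _ _ => 0 else B x.2))) = rho (Qf (cB B)).
Proof. by rewrite alt_rho_XiT uC0 addr0. Qed.

Lemma alt_WXi_W1 : alt @` WXi D e (W1 D) = W1a D n.
Proof.
apply/seteqP; split=> [_ [_ [a /(W1_rho HE)[B HB ->] <-] <-]|b /(W1a_rho HE n3)[B HB ->]].
  by rewrite (Xi_rho HE parseval) alt_Xi_B; apply/(W1a_rho HE n3); exists B.
rewrite -alt_Xi_B -(Xi_rho HE parseval); eexists; last by []; eexists; last by [].
by apply/(W1_rho HE); exists B.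
Qed.

Lemma alt_WXi_W2 : alt @` WXi D e (W2 D) = W2a D e true.
Proof.
apply/seteqP; split=> [_ [_ [a /(W2_rho HE)[B HB ->] <-] <-]|b /(W2a_rho HE n3 parseval)[B HB ->]].
  by rewrite (Xi_rho HE parseval) alt_Xi_B; apply/(W2a_rho HE n3 parseval); exists B.
rewrite -alt_Xi_B -(Xi_rho HE parseval); eexists; last by []; eexists; last by [].
by apply/(W2_rho HE); exists B.
Qed.

Lemma alt_Xi_A4 w : alt (rho (XiT (A4 w))) = rho (Pf (fun l => - (2 * 'i)^-1 * ((n - 1)%:R * w l))).
Proof. by rewrite alt_rho_XiT Qf0 add0r; congr rho; apply: eq_Pf => l; rewrite uC_A4. Qed.

Lemma W4_rho a : W4 D e a <-> exists w, a = rho (tJ (A4 w)).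
Proof.
split=> [[mu /(form_rho HE)[m [hm sm mr ->]] <-]|[w ->]].
  by rewrite -/(W4form D e (rho m)) (W4form_rho HE parseval) //; eexists.
have [m [hm sm mr mE]] := hom1_real (fun l => w l / 2).
exists (rho m); first exact: rho_form.
rewrite -/(W4form D e (rho m)) (W4form_rho HE parseval) //.
by congr (rho (tJ (A4 _))); apply/funext => l; rewrite mE mulrC divfK ?pnatr_eq0 //.
Qed.

Lemma alt_WXi_W4 : alt @` WXi D e (W4 D e) = W45a D true.
Proof.
apply/seteqP; split=> [_ [_ [a /W4_rho[w ->] <-] <-]|b /(W45a_rho HE)[u ->]].
  by rewrite (Xi_rho HE parseval) alt_Xi_A4; apply/(W45a_rho HE); eexists.
pose w l := - (2 * 'i) * u l / (n - 1)%:R.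
have -> : rho (Pf u) = alt (rho (XiT (A4 w))).
  rewrite alt_Xi_A4; congr rho; apply: eq_Pf => l; rewrite /w.
  move: i20 nR0; rewrite invr_eq0; move: (2 * 'i) ((n - 1)%:R : C) (u l) => x y z x0 y0.
  by field; rewrite x0 y0.
rewrite -(Xi_rho HE parseval); eexists; last by []; eexists; last by [].
by apply/W4_rho; exists w.
Qed.

Lemma alt_W5 eps : alt @` W5 D eps = W45a D true.
Proof.
have -> : alt @` W5 D eps = W45a D eps.
  rewrite /W5 /tensor_space image_lin_span; last by move=> c x y; rewrite altD altZ.
  rewrite /W45a /wedge_space; congr lin_span; apply/seteqP; split.
    move=> _ [_ [mu kmu [_ -> <-]] <-]; exists mu => //; exists (psi D eps) => //.
    by case: kmu => hm _ _; rewrite alt_otimes.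
  move=> _ [mu kmu [_ -> <-]]; exists (otimes mu (psi D eps)).
    by exists mu => //; exists (psi D eps).
  by case: kmu => hm _ _; rewrite alt_otimes.
by apply/seteqP; split=> b /(W45a_rho HE) ?; apply/(W45a_rho HE).
Qed.

Lemma Wa_direct_sum : is_direct_sum [:: W1a D n; W2a D e true; W45a D true] (Wa D n).
Proof.
apply: direct_sum3 => [w|a b f].
  split=> [/(Wa_rho HE n3)[c [u ->]]|[a [b [f [/(W1a_rho HE n3)[B _ ->]
       /(W2a_rho HE n3 parseval)[B' _ ->] /(W45a_rho HE)[u ->] ->]]]]]; last first.
    by rewrite -!rhoD -cBD; apply/(Wa_rho HE n3); eexists; eexists.
  (* B is skew in its last two indices, so its cyclic mean S is the totally skew projection and B -
     S has cyclic sum zero. *)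
  pose B := koszul c; pose S m j l := 3^-1 * (B m j l + B j l m + B l m j).
  have Bsk m j l : B m j l = - B m l j by exact: koszul_skew.
  have Ssk m j l : S m j l = - S m l j.
    by rewrite /S (Bsk m l j) (Bsk l j m) (Bsk j m l); ring.
  have Scyc m j l : S m j l = S j l m by rewrite /S; ring.
  exists (rho (Qf (cB S))), (rho (Qf (cB (fun m j l => B m j l + - S m j l)))), (rho (Pf u)).
  split; [apply/(W1a_rho HE n3); exists S|apply/(W2a_rho HE n3 parseval)|apply/(W45a_rho HE)|] => //.
  - by split=> // m j l; rewrite Scyc Ssk -Scyc Scyc Scyc.
  - exists (fun m j l => B m j l + - S m j l) => //; split=> m j l.
      by rewrite Bsk Ssk opprD.
    rewrite -(Scyc m) -(Scyc l) /S.
    have h3 : (3 : C) != 0 by rewrite pnatr_eq0.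
    move: (B m j l) (B j l m) (B l m j) => x y z.
    by field.
  - by exists u.
  - rewrite -rhoD -cBD -rhoD -(Qf_koszul c); congr (rho (_ + _)); apply: eq_Qf => m l j.
    by rewrite /cB addrC subrK.
move=> /(W1a_rho HE n3)[B [B1 B2] ->] /(W2a_rho HE n3 parseval)[B' [B1' B2'] ->] /(W45a_rho HE)[u ->].
rewrite -rhoD -cBD -rhoD => /(rho_eq0 HE)/(QPf_real_eq0 n3)[Q0 P0].
have S0 := Qf_cB_inj _ Q0.
have S1 m j l : B m j l + B' m j l = 0 by apply: S0 => m' j' l'; rewrite B1 B1' opprD.
have B0 m j l : B m j l = 0.
  have c m' j' l' : B m' j' l' = B j' l' m' by rewrite B2 B1 opprK.
  have := S1 m j l; have := S1 j l m; have := S1 l m j; have := B2' m j l.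
  rewrite -(c m j l) (c l m j) => e1 e2 e3 e4.
  (* B is invariant under rotation and B' has cyclic sum zero, so adding the rotations of B + B' = 0
     leaves 3 B = 0. *)
  have : B m j l *+ 3 = (B m j l + B' l m j) + (B m j l + B' j l m) + (B m j l + B' m j l)
     - (B' m j l + B' j l m + B' l m j) by ring.
  by rewrite e1 e2 e3 e4 !addr0 subr0 => /eqP; rewrite mulrn_eq0 => /eqP.
have B0' m j l : B' m j l = 0 by have := S1 m j l; rewrite B0 add0r.
by rewrite P0 rho0; split=> //; rewrite -[RHS](rho0 D E) -Qf0; congr rho; apply: eq_Qf => m l j; rewrite /cB ?B0 ?B0'.
Qed.

End FibreDecomposition.

(** * The kernel of the alternation map *)

Section FibreKernel.
Variables (R : realType) (V : lmodType R) (D : su_data V) (n : nat).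
Local Notation C := (R[i]).
Local Notation J := (bool * 'I_n)%type.
Local Notation I := (acs D).
Local Notation g := (met D).
Local Notation db i := (dcoord C (false, i)).
Local Notation Psi := (@Psi C n).
Local Notation psiJ := (@psiJ C n).
Variables (E : J -> V) (HE : sframe D E).
Local Notation rho := (@rho R V D n E).
Local Notation XiT := (@XiT C n).
Local Notation Pf := (@Pf C n).
Implicit Types (A : J -> 'I_n -> 'I_n -> C) (c : 'I_n -> 'I_n -> 'I_n -> C) (u w : 'I_n -> C).
Hypothesis n3 : (3 < n)%N.
Variable e : 'I_(n.*2) -> V.
Hypothesis ortho : forall e' : 'I_(n.*2) -> V, is_orthonormal D e' ->
  forall X Y, \sum_i g X (e' i) * g Y (e' i) = g X Y.
Hypothesis he : is_orthonormal D e.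
Let parseval := ortho he.

Let n1_gt0 : (0 < n - 1)%N. Proof. by lia. Qed.

Lemma pullback_ewedge (K : numFieldType) (h : V -> V) (a b : tensor K V) :
  pullback h (a ∧ b) = pullback h a ∧ pullback h b.
Proof.
apply/funext => s; elim: s a b => [|X s IH] a b; first by rewrite /pullback /= !ewedge_nil.
rewrite ewedge_cons /pullback map_cons ewedge_cons; congr (_ + _).
  exact: (IH (contract (h X) a) b).
apply: etrans (IH (sg a) (contract (h X) b)) _; congr (ewedge _ _ s).
by apply/funext => t; rewrite /sg /pullback size_map.
Qed.

Lemma pullback_contract h X (b : tensor R V) :
  contract X (pullback h b) = pullback h (contract (h X) b).
Proof. by []. Qed.

Lemma pullback_otimes h (a b : tensor R V) :
  pullback h (otimes a b) = otimes (pullback h a) (pullback h b).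
Proof. by apply/funext => s; rewrite /pullback /otimes map_take behead_map. Qed.

(** Both sides have the components [XiJ], in which no frame occurs. Pulling back by an isometry [h]
    replaces [e] by [h \o e], so equivariance of Xi needs this. *)
Lemma Xi_with_frame (e1 e2 : 'I_(n.*2) -> V) p a : multilinear p -> multilinear a ->
  is_orthonormal D e1 -> is_orthonormal D e2 -> Xi_with e1 p a = Xi_with e2 p a.
Proof.
move=> mp ma h1 h2; rewrite (rho_comp HE mp) (rho_comp HE ma).
have cr := comp_real HE mp.
by rewrite (Xi_with_rho HE (ortho h1)) // (Xi_with_rho HE (ortho h2)).
Qed.

Lemma psi_multilinear eps : multilinear (psi D eps).
Proof. by rewrite (psi_rho HE); exact: rho_multilinear. Qed.

Lemma Xi_pullback (h : {linear V -> V}) a : su_map D h -> multilinear a ->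
  Xi_plus D e (pullback h a) = pullback h (Xi_plus D e a).
Proof.
move=> [hg _ _ hm] ma; have ohe : is_orthonormal D (h \o e).
  by move=> i j; rewrite /= hg he.
rewrite /Xi_plus [in RHS](@Xi_with_frame _ (h \o e) _ _ (psi_multilinear false) ma he ohe).
apply/funext => -[|X s] //=; rewrite /pullback /= -{1}hm -/(pullback h _).
rewrite !scaleTE; congr (_ * _); rewrite !fct_sumE; apply: eq_bigr => i _.
rewrite !pullback_contract -[X in X s]pullback_ewedge.
by [].
Qed.

Lemma W4form_pullback (h : {linear V -> V}) mu : su_map D h ->
  W4form D e (pullback h mu) = pullback h (W4form D e mu).
Proof.
move=> [hg hI _ _]; apply/funext => -[|X s].
  by rewrite /pullback /= /W4form !fct_sumE; apply: eq_bigr => i _; rewrite /otimes /= !mul0r.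
rewrite -[LHS]/(contract X _ s) -[RHS]/(contract X _ s) pullback_contract.
rewrite !(W4form_contract HE parseval).
have fl Y : flat D Y = pullback h (flat D (h Y)).
  by apply/funext => -[|Z [|Z' t]] //; rewrite /pullback /= hg.
have Im : Iact D 0 (pullback h mu) = pullback h (Iact D 0 mu).
  apply/funext => -[|Y t]; first by rewrite /Iact /pullback.
  by rewrite Iact_cons0 /pullback map_cons Iact_cons0 /= hI.
rewrite Im (fl X) (fl (I X)) hI -!pullback_ewedge.
by [].
Qed.

(* nuA eps mu is the one-form for which the image of W4form mu and
   nuA eps mu (x) psi alternate to the same form. *)
Definition nuA (eps : bool) (mu : tensor R V) : tensor R V :=
  if eps then - (n - 1)%:R *: mu else (n - 1)%:R *: Iact D 0 mu.

(** The embedding of T^* whose image is the module A in the kernel: the W4 part and the W5 part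
    cancel under alternation. *)
Definition kerA eps (mu : tensor R V) : tensor R V :=
  Xi_plus D e (W4form D e mu) - otimes (nuA eps mu) (psi D (~~ eps)).

(** Origin of the two cases of [nuA]: once multiplied by 2 [av], the barred components are i (n - 1)
    mu for both signs, which is what the trace n - 1 of [A4] requires. *)
Lemma nuA_rho eps m : hom 1 m -> cj m = m -> exists m',
  [/\ hom 1 m', cj m' = m', nuA eps (rho m) = rho m' &
    forall l, 2 * av R (~~ eps) * m' [:: (false, l)] = 'i * (n - 1)%:R * m [:: (false, l)]].
Proof.
move=> hm mr; have nc : ((n - 1)%:R : C) = (((n - 1)%:R : R)%:C)%C by rewrite rmorph_nat.
case: eps; rewrite /nuA /av /=.
  exists (- (n - 1)%:R *: m); split; first exact: homZ.
  - by rewrite cjZ mr rmorphN rmorph_nat.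
  - by rewrite nc -rmorphN rhoZ.
  move=> l; rewrite scaleTE; have sq := sqrCi C.
  move: ('i : C) (neq0Ci C) sq ((n - 1)%:R : C) (m _) => i i0 sq x y.
  have -> : 2 * (2 * i)^-1 * (- x * y) = - (i ^+ 2)^-1 * (i * x * y) by field; exact: i0.
  by rewrite sq invrN1 opprK mul1r.
have [-> sr] := Iact0_rho HE hm mr.
exists ((n - 1)%:R *: slot 0 m); split.
- by apply: homZ; exact: slot_hom.
- by rewrite cjZ sr rmorph_nat.
- by rewrite nc rhoZ.
move=> l; rewrite scaleTE /slot /=.
by move: ('i : C) ((n - 1)%:R : C) (m _) => i x y; field.
Qed.

Lemma Xi_W4form m : hom 1 m -> cj m = m ->
  Xi_plus D e (W4form D e (rho m)) = rho (XiT (A4 (fun l => 2 * m [:: (false, l)]))).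
Proof. by move=> hm mr; rewrite (W4form_rho HE parseval) // (Xi_rho HE parseval). Qed.

Lemma alt_psi m eps : hom 1 m -> cj m = m ->
  alt (otimes (rho m) (psi D eps)) = rho (Pf (fun l => 2 * av R eps * m [:: (false, l)])).
Proof.
move=> hm mr; rewrite alt_otimes; last exact: rho_hom.
by rewrite (psi_rho HE) wedge_psiJ.
Qed.

Lemma alt_kerA eps mu : kforms 1%N mu -> alt (kerA eps mu) = 0.
Proof.
case/(form_rho HE) => m [hm sm mr ->]; rewrite /kerA.
have [m' [hm' mr' -> m'E]] := nuA_rho eps hm mr.
rewrite Xi_W4form // -scaleN1r altD altZ scaleN1r alt_psi // alt_Xi_A4 //.
apply/eqP; rewrite subr_eq0; apply/eqP; congr rho; apply: eq_Pf => l; rewrite m'E.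
have sq := sqrCi C; move: ('i : C) (neq0Ci C) sq ((n - 1)%:R : C) (m _) => i i0 sq x y.
have -> : - (2 * i)^-1 * (x * (2 * y)) = - (i ^+ 2)^-1 * (i * x * y) by field; exact: i0.
by rewrite sq invrN1 opprK mul1r.
Qed.

(** Evaluation at (x; z_1, ..., z_n): the form part of [XiT] has one barred argument, its conjugate
    n - 1, so both vanish there, while the second term gives m(x) times [av]. *)
Lemma Xi_psi_indep A m eps : hom 1 m -> cj m = m ->
  rho (XiT A) + otimes (rho m) (psi D eps) = 0 -> m = 0.
Proof.
move=> hm mr; rewrite (psi_rho HE) otimes_rho // -rhoD => /(rho_eq0 HE) e0.
apply/funext => s; have [|/hm//] := eqVneq (size s) 1%N.
case: s => [|x [|y s]] // _.
have n1 : (0 < n)%N by lia.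
have db0 j l (t : seq J) : nfalse t != 1%N -> (db l ∧ iz j Psi) t = 0.
  move=> nt; have := ty_ewedge (ty_db C l) (ty_izPsi R n3 j).
  by rewrite add1n subn1 prednK // => -[_ _]; exact.
have XT y t : nfalse t != 1%N -> XiT A (y :: t) = 0.
  move=> nt; rewrite /= scaleTE fct_sumE big1 ?mulr0 // => j _.
  by rewrite fct_sumE big1 // => l _; rewrite scaleTE db0 // mulr0.
have nz : nfalse (@ztop n) = 0%N by rewrite /nfalse /ztop count_map (@eq_count _ _ pred0) ?count_pred0.
have nz' : nfalse (map (@barJ n) (@ztop n)) = n.
  by have := nfalse_bar (@ztop n); rewrite nz addn0 size_map size_enum_ord.
have := congr1 (fun F => F (x :: @ztop n)) e0.
rewrite cjD !addTE XT ?nz // [cj (XiT A) _]/cj map_cons XT ?nz' ?rmorph0; last by lia.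
rewrite !add0r.
have -> : cj (otimes m (psiJ (av R eps))) = otimes m (psiJ (av R eps)).
  apply/funext => -[|y t]; rewrite /otimes -[in RHS]mr -[in RHS]psiJ_real /cj rmorphM //.
  by rewrite /= !take0.
have -> : otimes m (psiJ (av R eps)) (x :: @ztop n) = m [:: x] * av R eps.
  rewrite /otimes /= take0 /psiJ addTE !scaleTE Psi_ztop /cj.
  have [_ _ ->] := @ty_Psi C n; first by rewrite rmorph0 mulr0 addr0 mulr1.
  by rewrite nz'; lia.
by rewrite -mulr2n => /eqP; rewrite mulrn_eq0 mulf_eq0 (negPf (av_neq0 R eps)) orbF => /eqP.
Qed.

Let nR0' : (n - 1)%:R != 0 :> C. Proof. by rewrite pnatr_eq0 -lt0n. Qed.

Lemma hom1_real_eq0 m : hom 1 m -> cj m = m -> (forall l, m [:: (false, l)] = 0) ->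
  m = 0 :> tensor C J.
Proof.
move=> hm mr m0; apply/funext => -[|[[] l] [|y s]]; [by rewrite hm| |by rewrite hm|by rewrite m0|by rewrite hm].
by rewrite -mr /cj /= m0 rmorph0.
Qed.

Lemma kforms1_subspace : is_subspace (@kforms R V 1%N).
Proof.
split; first by rewrite -(rho0 D E); apply: rho_form => //; exact: skew0.
move=> c x y /(form_rho HE)[f [hf sf _ ->]] /(form_rho HE)[f' [hf' sf' _ ->]].
rewrite -rhoZ -rhoD; apply: rho_form => //.
  by apply: homD => //; exact: homZ.
by apply: skewD => //; exact: skewZ.
Qed.

Lemma otimesDl (c : R) (a b d : tensor R V) : otimes (c *: a + b) d = c *: otimes a d + otimes b d.
Proof. by apply/funext => s; rewrite addTE scaleTE /otimes addTE scaleTE mulrDl mulrA. Qed.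

Lemma Xi_with_linear p (c : R) (a b : tensor R V) :
  Xi_with e p (c *: a + b) = c *: Xi_with e p a + Xi_with e p b :> tensor R V.
Proof.
apply/funext => -[|X s]; rewrite addTE scaleTE /= ?mulr0 ?addr0 //.
rewrite !scaleTE mulrCA -mulrDr; congr (_ * _); rewrite !fct_sumE mulr_sumr -big_split.
by apply: eq_bigr => i _; rewrite !contractD !contractZ ewedgeDl ewedgeZl.
Qed.

Lemma Iact_linear k (c : R) a b : Iact D k (c *: a + b) = c *: Iact D k a + Iact D k b.
Proof. by apply/funext => s; rewrite addTE scaleTE /Iact addTE scaleTE opprD mulrN. Qed.

Lemma W4form_linear (c : R) a b : W4form D e (c *: a + b) = c *: W4form D e a + W4form D e b.
Proof.
apply/funext => -[|X s].
  rewrite addTE scaleTE /W4form !fct_sumE !big1 ?mulr0 ?addr0 // => i _;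
  by rewrite /otimes /= mul0r.
rewrite -[LHS]/(contract X _ s) -[RHS]/((c *: contract X _ + contract X _) s); congr (_ s).
rewrite !(W4form_contract HE parseval) Iact_linear !ewedgeDr !ewedgeZr scalerBr opprD.
by rewrite addrACA.
Qed.

Lemma nuA_linear eps (c : R) a b : nuA eps (c *: a + b) = c *: nuA eps a + nuA eps b.
Proof.
by case: eps; rewrite /nuA ?Iact_linear scalerDr !scalerA [c * _]mulrC.
Qed.

Lemma kerA_linear eps (c : R) a b : kerA eps (c *: a + b) = c *: kerA eps a + kerA eps b.
Proof.
rewrite /kerA W4form_linear /Xi_plus Xi_with_linear nuA_linear otimesDl scalerBr opprD.
by rewrite addrACA.
Qed.

Lemma kerA_pullback eps (h : {linear V -> V}) mu : su_map D h -> kforms 1%N mu ->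
  kerA eps (pullback h mu) = pullback h (kerA eps mu).
Proof.
move=> hh kmu; case: (hh) => hg hI hp hm; rewrite /kerA W4form_pullback // Xi_pullback //; last first.
  case: (form_rho HE kmu) => m [hm' _ mr ->].
  by rewrite (W4form_rho HE parseval) //; exact: rho_multilinear.
have -> : nuA eps (pullback h mu) = pullback h (nuA eps mu).
  rewrite /nuA; case: eps => //.
  have -> // : Iact D 0 (pullback h mu) = pullback h (Iact D 0 mu).
  apply/funext => -[|Y t]; first by rewrite /Iact /pullback.
  by rewrite Iact_cons0 /pullback map_cons Iact_cons0 /= hI.
have {1}-> : psi D (~~ eps) = pullback h (psi D (~~ eps)) by rewrite /psi; case: eps.
by rewrite -pullback_otimes.
Qed.

(** The W5 component alone determines mu. Taken with A = 0 this is injectivity of [kerA]; in general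
    it makes the sum with the image of W3 direct. *)
Lemma kerA_Xi A eps mu : kforms 1%N mu -> rho (XiT A) + kerA eps mu = 0 -> mu = 0.
Proof.
case/(form_rho HE) => m [hm sm mr ->]; have [m' [hm' mr' nE m'E]] := nuA_rho eps hm mr.
rewrite /kerA nE Xi_W4form // addrA -rhoD -XiTD => e0.
have m0 : - m' = 0.
  have hN : hom 1 (- m') by move=> s /hm' h; rewrite oppTE h oppr0.
  have rN : cj (- m') = - m' by rewrite cjN mr'.
  apply: (Xi_psi_indep hN rN (eps := ~~ eps)); last first.
    rewrite rhoN -scaleN1r -[_ *: rho m']addr0 otimesDl scaleN1r.
    have -> : otimes (0 : tensor R V) (psi D (~~ eps)) = 0.
      by apply/funext => s; rewrite /otimes mul0r.
    by rewrite addr0; exact: e0.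
rewrite (_ : m = 0) ?rho0 //; apply: hom1_real_eq0 => // l; have := m'E l.
rewrite -[m']opprK m0 oppr0 mulr0 => /esym/eqP.
by rewrite !mulf_eq0 (negPf (neq0Ci C)) (negPf nR0') => /eqP.
Qed.

Lemma W5_otimes eps t : W5 D eps t <-> exists2 mu, kforms 1%N mu & t = otimes mu (psi D eps).
Proof.
split=> [|[mu kmu ->]]; last by apply: sub_lin_span; exists mu => //; exists (psi D eps).
apply: (@lin_span_sub _ _ _ [set t | exists2 mu, kforms 1%N mu & t = otimes mu (psi D eps)]).
  have [k0 kD] := kforms1_subspace; split.
    by exists 0 => //; apply/funext => s; rewrite /otimes mul0r.
  move=> c _ _ [a ka ->] [b kb ->]; exists (c *: a + b); first exact: kD.
  by rewrite otimesDl.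
by move=> _ [mu kmu [_ -> <-]]; exists mu.
Qed.

End FibreKernel.

Section FibreKernelDecomposition.
Variables (R : realType) (V : lmodType R) (D : su_data V) (n : nat).
Local Notation C := (R[i]).
Local Notation J := (bool * 'I_n)%type.
Local Notation g := (met D).
Variables (E : J -> V) (HE : sframe D E).
Local Notation rho := (@rho R V D n E).
Local Notation XiT := (@XiT C n).
Implicit Types (A : J -> 'I_n -> 'I_n -> C) (c : 'I_n -> 'I_n -> 'I_n -> C) (u w : 'I_n -> C).
Hypothesis n3 : (3 < n)%N.
Variable e : 'I_(n.*2) -> V.
Hypothesis ortho : forall e' : 'I_(n.*2) -> V, is_orthonormal D e' ->
  forall X Y, \sum_i g X (e' i) * g Y (e' i) = g X Y.
Hypothesis he : is_orthonormal D e.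
Let parseval := ortho he.

Let n1_gt0 : (0 < n - 1)%N. Proof. by lia. Qed.

Local Notation kerA := (@kerA R V D n e).
Local Notation nuA := (@nuA R V D n).
Let nR0 : (n - 1)%:R != 0 :> C. Proof. by rewrite pnatr_eq0 -lt0n. Qed.

Let i20 : (2 * 'i)^-1 != 0 :> C.
Proof. by rewrite invr_eq0 mulf_neq0 ?neq0Ci ?pnatr_eq0. Qed.

Lemma iso_cotangent_kerA eps : iso_cotangent D (kerA eps @` kforms 1%N).
Proof.
have [k0 kD] := kforms1_subspace HE.
have kL := kerA_linear HE ortho he.
split.
  split; first by exists 0 => //; have := kL eps (-1) 0 0; rewrite scaler0 addr0 scaleN1r addNr.
  move=> a _ _ [x kx <-] [y ky <-]; exists (a *: x + y); first exact: kD.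
  exact: kL.
exists (kerA eps); split.
- split; first by move=> x kx; exists x.
    move=> x y /set_mem kx /set_mem ky exy.
    have kd : kforms 1%N (x - y) by rewrite addrC -scaleN1r; exact: kD.
    have : x - y = 0.
      apply: (kerA_Xi HE n3 ortho he (A := fun _ _ _ => 0) (eps := eps)) => //.
      by rewrite XiT0 rho0 add0r addrC -scaleN1r kL scaleN1r exy addNr.
    by move/eqP; rewrite subr_eq0 => /eqP.
  by move=> _ [x kx <-]; exists x.
- by move=> a x y kx ky; exact: kL.
- by move=> h mu hh kmu; exact: (kerA_pullback HE ortho he).
Qed.

Lemma kerA_sub eps :
  kerA eps @` kforms 1%N `<=` sum_space (WXi D e (W4 D e)) (W5 D (~~ eps)).
Proof.
move=> _ [mu kmu <-]; exists (Xi_plus D e (W4form D e mu)).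
  by exists (W4form D e mu) => //; exists mu.
exists (- otimes (nuA eps mu) (psi D (~~ eps))) => //.
apply/(W5_otimes HE); exists (- nuA eps mu).
  have [k0 kD] := kforms1_subspace HE.
  case: (form_rho HE kmu) => m [hm sm mr ->].
  have [m' [hm' mr' -> _]] := nuA_rho HE eps hm mr.
  rewrite -rhoN; apply: rho_form => //.
    by move=> s hs; rewrite oppTE hm' ?oppr0.
  have sk1 : skew m'.
    move=> s1 x y s2; have e2 (z w : J) : m' (s1 ++ z :: w :: s2) = 0.
      by rewrite hm' // size_cat /= !addnS.
    by rewrite !e2 oppr0.
  by rewrite -scaleN1r; exact: skewZ.
by apply/funext => s; rewrite oppTE /otimes oppTE mulNr.
Qed.

Lemma alt_ker_direct_sum eps :
  is_direct_sum [:: WXi D e (W3 D e); kerA eps @` kforms 1%N] (alt_ker D n eps).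
Proof.
have W3Xi t : WXi D e (W3 D e) t <-> exists2 B : 'I_n -> 'I_n -> 'I_n -> C,
    (forall m j l, B m j l = - B m l j) /\ (forall l, \sum_j B j j l = 0) &
    t = rho (XiT (fun x => if x.1 then B x.2 else fun _ _ => 0)).
  split=> [[a /(W3_rho HE parseval)[B HB ->] <-]|[B HB ->]].
    by rewrite (Xi_rho HE parseval); exists B.
  by rewrite -(Xi_rho HE parseval); eexists; last by []; apply/(W3_rho HE parseval); exists B.
have alt3 (B : 'I_n -> 'I_n -> 'I_n -> C) : (forall l, \sum_j B j j l = 0) ->
    alt (rho (XiT (fun x => if x.1 then B x.2 else fun _ _ => 0))) = 0.
  move=> B0; rewrite alt_rho_XiT Qf0 add0r Pf0 ?rho0 // => l.
  by rewrite /uC B0 mulr0.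
apply: direct_sum2 => [t|a b /W3Xi[B _ ->] [mu kmu <-] e0]; last first.
  have mu0 := kerA_Xi HE n3 ortho he kmu e0.
  have k0 : kerA eps mu = 0.
    by have := kerA_linear HE ortho he eps (-1) 0 0; rewrite mu0 scaler0 addr0 scaleN1r addNr.
  by rewrite k0 addr0 in e0.
split=> [[[_ /(WXi_total_rho HE n3)[A sA ->] [_ /(W5_otimes HE)[_ /(form_rho HE)[m [hm sm mr ->]] ->] <-]] a0]|].
  move: a0; rewrite altD alt_rho_XiT (alt_psi HE) // -rhoD.
  rewrite -addrA -PfD => /(rho_eq0 HE)/(QPf_real_eq0 n3)[Q0 P0].
  have Af m' j l : A (false, m') j l = 0.
    by move: m' j l; apply: Qf_cB_inj Q0 => m' j l; exact: sA.
  (* By [uC_A4] the array [A4 w] has the same trace as A in holomorphic directions, so the remainder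
     B below is traceless and belongs to W3. *)
  pose w l := (n - 1)%:R^-1 * \sum_j A (true, j) j l.
  have [f [hf sf fr fE]] := hom1_real (fun l => w l / 2).
  have f2 : (fun l => 2 * f [:: (false, l)]) = w.
    by apply/funext => l; rewrite fE mulrC divfK // pnatr_eq0.
  pose B m' j l := A (true, m') j l - A4 w (true, m') j l.
  have XA : XiT A = XiT (fun x => if x.1 then B x.2 else fun _ _ => 0) + XiT (A4 w).
    rewrite -XiTD; apply: eq_XiT => -[[] x] j l /=; first by rewrite subrK.
    by rewrite Af /A4 /= addr0.
  have kf : kforms 1%N (rho f) by exact: rho_form.
  exists (rho (XiT (fun x => if x.1 then B x.2 else fun _ _ => 0))), (kerA eps (rho f)).
  split.
  - apply/W3Xi; exists B => //; split=> [m' j l|l].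
      by rewrite /B (sA _ j l) (A4_skew w _ j l) opprK [RHS]opprB addrC.
    rewrite sumrB; apply/eqP; rewrite subr_eq0; apply/eqP.
    have := uC_A4 n3 w l; rewrite /uC => /(mulfI _) -> //; last by rewrite oppr_eq0.
    by rewrite /w mulrA mulfV // mul1r.
  - by exists (rho f).
  - have [m' [hm' mr' nE m'E]] := nuA_rho HE eps hf fr.
    rewrite /kerA nE (Xi_W4form HE ortho he) // f2 XA rhoD -addrA; congr (_ + (_ + _)).
    (* Vanishing of the (n, 1) part fixes the barred components of m, and these determine a real
       one-form. *)
    have mm : m = - m'.
      apply/eqP; rewrite -addr_eq0; apply/eqP/hom1_real_eq0.
      + exact: homD.
      + by rewrite cjD mr mr'.
      move=> l; have := Pf_eq0 P0 l; rewrite -/(uC _ _).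
      have -> : uC (fun m0 => A (true, m0)) l = 2 * av R (~~ eps) * m' [:: (false, l)].
        rewrite m'E fE /w /uC.
        have sq := sqrCi C; move: (\sum_j _) ('i : C) (neq0Ci C) sq => z i i0 sq.
        move: ((n - 1)%:R : C) nR0 => x x0.
        have -> : i * x * (x^-1 * z / 2) = - (i ^+ 2) * ((2 * i)^-1 * - z).
          by field; rewrite i0 x0.
        by rewrite sq opprK mul1r mulrN mulNr.
      rewrite -mulrDr => /eqP; rewrite !mulf_eq0 pnatr_eq0 (negPf (av_neq0 R _)) /=.
      by rewrite addrC => /eqP.
    rewrite mm rhoN -scaleN1r -[_ *: rho m']addr0 otimesDl scaleN1r.
    by rewrite (_ : otimes 0 _ = 0) ?addr0 //; apply/funext => s; rewrite /otimes mul0r.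
case=> a [b [/W3Xi[B [sB B0] ->] [mu kmu <-] ->]]; split; last first.
  by rewrite altD alt3 // (alt_kerA HE n3 ortho he) ?addr0.
have [m1 [a1 W4a1 m1E] [m2 m2W E2]] : sum_space (WXi D e (W4 D e)) (W5 D (~~ eps)) (kerA eps mu).
  by apply: kerA_sub; exists mu.
have /(W4_rho HE parseval)[w a1E] := W4a1; rewrite a1E in m1E.
set t0 := rho _; exists (t0 + m1).
  rewrite -m1E (Xi_rho HE parseval) /t0 -rhoD -XiTD; apply/(WXi_total_rho HE n3).
  eexists; last by reflexivity.
  move=> [[] x] j l /=; first by rewrite (sB _ j l) (A4_skew w _ j l) -opprD.
  by rewrite (A4_skew w _ j l) !add0r.
exists m2; first exact: m2W.
by rewrite -[LHS]addrA E2.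
Qed.

End FibreKernelDecomposition.

(** * The exterior derivative of the complex volume form *)

Section Torsion.
Variables (R : realType) (V : lmodType R) (D : su_data V) (n : nat).
Local Notation C := (R[i]).
Local Notation J := (bool * 'I_n)%type.
Local Notation I := (acs D).
Local Notation Psi := (@Psi C n).
Variables (E : J -> V) (HE : sframe D E).
Local Notation Th := (Th D E).
Local Notation dec := (lin_subst Th).
Local Notation rho := (@rho R V D n E).
Hypothesis n3 : (3 < n)%N.

Lemma hom_alt p (t : tensor C J) : hom p t -> hom p (alt t).
Proof.
move=> ht s hs; rewrite /alt big1 // => i _.
by rewrite ht ?mulr0 //= size_cat size_takel ?(ltnW (ltn_ord i)) // size_drop -addnS subnSK // subnKC // ltnW.
Qed.

Lemma skew_alt (t : tensor C J) : (forall x, skew (contract x t)) -> skew (alt t).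
Proof.
move=> st; rewrite alt_dcoord; apply: skew_sum => x _.
by apply: skew_ewedge; [exact: dcoord_skew|exact: st].
Qed.

(** The matrix of [Th] on the frame is inverted by [Nm], so real vectors separate complex
    components. *)
Lemma Th_separates (a : J -> C) : (forall Y, \sum_y Th Y y * a y = 0) -> forall x, a x = 0.
Proof.
move=> h x; have : \sum_y @Nm R n x y * (\sum_z Th (E y) z * a z) = 0.
  by apply: big1 => y _; rewrite h mulr0.
under eq_bigr => y _ do rewrite mulr_sumr.
rewrite exchange_big /=.
under eq_bigr => z _.
  under eq_bigr => y _ do rewrite mulrA.
  rewrite -mulr_suml (Nm_Th HE); over.
rewrite (bigD1 x) //= eqxx mul1r big1 ?addr0 // => z zx.
by rewrite eq_sym (negPf zx) mul0r.
Qed.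

(** One argument goes to the leading slot, so alternation raises the number of antiholomorphic
    arguments by at most one. *)
Lemma alt_nfalse (G : tensor C J) : (forall x s, (1 < nfalse s)%N -> G (x :: s) = 0) ->
  forall s, (2 < nfalse s)%N -> alt G s = 0.
Proof.
move=> h s hs; rewrite /alt big1 // => i _; rewrite h ?mulr0 //.
move: hs; rewrite -{1}(cat_take_drop i s) (drop_nth (tnth (in_tuple s) i)) //.
rewrite /nfalse !count_cat /= addnCA; case: (~~ _) => /=; lia.
Qed.

(** [tp] and [tm] stand for the derivatives of psi_+ and psi_- along the first argument and [I' X Y]
    for the derivative of I Y along X. The relations below are the product rule for psi_+(IY, ...) =
    -psi_-(Y, ...) and psi_-(IY, ...) = psi_+(Y, ...). *)
Variables (tp tm : tensor R V) (I' : V -> V -> V).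
Hypotheses (mp : multilinear tp) (mm : multilinear tm).
Hypotheses (hp : homogeneous n.+1 tp) (hm : homogeneous n.+1 tm).
Hypotheses (sp : forall X, skew (contract X tp)) (sm : forall X, skew (contract X tm)).
Hypothesis relp : forall X Y s,
  tp (X :: I Y :: s) + psi_plus D (I' X Y :: s) = - tm (X :: Y :: s).
Hypothesis relm : forall X Y s,
  tm (X :: I Y :: s) + psi_minus D (I' X Y :: s) = tp (X :: Y :: s).

Local Notation G := (comp E tp + 'i *: comp E tm).

Lemma dec_torsion : dec G = rc tp + 'i *: rc tm.
Proof. by rewrite decD decZ -!(rc_comp HE). Qed.

Lemma comp_contract_skew (t : tensor R V) x : (forall X, skew (contract X t)) ->
  skew (contract x (comp E t)).
Proof.
move=> st; rewrite /comp contract_dec; apply: dec_skew; apply: skew_sum => y _.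
apply: skewZ => s1 z w s2; rewrite /contract /rc /= !map_cat /=.
by rewrite -[t _]/(contract (E y) t _) st rmorphN.
Qed.

Lemma torsion_skew x : skew (contract x G).
Proof.
by rewrite contractD contractZ; apply: skewD; [|apply: skewZ]; exact: comp_contract_skew.
Qed.

(* The relations say that F = tp + i tm satisfies F(X, IY, ...) - i F(X, Y, ...) =
   - Psi(I' X Y, ...), whose right-hand side has only holomorphic arguments. *)
Lemma torsion_false j x s : (0 < nfalse s)%N -> G (x :: (false, j) :: s) = 0.
Proof.
move=> s0; move: x; apply: Th_separates => X.
pose GX := \sum_x Th X x *: contract x G.
(* For holomorphic y the relation has coefficient 0 and says nothing, so the array is padded by 0
   there before separating in Y. *)
suff h y : (if y.1 then 0 else GX (y :: s)) = 0.
  by rewrite -[RHS](h (false, j)) /GX fct_sumE; apply: eq_bigr => x _.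
move: y; apply: Th_separates => Y.
have e : dec (\sum_y (Th (I Y) y - 'i * Th Y y) *: contract y GX
             + \sum_y Th (I' X Y) y *: contract y Psi) = 0.
  have dG Z : dec (\sum_y Th Z y *: contract y GX) = fun s => rc tp (X :: Z :: s) + 'i * rc tm (X :: Z :: s).
    by rewrite -contract_dec -contract_dec dec_torsion.
  under eq_bigr => y _ do rewrite scalerBl -scalerA.
  rewrite sumrB -scaler_sumr !decD decN decZ !dG -contract_dec; apply/funext => t.
  rewrite !addTE oppTE scaleTE /contract (dec_Psi HE) /rc.
  rewrite complex_iE; have := relp X Y t => /(congr1 (fun a : R => (a%:C)%C : C)).
  rewrite rmorphD rmorphN /= => e1.
  have := relm X Y t => /(congr1 (fun a : R => (a%:C)%C : C)).
  rewrite rmorphD /= => e2.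
  move: e1 e2; set a := (_ %:C)%C; set b := (_ %:C)%C; set c := (_ %:C)%C.
  set d := (_ %:C)%C; set f := (_ %:C)%C; set h := (_ %:C)%C => e1 e2.
  have -> : a + 'i * d - 'i * (h + 'i * c) + (b + 'i * f) =
     (a + b) - 'i ^+ 2 * c + 'i * (d + f - h) by ring.
  by rewrite e1 e2 sqrCi; rewrite mulN1r opprK addNr subrr mulr0 addr0.
have := congr1 (fun f => f s) (dec_inj HE e).
(* The term with I' is a contraction of Psi at s, which already contains a barred index. *)
rewrite addTE [X in _ + X](_ : _ = 0) ?addr0; last first.
  rewrite fct_sumE big1 // => y _; case: (@ty_Psi C n) => _ _ tP.
  rewrite scaleTE /contract tP ?mulr0 // /nfalse /=.
  by rewrite -lt0n addn_gt0 [X in _ || X]s0 orbT.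
rewrite fct_sumE sumJ /= big1 ?add0r => [h|i _]; last first.
  by rewrite (ThI HE) subrr scale0r.
rewrite sumJ big1 ?add0r => [|i _]; last by rewrite mulr0.
(* I acts as -i on the barred coframe, so [Th (I Y) y - 'i * Th Y y] is -2i [Th Y y]. *)
apply: (@mulfI _ (-2 * 'i : C)); first by rewrite mulf_neq0 ?neq0Ci // oppr_eq0 pnatr_eq0.
rewrite mulr0 -[RHS]h mulr_sumr; apply: eq_bigr => i _ /=.
rewrite (ThI HE) /= scaleTE /contract; ring.
Qed.

(** One barred argument is moved to the front by skewness and another remains, so [torsion_false]
    applies. *)
Lemma torsion_nfalse x s : (1 < nfalse s)%N -> G (x :: s) = 0.
Proof.
move=> hs; have : has (fun x => ~~ x.1) s by rewrite has_count; exact: ltnW.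
case/hasP => -[b j] js /= b0; case: b b0 js => // _ /splitPr js.
case: js hs => s1 s2; rewrite /nfalse count_cat /= => hs.
rewrite -[G _]/(contract x G _) (skew_move _ _ _ (torsion_skew x)) /contract torsion_false ?mulr0 //.
by rewrite /nfalse count_cat; lia.
Qed.

Lemma torsion_Wa : Wa D n (alt tp) /\ Wa D n (alt tm).
Proof.
have hG : hom n.+1 G by apply: homD; [|apply: homZ]; exact: comp_hom.
have key k : Wa D n (alt (rho (k *: G))).
  rewrite alt_rho; apply/(Wa_rho HE n3).
  have n0 : (0 < n)%N by exact: ltn_trans n3.
  have [||s hs|c [u e]] := @expand_QPf _ n (alt (k *: G)) n0.
  - by apply: hom_alt; exact: homZ.
  - by apply: skew_alt => x; rewrite contractZ; apply: skewZ; exact: torsion_skew.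
  - by rewrite altZ scaleTE (alt_nfalse torsion_nfalse) ?mulr0.
  by exists c, u; rewrite e.
split.
  have -> : tp = rho (1 *: G); last exact: key.
  by rewrite scale1r /rho dec_torsion; apply/funext => s; rewrite /rep addTE scaleTE /rc -complex_iE.
(* An imaginary part is the real part after multiplication by -i. *)
have -> : tm = rho (- 'i *: G); last exact: key.
rewrite /rho decZ dec_torsion; apply/funext => s.
rewrite /rep.
have -> : (- 'i *: (rc tp + 'i *: rc tm)) s = rc tm s + 'i * - rc tp s.
  rewrite scaleTE addTE scaleTE; move: (rc tp s) (rc tm s) => a b.
  have -> : - 'i * (a + 'i * b) = - 'i ^+ 2 * b + 'i * - a by ring.
  by rewrite sqrCi opprK mul1r.
by rewrite /rc -rmorphN -complex_iE.
Qed.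

End Torsion.

(** * Linearity of directional derivatives in the direction *)

Section DirectionalDerivatives.
Variables (R : realType) (V : normedModType R).
Implicit Types (f : V -> R) (p v x X Y : V).

(** The two difference quotients are the same function, which gives access to the one-variable chain
    rule and mean value theorem. *)
Lemma is_derive_line f p v (t d : R) :
  is_derive (t *: v + p) v f d <-> is_derive t (1 : R) (fun s => f (s *: v + p)) d.
Proof.
have e : (fun h : R => h^-1 *: ((f \o shift (t *: v + p)) (h *: v) - f (t *: v + p))) =
  (fun h => h^-1 *: (((fun s : R => f (s *: v + p)) \o shift t) (h *: 1) - f (t *: v + p))).
  by apply/funext => h /=; rewrite scalerDl addrA [h *: 1]mulr1.
by split=> -[df dE]; apply: DeriveDef; move: df dE; rewrite /derivable /derive e.
Qed.

Lemma is_derive_scale f x v (k d : R) : is_derive x v f d -> is_derive x (k *: v) f (k * d).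
Proof.
have e0 w : x = 0 *: w + x by rewrite scale0r add0r.
rewrite (e0 v) => /is_derive_line df; rewrite -(e0 v) (e0 (k *: v)); apply/is_derive_line.
have -> : (fun s => f (s *: (k *: v) + x)) = (fun s => f (s *: v + x)) \o ( *%R^~ k).
  by apply/funext => s /=; rewrite scalerA.
rewrite mulrC; apply: is_derive1_comp; first by rewrite mul0r.
have h : is_derive (0 : R) (1 : R) (id * cst k) _ :=
  @is_deriveM _ R^o id (cst k) 0 1 _ _ (is_derive_id _ _) (is_derive_cst _ _ _).
by apply: (is_derive_eq h); rewrite scaler0 add0r [_ *: _]mulr1.
Qed.

(* Mean value theorem for t |-> f (t h Y + h X + x0) on [0, 1]. *)
Lemma is_derive_add f x0 X Y : derivable f x0 X -> (\forall x \near x0, derivable f x Y) ->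
  {for x0, continuous ('D_Y f)} -> is_derive x0 (X + Y) f ('D_X f x0 + 'D_Y f x0).
Proof.
move=> fX fY cY.
suff lim : h^-1 *: ((f \o shift x0) (h *: (X + Y)) - f x0) @[h --> 0^'] --> 'D_X f x0 + 'D_Y f x0.
  by apply: DeriveDef; [exact: cvgP lim|exact: cvg_lim lim].
(* The increment goes first along hX, then along hY from a base point that moves with h; the second
   quotient is controlled by continuity of the derivative along Y. *)
have -> : (fun h : R => h^-1 *: ((f \o shift x0) (h *: (X + Y)) - f x0)) =
   (fun h => h^-1 *: ((f \o shift x0) (h *: X) - f x0)) +
   (fun h => h^-1 *: (f (h *: Y + (h *: X + x0)) - f (h *: X + x0))).
  apply/funext => h; rewrite /= -[RHS]/(_ + _) -scalerDr; congr (_ *: _).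
  by rewrite scalerDr addrC [in RHS]addrC addrA subrK (addrC (h *: X)) addrA addrC.
apply: cvgD; first exact: fX.
apply/cvgrPdist_lt => e e0.
have /cvgrPdist_lt/(_ e e0) cYe := cY.
have /nbhs_normP [r /= r0 xr] : \forall x \near x0, derivable f x Y /\ `|'D_Y f x0 - 'D_Y f x| < e.
  by apply: filterI.
near=> h.
have h0 : h != 0 by near: h; exact: nbhs_dnbhs_neq.
have hr : `|h| * (`|X| + `|Y|) < r.
  near: h; apply: nbhs_dnbhs.
  have : (fun h : R => `|h| * (`|X| + `|Y|)) h @[h --> (0 : R)] --> `|0 : R| * (`|X| + `|Y|).
    by apply: cvgM; [apply: cvg_norm; exact: cvg_id|exact: cvg_cst].
  by rewrite normr0 mul0r => /cvgrPdist_lt/(_ r r0); apply: filterS => t; rewrite sub0r normrN; apply: le_lt_trans; exact: ler_norm.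
have xt (t : R) : 0 <= t <= 1 -> derivable f (t *: (h *: Y) + (h *: X + x0)) Y /\
    `|'D_Y f x0 - 'D_Y f (t *: (h *: Y) + (h *: X + x0))| < e.
  case/andP => t0 t1; apply: xr; rewrite /ball_ /= addrA opprD addrCA subrr addr0.
  rewrite normrN (le_lt_trans (ler_normD _ _)) // !normrZ (le_lt_trans _ hr) //.
  rewrite addrC mulrDr lerD2l mulrA ler_wpM2r // ler_piMl // ger0_norm //.
pose phi t := f (t *: (h *: Y) + (h *: X + x0)).
pose dphi t := h * 'D_Y f (t *: (h *: Y) + (h *: X + x0)).
have dp (t : R) : t \in `[0, 1]%R -> is_derive t (1 : R) phi (dphi t).
  rewrite in_itv /= => /xt[dft _]; apply/is_derive_line/is_derive_scale.
  exact: derivableP.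
have dp' (t : R) : t \in `]0, 1[%R -> is_derive t (1 : R) phi (dphi t).
  by move=> /subset_itv_oo_cc; exact: dp.
have cp : {within `[0, 1], continuous phi}.
  by apply: derivable_within_continuous => t /dp [].
have [c cI] := MVT_segment ler01 dp' cp.
rewrite /phi scale1r scale0r add0r subr0 mulr1 => ->.
rewrite /dphi -[h^-1 *: _]/(h^-1 * _) mulKf //.
by case: (xt c) => //; rewrite in_itv in cI.
Unshelve. all: by end_near.
Qed.

End DirectionalDerivatives.

Section TypeOfPsi.
Variables (R : realType) (V : lmodType R) (D : su_data V) (n : nat).
Local Notation C := (R[i]).
Local Notation J := (bool * 'I_n)%type.
Local Notation I := (acs D).
Local Notation Psi := (@Psi C n).
Variables (E : J -> V) (HE : sframe D E).
Local Notation Th := (Th D E).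
Local Notation dec := (lin_subst Th).

Lemma psi_acs Y s : psi_plus D (I Y :: s) = - psi_minus D (Y :: s) /\
                    psi_minus D (I Y :: s) = psi_plus D (Y :: s).
Proof.
have : dec Psi (I Y :: s) = 'i * dec Psi (Y :: s).
  rewrite !dec_cons mulr_sumr; apply: eq_bigr => -[b i] _; rewrite (ThI HE) /=.
  case: b; first by rewrite mulrA.
  by rewrite (ty0_ib i (@ty_Psi C n)) dec0 !mulr0.
by rewrite !(dec_Psi HE) -complexiE; simpc => -[-> ->].
Qed.

End TypeOfPsi.

(** * The derivative of psi in a chart *)

Section LocalForms.
Variables (R : realType) (m n : nat).
Local Notation V := 'rV[R]_m.
Variables (U : set V) (openU : open U).
Implicit Types (f g : V -> R) (x X Y : V) (s : seq V).

Lemma smooth_derivable f x X : smooth_on U f -> U x -> derivable f x X.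
Proof. by move=> /(_ 1%N) [_ /(_ X) [df _]]; exact: df. Qed.

Lemma smooth_derive_linear f x (c : R) X Y : smooth_on U f -> U x ->
  'D_(c *: X + Y) f x = c * 'D_X f x + 'D_Y f x.
Proof.
move=> sf Ux; have := is_derive_scale c (derivableP (@smooth_derivable f x X sf Ux)).
case=> dc ec; rewrite -ec; apply: derive_val; apply: is_derive_add => //.
  by near=> y; apply: smooth_derivable => //; near: y; exact: open_nbhs_nbhs.
by have [_ /(_ Y) [_ [cf _]]] := sf 1%N; exact: cf.
Unshelve. all: by end_near.
Qed.

Lemma eq_derive_on f g x X : {in U, f =1 g} -> U x -> 'D_X f x = 'D_X g x.
Proof.
move=> fg Ux; apply: near_eq_derive; near=> y; apply: fg; apply/mem_set.
by near: y; exact: open_nbhs_nbhs.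
Unshelve. all: by end_near.
Qed.

Variables (D : V -> su_data V).
Hypothesis psi_smoothU : forall eps s, smooth_on U (fun x => psi (D x) eps s).
Hypothesis acs_smoothU : forall X i, smooth_on U (fun x => acs (D x) X 0 i).
Hypothesis psi_form : forall x eps, U x -> kforms n (psi (D x) eps).
Hypothesis psi_type : forall x Y s, U x ->
  psi_plus (D x) (acs (D x) Y :: s) = - psi_minus (D x) (Y :: s) /\
  psi_minus (D x) (acs (D x) Y :: s) = psi_plus (D x) (Y :: s).
Variables (x : V) (Ux : U x).

(** The coordinate derivative of psi, not a covariant one; its alternation is [ext_deriv], and the
    product rule is all that [torsion_Wa] asks of it. *)
Definition dpsi eps : tensor R V := fun s =>
  if s is X :: s' then 'D_X (fun y => psi (D y) eps s') x else 0.

Let dpsi_derivable eps X s : derivable (fun y => psi (D y) eps s) x X.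
Proof. exact: smooth_derivable. Qed.

Lemma dpsi_hom eps : homogeneous n.+1 (dpsi eps).
Proof.
case=> [|X s] //= hs; rewrite (@eq_derive_on _ (cst 0)) ?derive_cst // => y /set_mem Uy.
by have [h _ _] := psi_form eps Uy; rewrite h.
Qed.

Lemma dpsi_multilinear eps : multilinear (dpsi eps).
Proof.
case=> [|Z s1] s2 c X Y /=; first exact: smooth_derive_linear.
rewrite (@eq_derive_on _ ((c \*: (fun y => psi (D y) eps (s1 ++ X :: s2))) +
                         (fun y => psi (D y) eps (s1 ++ Y :: s2)))) //; last first.
  by move=> y /set_mem Uy; have [_ ml _] := psi_form eps Uy; exact: ml.
rewrite deriveD //; last exact: derivableZ.
by rewrite deriveZ.
Qed.

Lemma dpsi_skew eps X : skew (contract X (dpsi eps)).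
Proof.
move=> s1 Y Z s2; rewrite /contract /= -deriveN //; apply: eq_derive_on => // y /set_mem Uy.
by have [_ ml al] := psi_form eps Uy; exact: alternating_skew.
Qed.

Definition dacs X Y : V := \row_i 'D_X (fun y => acs (D y) Y 0 i) x.

(** Both I Y and its derivative are expanded in the standard basis, whose vectors are constant, so
    the product rule for real functions applies to each coordinate. *)
Lemma dpsi_acs eps X Y s : dpsi eps (X :: acs (D x) Y :: s) + psi (D x) eps (dacs X Y :: s) =
  'D_X (fun y => psi (D y) eps (acs (D y) Y :: s)) x.
Proof.
pose h i : V -> R := (fun y => acs (D y) Y 0 i) * (fun y => psi (D y) eps (delta_mx 0 i :: s)).
rewrite (@eq_derive_on _ (\sum_i h i)) //; last first.
  move=> y /set_mem Uy; rewrite [in LHS](row_sum_delta (acs (D y) Y)) fct_sumE.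
  by have [_ ml _] := psi_form eps Uy; rewrite (@multilinear_sum _ _ _ _ _ _ _ _ [::] s ml).
rewrite derive_sum => [|i]; last by apply: derivableM => //; exact: smooth_derivable.
rewrite [in LHS](row_sum_delta (acs (D x) Y)) [in LHS](row_sum_delta (dacs X Y)).
have [_ ml _] := psi_form eps Ux; rewrite (@multilinear_sum _ _ _ _ _ _ _ _ [::] s ml).
rewrite (@multilinear_sum _ _ _ _ _ _ _ _ [:: X] s (@dpsi_multilinear eps)) -big_split.
apply: eq_bigr => i _; rewrite deriveM //; last exact: smooth_derivable.
by rewrite mxE [X in _ + X]mulrC.
Qed.

Lemma dpsi_acs_plus X Y s : dpsi true (X :: acs (D x) Y :: s) + psi_plus (D x) (dacs X Y :: s) =
  - dpsi false (X :: Y :: s).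
Proof.
rewrite (dpsi_acs true) /= -deriveN; last exact: (@dpsi_derivable false X (Y :: s)).
apply: eq_derive_on => // y /set_mem Uy.
by case: (psi_type Y s Uy).
Qed.

Lemma dpsi_acs_minus X Y s : dpsi false (X :: acs (D x) Y :: s) + psi_minus (D x) (dacs X Y :: s) =
  dpsi true (X :: Y :: s).
Proof.
rewrite (dpsi_acs false) /=; apply: eq_derive_on => // y /set_mem Uy.
by case: (psi_type Y s Uy).
Qed.

Lemma ext_deriv_Wa (E : bool * 'I_n -> V) eps : sframe (D x) E -> (3 < n)%N ->
  Wa (D x) n (ext_deriv (fun y => psi (D y) eps) x).
Proof.
move=> HE n3; have [Wp Wm] := torsion_Wa HE n3 (@dpsi_multilinear true) (@dpsi_multilinear false)
  (@dpsi_hom true) (@dpsi_hom false) (@dpsi_skew true) (@dpsi_skew false) dpsi_acs_plus dpsi_acs_minus.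
by case: eps.
Qed.

End LocalForms.

(** * Orthonormal families as bases *)

Section OrthonormalFrames.
Variables (R : realType) (m : nat).
Local Notation V := 'rV[R]_m.
Variable (g : V -> V -> R).
Hypothesis gL : forall c X Y Z, g (c *: X + Y) Z = c * g X Z + g Y Z.
Hypothesis gC : forall X Y, g X Y = g Y X.

Lemma form_sum (I : Type) (r : seq I) (c : I -> R) (F : I -> V) Z :
  g (\sum_(i <- r) c i *: F i) Z = \sum_(i <- r) c i * g (F i) Z.
Proof.
have g0 : g 0 Z = 0 by rewrite -[0](addNr 0) -scaleN1r gL mulN1r addNr.
by elim/big_rec2: _ => [|i x y _ <-] //; rewrite gL.
Qed.

(** Orthonormality says that the matrix of the vectors has a right inverse; as it is square it is
    invertible, so the vectors span. *)
Lemma orthonormal_expand (K : finType) (E : K -> V) : #|K| = m ->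
  (forall x y, g (E x) (E y) = (x == y)%:R) -> forall X, X = \sum_x g (E x) X *: E x.
Proof.
(* The dimension is replaced by the cardinality of [K], so that [P] is a square matrix by its
   type. *)
move=> eK; case: m / eK g gL gC form_sum E => g' gL' gC' form_sum' E ortho X.
pose P : 'M[R]_#|K| := \matrix_i E (enum_val i).
pose Q : 'M[R]_#|K| := \matrix_(k, j) g' (delta_mx 0 k) (E (enum_val j)).
have PQ : P *m Q = 1%:M.
  apply/matrixP => i j; rewrite !mxE -[RHS]/((i == j)%:R) -(inj_eq enum_val_inj) -ortho.
  rewrite [in RHS](row_sum_delta (E (enum_val i))) form_sum'.
  by apply: eq_bigr => k _; rewrite !mxE.
have [Pu _] := mulmx1_unit PQ.
have eX : X = \sum_x (X *m invmx P) 0 (enum_rank x) *: E x.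
  rewrite -{1}(mulmxKV Pu X) mulmx_sum_row (reindex (@enum_rank K)) /=; last first.
    by exists enum_val => x _; rewrite ?enum_rankK ?enum_valK.
  by apply: eq_bigr => x _; rewrite rowK enum_rankK.
rewrite {1}eX; apply: eq_bigr => x _; congr (_ *: _).
rewrite gC' {2}eX form_sum' (bigD1 x) //= ortho eqxx mulr1 big1 ?addr0 // => y yx.
by rewrite ortho (negPf yx) mulr0.
Qed.

Lemma parseval (K : finType) (E : K -> V) : #|K| = m ->
  (forall x y, g (E x) (E y) = (x == y)%:R) ->
  forall X Y, \sum_x g X (E x) * g Y (E x) = g X Y.
Proof.
move=> eK ortho X Y; rewrite [in RHS](orthonormal_expand eK ortho X) form_sum.
by apply: eq_bigr => x _; rewrite (gC X) (gC Y).
Qed.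

End OrthonormalFrames.

Lemma su_fibre_sframe (R : realType) (n : nat) (D : su_data 'rV[R]_(n.*2)) :
  su_fibre D n -> exists E : bool * 'I_n -> 'rV[R]_(n.*2), sframe D E.
Proof.
case=> gL gC _ IL [IK gI _ _ [e [ee eI epsi]]].
pose E (x : bool * 'I_n) := if x.1 then e x.2 else acs D (e x.2).
have gE x y : met D (E x) (E y) = (x == y)%:R.
  case: x y => -[] i [[] j]; rewrite /E xpair_eqE /=.
  - exact: ee.
  - exact: eI.
  - by rewrite gC eI.
  - by rewrite gI; exact: ee.
exists E; split=> //; apply: orthonormal_expand => //.
by rewrite card_prod card_bool card_ord mul2n.
Qed.

Theorem corollary2p5 (R : realType) (n : nat) (hn : (4 <= n)%N)
    (M : manifold R n.*2) (S : su_structure M)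
    (c : chart M) (p : M) (hp : chart_dom c p)
    (e : 'I_(n.*2) -> 'rV[R]_(n.*2))
    (he : is_orthonormal (su_at S c (chart_coord c p)) e) :
  let D := su_at S c (chart_coord c p) in
  let d_psi (eps : bool) := ext_deriv (fun x => psi (su_at S c x) eps) (chart_coord c p) in
  [/\ (forall eps : bool, Wa D n (d_psi eps)),
      is_direct_sum [:: W1a D n; W2a D e true; W45a D true] (Wa D n),
      [/\ alt @` WXi D e (W1 D) = W1a D n,
          alt @` WXi D e (W2 D) = W2a D e true,
          alt @` WXi D e (W4 D e) = W45a D true
        & forall eps : bool, alt @` W5 D (~~ eps) = W45a D true],
      (forall eps : bool, exists A : set (tensor R 'rV[R]_(n.*2)),
         [/\ iso_cotangent D A,
             A `<=` sum_space (WXi D e (W4 D e)) (W5 D (~~ eps))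
           & is_direct_sum [:: WXi D e (W3 D e); A] (alt_ker D n eps)])
    & [/\ W2a D e true = W2a D e false,
          W45a D true = W45a D false
        & W45a D true = lam_wedge_om D (n - 1)%N]].
Proof.
move=> D d_psi; have fib := su_at_fibre S hp; rewrite -/D in he fib.
have [E HE] := su_fibre_sframe fib; have [gL gC _ _ _] := fib.
(* Stated for every orthonormal frame, because the equivariance of Xi compares [e] with its image
   under an element of SU(n). *)
have ortho (e' : 'I_n.*2 -> _) : is_orthonormal D e' ->
    forall X Y, \sum_i met D X (e' i) * met D Y (e' i) = met D X Y.
  by move=> he'; apply: parseval => //; rewrite card_ord.
have pars := ortho e he; split.
- move=> eps; apply: (@ext_deriv_Wa _ _ n (chart_coord c @` chart_dom c) _ _ _ _ _ _ _ _ E) => //.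
  + exact: chart_coord_open.
  + exact: psi_smooth.
  + exact: acs_smooth.
  + by move=> _ sg [q hq <-]; have [_ _ _ _ [_ _ fp fm _]] := su_at_fibre S hq; case: sg.
  + move=> _ Y s [q hq <-]; have [Eq HEq] := su_fibre_sframe (su_at_fibre S hq).
    exact: psi_acs HEq Y s.
- exact: (Wa_direct_sum HE hn pars).
- split; [exact: (alt_WXi_W1 HE hn pars)|exact: (alt_WXi_W2 HE hn pars)| |].
  + exact: (alt_WXi_W4 HE hn pars).
  + by move=> eps; exact: (alt_W5 HE).
- move=> eps; exists (kerA D e eps @` kforms 1%N); split.
  + exact (iso_cotangent_kerA HE hn ortho he eps).
  + exact: (kerA_sub HE).
  + exact (alt_ker_direct_sum HE hn ortho he eps).
have sets (A B : set (tensor R 'rV[R]_(n.*2))) : (forall b, A b <-> B b) -> A = B.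
  by move=> AB; apply/seteqP; split=> b /AB.
split; apply: sets => b.
- by rewrite (W2a_rho HE hn pars true) (W2a_rho HE hn pars false).
- by rewrite (W45a_rho HE true) (W45a_rho HE false).
- by rewrite (W45a_rho HE true) (lam_wedge_om_rho HE hn).
Qed.
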